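(* Let $p>0$, let $(\mathbb{L},\mathcal{L},\lambda)$ be a Borel space with an atomless $\sigma$-finite Borel measure $\lambda$, and let $S$ denote the Gamma integral on it. Consider measurable functions $f\in L^0(\mathbb{L},\mathcal{L},\lambda)$ for which $Sf$ exists. (i) If $\lambda(\operatorname{supp} f)<\infty$, then there exist positive constants $c,C$, depending only on $p$ and $\lambda(\operatorname{supp} f)$, such that $$c\,\|f\|_p\le\|Sf\|_p\le C\,\|f\|_p .$$ (ii) Consequently, $\mathbb{E}|Sf|^p<\infty$ if and only if for any or some $c,c'>0$ (i.e. the condition for some pair $c,c'>0$ is equivalent to the condition for all pairs $c,c'>0$, and to $\mathbb{E}|Sf|^p<\infty$) $$\text{(a)}\ \int_{\mathbb{L}}|f|\,1_{\{|f|\le c\}}\,d\lambda<\infty\quad\text{and}\quad\text{(b)}\ \int_{\mathbb{L}}|f|^p\,1_{\{|f|>c'\}}\,d\lambda<\infty .$$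
   Context: Let $E_1(v)=\int_v^\infty e^{-x}\frac{dx}{x}$ for $v>0$ and let $H=E_1^{-1}:(0,\infty)\to(0,\infty)$ be its inverse function. Let $(\tau_n)_{n\ge1}$ be the arrival times of a unit intensity Poisson process on $[0,\infty)$, and let $(U_n)_{n\ge1}$ be i.i.d. random elements of $\mathbb{L}$, independent of $(\tau_n)$, whose distribution has a strictly positive density $q$ with respect to $\lambda$. The Gamma integral of a measurable real function $f$ on $\mathbb{L}$ is $$Sf=\sum_n H\big(\tau_n\,q(U_n)\big)\,f(U_n),$$ and $Sf$ exists if this series is a.s. (absolutely) summable, equivalently if $\int_{\mathbb{L}}\ln(1+|f|)\,d\lambda<\infty$. Its characteristic function is $\mathbb{E}e^{i\theta Sf}=\exp\{-\frac12\int\ln(1+\theta^2f^2)\,d\lambda+i\int\arctan(\theta f)\,d\lambda\}$. On $\mathbb{L}=\mathbb{R}_+$ with Lebesgue measure, $Sf=\int f\,dS_t$ for the standard Gamma process $S_t$. Here $\operatorname{supp}f=\{f\ne0\}$. For $p\ge1$, $\|f\|_p=(\int|f|^p\,d\lambda)^{1/p}$ and $\|X\|_p=(\mathbb{E}|X|^p)^{1/p}$ (norms); for $0<p<1$, $\|f\|_p=\int|f|^p\,d\lambda$ and $\|X\|_p=\mathbb{E}|X|^p$ (F-norms). Values may be $+\infty$. *)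

(* Defs.v *)
From HB Require Import structures.
From mathcomp Require Import all_boot all_order all_algebra.
From mathcomp Require Import all_classical all_reals all_analysis.

Set Implicit Arguments.
Unset Strict Implicit.
Unset Printing Implicit Defensive.

Import Order.TTheory GRing.Theory Num.Theory.
Import numFieldNormedType.Exports.

Local Open Scope classical_set_scope.
Local Open Scope ring_scope.

(* [phi] is a Borel isomorphism of [L] onto the Borel subset [range phi] of the
   real line: its inverse is measurable because [phi] maps measurable sets to
   Borel sets. *)
Definition Borel_space (R : realType) (d : measure_display)
    (L : measurableType d) : Prop :=
  exists phi : L -> R,
    [/\ injective phi, measurable_fun [set: L] phi
      & forall A : set L, measurable A -> measurable (phi @` A)].

Definition atomless (R : realType) (d : measure_display)
    (L : measurableType d) (lam : {measure set L -> \bar R}) : Prop :=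
  forall A : set L, measurable A -> (0 < lam A)%E ->
    exists B : set L,
      [/\ measurable B, B `<=` A, (0 < lam B)%E & (lam B < lam A)%E].

Definition mutually_independent (R : realType) (dO dT : measure_display)
    (Omega : measurableType dO) (T : measurableType dT)
    (P : probability Omega R) (X : nat -> Omega -> T) : Prop :=
  forall (J : seq nat) (A : nat -> set T),
    uniq J -> (forall i, measurable (A i)) ->
    P (\bigcap_(i in [set` J]) (X i @^-1` A i)) =
      (\prod_(i <- J) P (X i @^-1` A i))%E.

Definition sigma_of_sequence (dO dT : measure_display)
    (Omega : measurableType dO) (T : measurableType dT)
    (X : nat -> Omega -> T) : set (set Omega) :=
  <<s [set B | exists n (A : set T), measurable A /\ B = X n @^-1` A] >>.

Definition independent_sequences (R : realType) (dO dT dT' : measure_display)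
    (Omega : measurableType dO) (T : measurableType dT)
    (T' : measurableType dT') (P : probability Omega R)
    (X : nat -> Omega -> T) (Y : nat -> Omega -> T') : Prop :=
  forall A B : set Omega,
    sigma_of_sequence X A -> sigma_of_sequence Y B ->
    P (A `&` B) = (P A * P B)%E.

(* Arrival times are numbered from 0, so the first gap is measured from the
   origin of time. *)
Definition interarrival (R : realType) (Omega : Type) (tau : nat -> Omega -> R)
    (n : nat) (w : Omega) : R :=
  if n is m.+1 then tau n w - tau m w else tau 0%N w.

Definition unit_Poisson_arrivals (R : realType) (dO : measure_display)
    (Omega : measurableType dO) (P : probability Omega R)
    (tau : nat -> {RV P >-> R}) : Prop :=
  mutually_independent P (interarrival tau) /\
  forall n (A : set R), measurable A ->
    P (interarrival tau n @^-1` A) = exponential_prob 1 A.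

Definition iid_with_density (R : realType) (dL dO : measure_display)
    (L : measurableType dL) (Omega : measurableType dO)
    (lam : {measure set L -> \bar R}) (P : probability Omega R) (q : L -> R)
    (U : nat -> {RV P >-> L}) : Prop :=
  mutually_independent P U /\
  forall n (A : set L), measurable A ->
    distribution P (U n) A = (\int[lam]_(x in A) (q x)%:E)%E.

Record gamma_representation (R : realType) (dL dO : measure_display)
    (L : measurableType dL) (Omega : measurableType dO)
    (lam : {measure set L -> \bar R}) (P : probability Omega R) (q : L -> R)
    (tau : nat -> {RV P >-> R}) (U : nat -> {RV P >-> L}) : Prop := {
  density_measurable : measurable_fun [set: L] q;
  density_gt0 : forall x, 0 < q x;
  arrivals_Poisson : unit_Poisson_arrivals tau;
  marks_iid : iid_with_density lam q U;
  arrivals_marks_independent : independent_sequences P tau U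
}.

Definition E1 (R : realType) (v : R) : \bar R :=
  (\int[lebesgue_measure]_(x in `]v, +oo[) (expR (- x) / x)%:E)%E.

(* [E1] is a decreasing bijection of ]0, +oo[ onto itself, so the value is the
   unique preimage for [0 < u]; for [u <= 0] it is a junk value. *)
Definition E1_inv (R : realType) (u : R) : R :=
  get [set v : R | 0 < v /\ E1 v = u%:E].

Section gamma_integral.
Context (R : realType) (dL : measure_display) (L : measurableType dL).
Context (Omega : Type) (q : L -> R).
Context (tau : nat -> Omega -> R) (U : nat -> Omega -> L) (f : L -> R).

Definition gamma_term (w : Omega) (n : nat) : R :=
  E1_inv (tau n w * q (U n w)) * f (U n w).

Definition gamma_integral (w : Omega) : R := limn (series (gamma_term w)).

End gamma_integral.

Definition gamma_integral_exists (R : realType) (dL dO : measure_display)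
    (L : measurableType dL) (Omega : measurableType dO)
    (P : probability Omega R) (q : L -> R) (tau : nat -> Omega -> R)
    (U : nat -> Omega -> L) (f : L -> R) : Prop :=
  {ae P, forall w, cvgn [normed series (gamma_term q tau U f w)]}.

Definition supp (R : realType) (L : Type) (f : L -> R) : set L :=
  [set x | f x != 0].

(* The usual norm for [1 <= p], the F-norm (no [p]-th root) for [0 < p < 1]. *)
Definition pnorm (R : realType) (d : measure_display) (T : measurableType d)
    (mu : {measure set T -> \bar R}) (p : R) (g : T -> R) : \bar R :=
  if 1 <= p then Lnorm mu p%:E (EFin \o g)
  else (\int[mu]_x (`|g x| `^ p)%:E)%E.

(* Main.v *)
Require Import Defs.
From HB Require Import structures.
From mathcomp Require Import all_boot all_order all_algebra.
From mathcomp Require Import all_classical all_reals all_analysis.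
From mathcomp Require Import measurable_realfun ring lra.
Set Implicit Arguments.
Unset Strict Implicit.
Unset Printing Implicit Defensive.
Import Order.TTheory GRing.Theory Num.Theory.
Import numFieldNormedType.Exports.
Local Open Scope classical_set_scope.
Local Open Scope ring_scope.

(** Let mu be Lebesgue measure on the time axis times the law of the marks.
    Up to a null set the arrival times are the partial sums T_n of strictly
    positive independent exponential gaps, so the marked points (T_n, U_n) form
    a renewal chain: given the first n points, the next one has density
    exp (T_n - s) on s >= T_n with respect to mu ([gaps_marks_renewal]).
    The Gamma integral is the sum of phi (t, u) = H (t q(u)) f(u) over the points, and
    the substitution s = t q(u) turns integrals of functions of phi against mu
    into integrals against ds lam(du) of the same functions of H(s) f(u)
    ([time_mark_integralE]). In particular the integral of |phi|^p is that of
    H^p times that of |f|^p, and the former is finite because E1(v) = O(v^-a)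
    for every a > 0 ([jump_powR_integral]).

    Upper bound. For p <= 1 subadditivity of the power and Campbell's
    inequality bound the p-th moment of the sum by the integral of |phi|^p.
    For p > 1 a new point of size b changes the p-th power of a sum S by at
    most 2^p (S^(p-1) b + b^p); compensating the first term
    ([compensator_le]) bounds the p-th moment by the (p-1)-st one times the
    integral of |phi|, plus the integral of |phi|^p ([mark_sumX_ge1]). This is
    an induction on p. If the support has measure s, it closes because the
    integrals of |f|^(p-1) and |f| have product at most 2 s times that of
    |f|^p ([moment_le_const]).

    Lower bound. Let D be a region with mu(D) <= 1/2. With probability at
    least 1/4 no point of the process lies in D, and if one inserts a point z
    of D into such a configuration, then the integral over z of the values
    obtained is at most the expectation over configurations having exactly one
    point in D ([insertion_avoid_le], one half of Mecke's formula).
    Since |phi z|^p <= 2^p (|phi z + x|^p + |x|^p), the integral of |phi|^p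
    over D is at most a constant times E|Sf|^p ([insertion_moment]). For D
    take the points with mark in A and t q(u) <= K, where lam(A) K <= 1/2;
    there H is at least H(K), and the result bounds the integral of |f|^p over
    A ([lower_moment]): take A to be the support of f.

    Finiteness. Almost sure summability forces min(|phi|, 1) to be integrable
    ([summable_integral_lty]). Hence |f| is integrable over {|f| <= c} and
    {|f| > c} has finite measure for every c > 0, so that the integrability of
    |f|^p over {|f| > c} does not depend on c. It is necessary for a finite
    moment by the lower bound for A = {|f| > c}, and sufficient by the
    upper estimates, applied for p <= 1 to the two parts of f cut at level 1
    ([moment_of_large_part]). *)

(** * Integration tools *)

Section integration_tools.
Context {R : realType}.
Local Open Scope ereal_scope.
Import HBNNSimple.

(** By hypothesis the two sides agree on simple functions; monotone
    approximation does the rest. *)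
Lemma ge0_integral_density (d : measure_display) (T : measurableType d)
    (mu nu : {measure set T -> \bar R}) (q : T -> R) (f : T -> \bar R) :
  measurable_fun [set: T] q -> (forall x, 0 <= q x)%R ->
  (forall A, measurable A -> nu A = \int[mu]_(x in A) (q x)%:E) ->
  measurable_fun [set: T] f -> (forall x, 0 <= f x) ->
  \int[nu]_x f x = \int[mu]_x (f x * (q x)%:E).
Proof.
move=> mq q0 nuE mf f0.
have mqE : measurable_fun [set: T] (EFin \o q) by exact/measurable_EFinP.
pose h := nnsfun_approx measurableT mf.
have hf x : (EFin \o h n) x @[n --> \oo] --> f x.
  by apply: cvg_nnsfun_approx.
have -> : \int[nu]_x f x = limn (fun n => \int[nu]_x (h n x)%:E).
  rewrite -monotone_convergence//.
  - by apply: eq_integral => x _; apply/esym/cvg_lim => //; exact: hf.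
  - by move=> n; apply/measurable_EFinP.
  - by move=> n x _; rewrite lee_fin.
  - by move=> x _ a b ab; rewrite lee_fin; exact/lefP/nd_nnsfun_approx.
have -> : \int[mu]_x (f x * (q x)%:E) =
    limn (fun n => \int[mu]_x ((h n x)%:E * (q x)%:E)).
  rewrite -monotone_convergence//.
  - apply: eq_integral => x _; apply/esym/cvg_lim => //.
    by apply: cvgeZr => //; exact: hf.
  - by move=> n; apply: emeasurable_funM => //; exact/measurable_EFinP.
  - by move=> n x _; rewrite mule_ge0// lee_fin.
  - move=> x _ a b ab; apply: lee_wpmul2r; rewrite lee_fin//.
    exact/lefP/nd_nnsfun_approx.
congr (limn _); apply/funext => n.
transitivity (\int[nu]_x
   (\sum_(y \in range (h n)) (y * \1_(h n @^-1` [set y]) x)%:E)).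
  by apply: eq_integral => t _; rewrite /= fimfunE -fsumEFin.
rewrite ge0_integral_fsum//; last 2 first.
- by move=> r; exact/measurable_EFinP/measurable_funM.
- by move=> r x _; rewrite nnfun_muleindic_ge0.
transitivity (\int[mu]_x (\sum_(y \in range (h n))
    (y * \1_(h n @^-1` [set y]) x)%:E * (q x)%:E)); last first.
  apply: eq_integral => x _.
  rewrite -ge0_mule_fsuml => [|y]; last exact: nnfun_muleindic_ge0.
  by rewrite fsumEFin// -(fimfunE _ x).
rewrite ge0_integral_fsum//; last 2 first.
- by move=> r; apply: emeasurable_funM => //; exact/measurable_EFinP/measurable_funM.
- by move=> r x _; rewrite mule_ge0 ?lee_fin//; exact: nnfun_muleindic_ge0.
apply: eq_fsbigr => r; rewrite inE => -[t _ rE].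
have r0 : (0 <= r)%R by rewrite -rE.
have mr : measurable (h n @^-1` [set r]) by [].
under eq_integral do rewrite EFinM.
rewrite ge0_integralZl//; last exact/measurable_EFinP.
rewrite integral_indic// setIT nuE//.
under [in RHS]eq_integral do rewrite EFinM -muleA.
rewrite ge0_integralZl//; last 2 first.
- by apply: emeasurable_funM => //; exact/measurable_EFinP.
- by move=> x _; rewrite mule_ge0 ?lee_fin.
congr (_ * _); rewrite [LHS]integral_mkcond; apply: eq_integral => x _.
by rewrite patchE indicE; case: ifPn; rewrite ?mul1e ?mul0e.
Qed.

Definition image_measure (d1 d2 : measure_display) (X : measurableType d1)
    (Y : measurableType d2) (phi : X -> Y) (mphi : measurable_fun [set: X] phi)
    (mu : {measure set X -> \bar R}) : {measure set Y -> \bar R} :=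
  measure_function_pushforward__canonical__measure_function_Measure mu mphi.

Lemma ge0_integral_image (d1 d2 : measure_display) (X : measurableType d1)
    (Y : measurableType d2) (phi : X -> Y) (mphi : measurable_fun [set: X] phi)
    (mu : {measure set X -> \bar R}) (f : Y -> \bar R) :
  measurable_fun [set: Y] f -> (forall y, 0 <= f y) ->
  \int[image_measure mphi mu]_y f y = \int[mu]_x f (phi x).
Proof. by move=> mf f0; rewrite ge0_integral_pushforward// => y _. Qed.

(** The image of Lebesgue measure under x |-> a x + b, multiplied by a, agrees
    with Lebesgue measure on half-open intervals, hence everywhere. *)
Lemma ge0_integral_affine (a b : R) (F : R -> \bar R) : (0 < a)%R ->
  measurable_fun [set: R] F -> (forall x, 0 <= F x) ->
  \int[lebesgue_measure]_x F x =
  a%:E * \int[lebesgue_measure]_x F (a * x + b)%R.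
Proof.
move=> a0 mF F0.
pose phi (x : R) : R := (a * x + b)%R.
have mphi : measurable_fun [set: R] phi.
  by apply: measurable_funD => //; exact: measurable_funM.
have a0' : (0 <= a)%R := ltW a0.
pose m0 := mscale (NngNum a0') 
    (@image_measure _ _ (measurableTypeR R) (measurableTypeR R) phi mphi
      lebesgue_measure).
have m0E X : ocitv X -> lebesgue_measure X = m0 X.
  move=> /ocitvP[->|[[x y] /= xy ->]].
    by rewrite !measure0.
  rewrite /m0 /mscale/= /pushforward.
  have -> : phi @^-1` `]x, y] = `]((x - b) / a)%R, ((y - b) / a)%R]%classic.
    apply/seteqP; split => z; rewrite /= !in_itv/= /phi
      ler_pdivlMr// ltr_pdivrMr// (mulrC z).
      by rewrite lerBrDr ltrBlDr.
    by rewrite lerBrDr ltrBlDr.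
  rewrite !lebesgue_measure_itv/= !lte_fin xy.
  rewrite ltr_pM2r ?invr_gt0// ltrD2r xy.
  rewrite -!EFinB -EFinM; congr (_%:E).
  by rewrite -mulrBl mulrC mulfVK ?gt_eqF// opprB addrA subrK.
transitivity (\int[m0]_x F x).
  by apply: eq_measure_integral => A mA _; exact: lebesgue_measure_unique.
rewrite /m0 ge0_integral_mscale//=; congr (_ * _).
exact: ge0_integral_image.
Qed.

End integration_tools.

Section time_mark_measure.
Context {R : realType} {d : measure_display} {L : measurableType d}.
Variable Q : probability L R.

(** A name of its own for the product measure lets it carry the
    sigma-finiteness that iterated applications of Fubini-Tonelli need. *)
Definition time_mark_measure : set (measurableTypeR R * L) -> \bar R :=
  (lebesgue_measure \x Q)%E.

HB.instance Definition _ :=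
  Measure.copy time_mark_measure (lebesgue_measure \x Q)%E.

Let time_mark_measure_sigma_finite : sigma_finite setT time_mark_measure.
Proof.
have /sigma_finiteP[F [TF ndF Foo]] := sigma_finiteT (@lebesgue_measure R).
exists (fun n => F n `*` setT).
  apply/seteqP; split => // -[t u] _.
  have [n _ Fn] : (\bigcup_i F i) t by rewrite -TF.
  by exists n.
move=> k; have [mF Fk] := Foo k; split; first exact: measurableX.
by rewrite /time_mark_measure product_measure1E//= [X in (_ * X)%E]probability_setT mule1.
Qed.

HB.instance Definition _ := Measure_isSigmaFinite.Build _ _ _
  time_mark_measure time_mark_measure_sigma_finite.

Lemma ge0_integral_time_mark (f : R * L -> \bar R) :
  measurable_fun [set: R * L] f -> (forall z, 0 <= f z)%E ->
  (\int[time_mark_measure]_z f z =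
   \int[lebesgue_measure]_t \int[Q]_u f (t, u))%E.
Proof. by move=> mf f0; exact: (@fubini_tonelli1 _ _ _ _ _ lebesgue_measure Q f mf f0). Qed.

End time_mark_measure.

(** * Independence of the next point from the past *)

Section independence.
Context {R : realType} {dO : measure_display} {Omega : measurableType dO}.
Variable P : probability Omega R.
Local Open Scope ereal_scope.

(** The sets whose preimage is independent of E form a Dynkin system, and it
    contains the pi-system G. *)
Lemma pi_system_independent (d : measure_display) (T : measurableType d)
    (X : Omega -> T) (G : set (set T)) (E : set Omega) :
  measurable_fun [set: Omega] X -> setI_closed G -> G `<=` measurable ->
  measurable E ->
  (forall A, G A -> P (X @^-1` A `&` E) = P (X @^-1` A) * P E) ->
  forall A, <<s G >> A -> P (X @^-1` A `&` E) = P (X @^-1` A) * P E.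
Proof.
move=> mX GI Gm mE GE.
have mXA A : measurable A -> measurable (X @^-1` A).
  by move=> mA; rewrite -[X @^-1` A]setTI; exact: mX.
pose H := [set A | measurable A /\ P (X @^-1` A `&` E) = P (X @^-1` A) * P E].
have dH : dynkin H.
  split.
  - by split => //; rewrite preimage_setT setTI probability_setT mul1e.
  - move=> A [mA AE]; split; first exact: measurableC.
    have -> : X @^-1` (~` A) = ~` (X @^-1` A) by [].
    rewrite setIC -setDE measureD//; last 2 first.
    + exact: mXA.
    + by rewrite ltey_eq fin_num_measure.
    rewrite setIC [X in _ - X]AE probability_setC; last exact: mXA.
    by rewrite muleBl ?mul1e// ?fin_num_measure//; exact: mXA.
  - move=> F tF HF; split; first by apply: bigcupT_measurable => i; case: (HF i).
    have mF i : measurable (X @^-1` F i) by apply: mXA; case: (HF i).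
    have tXF : trivIset setT (fun i => X @^-1` F i).
      move=> i j _ _ [w [Fi Fj]]; apply: tF => //.
      by exists (X w); split.
    rewrite preimage_bigcup setI_bigcupl measure_bigcup//; last 2 first.
    + by move=> i _; exact: measurableI.
    + exact: trivIset_setIr.
    rewrite measure_bigcup// -(fineK (fin_num_measure P _ mE)) muleC -nneseriesZl//.
    apply: eq_eseriesr => i _; rewrite fineK ?fin_num_measure// muleC.
    exact: (HF i).2.
move=> A GA; suff : H A by case.
move: A GA; apply: lambda_system_subset => //.
- by apply/dynkin_lambda_system.
- by move=> A GA; split; [exact: Gm|exact: GE].
Qed.

End independence.

Section marked_sequence.
Context {R : realType} {dO dL : measure_display} {Omega : measurableType dO}.
Context {L : measurableType dL} (P : probability Omega R).
Variables (e : nat -> Omega -> R) (U : nat -> Omega -> L).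
Hypothesis me : forall n, measurable_fun [set: Omega] (e n).
Hypothesis mU : forall n, measurable_fun [set: Omega] (U n).
Hypothesis ie : mutually_independent P e.
Hypothesis iU : mutually_independent P U.
Hypothesis ieU : independent_sequences P e U.
Local Open Scope ereal_scope.

Definition past_rectangle n (B : nat -> set R) (C : nat -> set L) : set Omega :=
  \bigcap_(i in `I_n) (e i @^-1` B i) `&`
  \bigcap_(i in `I_n) (U i @^-1` C i).

(** A pi-system generating the sigma-algebra of the first n gaps and marks. *)
Definition past n : set (set Omega) :=
  [set D | exists B C, [/\ forall i, measurable (B i),
     forall i, measurable (C i) & D = past_rectangle n B C]].

Let mpre n (B : set R) : measurable B -> measurable (e n @^-1` B).
Proof. by move=> mB; rewrite -[_ @^-1` _]setTI; exact: me. Qed.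

Let mpreU n (C : set L) : measurable C -> measurable (U n @^-1` C).
Proof. by move=> mC; rewrite -[_ @^-1` _]setTI; exact: mU. Qed.

Lemma probability_past_rectangle n B C :
  (forall i, measurable (B i)) -> (forall i, measurable (C i)) ->
  P (past_rectangle n B C) =
  (\prod_(i <- iota 0 n) P (e i @^-1` B i)) *
  (\prod_(i <- iota 0 n) P (U i @^-1` C i)).
Proof.
move=> mB mC; rewrite -ie ?iota_uniq// -iU ?iota_uniq//.
have <- : `I_n = [set` iota 0 n].
  by apply/seteqP; split => i; rewrite /mkset mem_iota.
apply: ieU.
- apply: (@bigcap_measurableType _ (g_sigma_algebraType
    [set B | exists n (A : set R), measurable A /\ B = e n @^-1` A])).
  by move=> i _; apply: sub_sigma_algebra; exists i, (B i).
- apply: (@bigcap_measurableType _ (g_sigma_algebraType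
    [set B | exists n (A : set L), measurable A /\ B = U n @^-1` A])).
  by move=> i _; apply: sub_sigma_algebra; exists i, (C i).
Qed.

Lemma past_measurable n : past n `<=` measurable.
Proof.
move=> _ [B [C [mB mC ->]]]; apply: measurableI.
  by apply: bigcap_measurableType => i _; exact: mpre.
by apply: bigcap_measurableType => i _; exact: mpreU.
Qed.

Lemma past_setI n : setI_closed (past n).
Proof.
move=> _ _ [B [C [mB mC ->]]] [B' [C' [mB' mC' ->]]].
exists (fun i => B i `&` B' i), (fun i => C i `&` C' i); split.
- by move=> i; exact: measurableI.
- by move=> i; exact: measurableI.
- by rewrite /past_rectangle setIACA -!bigcapI.
Qed.

Lemma past_rectangle_setT n : past_rectangle n (fun=> setT) (fun=> setT) = setT.
Proof. by rewrite /past_rectangle; apply/seteqP; split => // w _; split. Qed.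

Lemma past_rectangleS n B C : past_rectangle n.+1 B C =
  past_rectangle n B C `&` (e n @^-1` B n `&` U n @^-1` C n).
Proof.
have recr (F : nat -> set Omega) :
    \bigcap_(i in `I_n.+1) F i = \bigcap_(i in `I_n) F i `&` F n.
  apply/seteqP; split => [w H|w [H Hn] i /=].
    by split=> [i /= ii|]; apply: H => //=; rewrite ltnW.
  by rewrite ltnS leq_eqVlt => /orP[/eqP->//|ni]; exact: H.
by rewrite /past_rectangle !recr setIACA.
Qed.

Lemma past_sub n : past n `<=` past n.+1.
Proof.
move=> _ [B [C [mB mC ->]]].
exists (fun i => if (i < n)%N then B i else setT),
  (fun i => if (i < n)%N then C i else setT).
split=> [i|i|]; [by case: ifP|by case: ifP|].
rewrite past_rectangleS ltnn setIT setIT.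
by congr (_ `&` _); apply: eq_bigcapr => i /= ->.
Qed.

Lemma past_next n (B : set R) (C : set L) : measurable B -> measurable C ->
  past n.+1 (e n @^-1` B `&` U n @^-1` C).
Proof.
move=> mB mC.
exists (fun i => if i == n then B else setT),
  (fun i => if i == n then C else setT).
split=> [i|i|]; [by case: ifP|by case: ifP|].
rewrite past_rectangleS eqxx -[LHS]setTI; congr (_ `&` _).
rewrite -(past_rectangle_setT n); congr (_ `&` _); apply: eq_bigcapr => i /= ni;
  by rewrite ltn_eqF.
Qed.

Lemma past_independent_rectangle n D (B : set R) (C : set L) :
  measurable B -> measurable C -> past n D ->
  P (D `&` (e n @^-1` B `&` U n @^-1` C)) =
  P D * (P (e n @^-1` B) * P (U n @^-1` C)).
Proof.
move=> mB mC [B' [C' [mB' mC' ->]]].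
pose B2 i := if i == n then B else B' i.
pose C2 i := if i == n then C else C' i.
have E : past_rectangle n B' C' = past_rectangle n B2 C2.
  congr (_ `&` _); apply: eq_bigcapr => i /= ni;
  by rewrite /B2 /C2 ltn_eqF.
have -> : e n @^-1` B `&` U n @^-1` C = e n @^-1` B2 n `&` U n @^-1` C2 n.
  by rewrite /B2 /C2 eqxx.
have mB2 i : measurable (B2 i) by rewrite /B2; case: ifP.
have mC2 i : measurable (C2 i) by rewrite /C2; case: ifP.
rewrite E -past_rectangleS !probability_past_rectangle//.
rewrite -addn1 iotaD !big_cat/= add0n !big_seq1 {2}/B2 {2}/C2 !eqxx.
by rewrite muleACA.
Qed.

Lemma past_independent n D (B : set R) (C : set L) :
  measurable B -> measurable C -> <<s past n >> D ->
  P (D `&` (e n @^-1` B `&` U n @^-1` C)) =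
  P D * (P (e n @^-1` B) * P (U n @^-1` C)).
Proof.
move=> mB mC sD.
have PE : P (e n @^-1` B `&` U n @^-1` C) = P (e n @^-1` B) * P (U n @^-1` C).
  have /(past_independent_rectangle mB mC) : past n setT.
    exists (fun=> setT), (fun=> setT); split => //.
    by rewrite past_rectangle_setT.
  by rewrite setTI probability_setT mul1e.
rewrite -PE; apply: (@pi_system_independent _ _ _ P _ _ idfun (past n)) => //.
- exact: measurable_id.
- exact: past_setI.
- exact: past_measurable.
- by apply: measurableI; [exact: mpre|exact: mpreU].
- by move=> A /(past_independent_rectangle mB mC); rewrite PE.
Qed.

Definition adapted (d : measure_display) (T : measurableType d) n
    (W : Omega -> T) : Prop :=
  forall A, measurable A -> <<s past n >> (W @^-1` A).

Section joint_law.
Context {d : measure_display} {T : measurableType d}.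
Variables (n : nat) (W : Omega -> T).
Hypothesis aW : adapted n W.

Let mW : measurable_fun [set: Omega] W.
Proof.
move=> _ A mA; rewrite setTI.
by apply: (smallest_sub (@sigma_algebra_measurable _ Omega) (@past_measurable n)); exact: aW.
Qed.

Let mz : measurable_fun [set: Omega] (fun w => (e n w, U n w)).
Proof. exact: measurable_fun_pair. Qed.

(** Rectangles generate the product sigma-algebra, and for them the claim is
    independence from the past. *)
Lemma adapted_joint_law (A : set T) (X : set (R * L)) :
  measurable A -> measurable X ->
  P (W @^-1` A `&` (fun w => (e n w, U n w)) @^-1` X) =
  P (W @^-1` A) * P ((fun w => (e n w, U n w)) @^-1` X).
Proof.
move=> mA; rewrite measurable_prod_measurableType => sX.
rewrite setIC muleC.
have mWA : measurable (W @^-1` A) by rewrite -[_ @^-1` _]setTI; exact: mW.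
apply: (pi_system_independent mz _ _ mWA _ sX).
- move=> _ _ [B1 mB1 [C1 mC1 <-]] [B2 mB2 [C2 mC2 <-]].
  exists (B1 `&` B2); first exact: measurableI.
  by exists (C1 `&` C2); [exact: measurableI|rewrite setXI].
- by move=> _ [B1 mB1 [C1 mC1 <-]]; exact: measurableX.
- move=> _ [B1 mB1 [C1 mC1 <-]].
  have -> : (fun w => (e n w, U n w)) @^-1` (B1 `*` C1) =
    e n @^-1` B1 `&` U n @^-1` C1 by [].
  rewrite setIC past_independent//; last exact: aW.
  rewrite muleC; congr (_ * _).
  have := @past_independent n setT B1 C1 mB1 mC1.
  rewrite setTI probability_setT mul1e => -> //.
  exact: (@measurableT _ (g_sigma_algebraType (past n))).
Qed.

End joint_law.
End marked_sequence.

(** * The renewal step *)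

Section renewal_step.
Context {R : realType} {dO dL : measure_display} {Omega : measurableType dO}.
Context {L : measurableType dL}.
Variables (e : nat -> Omega -> R) (U : nat -> Omega -> L).

Definition arrival n (w : Omega) : R := \sum_(i < n) e i w.

(** Point n sits at the end of gap n, hence the shift of the arrival index. *)
Definition marked_point n (w : Omega) : R * L := (arrival n.+1 w, U n w).

Definition mark_sum (a : R * L -> R) n (w : Omega) : R :=
  \sum_(i < n) a (marked_point i w).

(** The density at s of t plus a standard exponential variable. *)
Definition waiting_density (t s : R) : R :=
  if t <= s then expR (t - s) else 0.

Lemma waiting_density_ge0 t s : 0 <= waiting_density t s.
Proof. by rewrite /waiting_density; case: ifP => // _; exact: expR_ge0. Qed.

Lemma measurable_waiting_density d (T : measurableType d) (f g : T -> R) :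
  measurable_fun [set: T] f -> measurable_fun [set: T] g ->
  measurable_fun [set: T] (fun x => waiting_density (f x) (g x)).
Proof.
move=> mf mg; apply: measurable_fun_ifT => //; first exact: measurable_fun_ler.
by apply: measurableT_comp => //; exact: measurable_funB.
Qed.

Lemma arrivalS n w : arrival n.+1 w = arrival n w + e n w.
Proof. by rewrite /arrival big_ord_recr. Qed.

Lemma mark_sumS a n w :
  mark_sum a n.+1 w = mark_sum a n w + a (marked_point n w).
Proof. by rewrite /mark_sum big_ord_recr. Qed.

(** The one-step law of the marked points. The state after n points consists
    of the current time and two running sums, so that one of them can be the sum
    under study while the other counts the points in a region. *)
Definition renewal_property (P : probability Omega R) (Q : probability L R) :=
  forall (a b : R * L -> R) n (Phi : (R * (R * R)) * (R * L) -> \bar R),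
  measurable_fun [set: R * L] a -> measurable_fun [set: R * L] b ->
  measurable_fun [set: (R * (R * R)) * (R * L)] Phi ->
  (forall s, 0 <= Phi s)%E ->
  let Y w := (arrival n w, (mark_sum a n w, mark_sum b n w)) in
  (\int[P]_w Phi (Y w, marked_point n w) =
   \int[P]_w \int[time_mark_measure Q]_z
     ((waiting_density (arrival n w) z.1)%:E * Phi (Y w, z)))%E.

Variables (P : probability Omega R) (Q : probability L R).
Hypothesis me : forall n, measurable_fun [set: Omega] (e n).
Hypothesis mU : forall n, measurable_fun [set: Omega] (U n).
Hypothesis ie : mutually_independent P e.
Hypothesis iU : mutually_independent P U.
Hypothesis ieU : independent_sequences P e U.
Hypothesis eE : forall n A, measurable A ->
  P (e n @^-1` A) = exponential_prob 1 A.
Hypothesis UE : forall n A, measurable A -> P (U n @^-1` A) = Q A.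

Local Open Scope ereal_scope.

(** The law of (e n, U n) is the product of the exponential law and Q;
    a shift of time by t turns the exponential density into the waiting density. *)
Lemma gap_mark_integral n (t : R) (g : R * L -> \bar R) :
  measurable_fun [set: R * L] g -> (forall z, 0 <= g z) ->
  \int[P]_w g (t + e n w, U n w)%R =
  \int[time_mark_measure Q]_z ((waiting_density t z.1)%:E * g z).
Proof.
move=> mg g0.
pose en : {mfun Omega >-> measurableTypeR R} :=
  HB.pack (e n : Omega -> measurableTypeR R)
    (isMeasurableFun.Build _ _ _ _ (e n : Omega -> measurableTypeR R) (me n)).
pose Un : {mfun Omega >-> L} :=
  HB.pack (U n) (isMeasurableFun.Build _ _ _ _ (U n) (mU n)).
have mz : measurable_fun [set: Omega]
    ((fun w => (e n w, U n w)) : Omega -> (measurableTypeR R * L)%type).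
  by apply: (@measurable_fun_pair _ _ _ _ (measurableTypeR R) L (e n) (U n)) => //; exact: me.
pose h (z : R * L) := g ((t + z.1)%R, z.2).
have mh : measurable_fun [set: R * L] h.
  apply: measurableT_comp => //; apply: measurable_fun_pair => //.
  exact: measurable_funD.
have h0 z : 0 <= h z by exact: g0.
rewrite -[LHS]/(\int[P]_w h (e n w, U n w)).
rewrite -(ge0_integral_image mz)//.
rewrite (@eq_measure_integral _ _ _ _ (distribution P en \x distribution P Un));
  last first.
  move=> X mX _; apply/esym.
  apply: (@product_measure_unique _ _ _ _ _ (distribution P en)
    (distribution P Un) (image_measure mz P)) => // A B mA mB.
  have := past_independent_rectangle ie iU ieU mA mB (n := n) (D := setT).
  rewrite setTI probability_setT mul1e; apply.
  exists (fun=> setT), (fun=> setT); split => //.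
  by rewrite past_rectangle_setT.
rewrite fubini_tonelli1// /fubini_F.
have mF : measurable_fun [set: R] (fun r => \int[Q]_u h (r, u)).
  exact: (@measurable_fun_fubini_tonelli_F _ _ _ _ _ Q _ mh h0).
have F0 r : 0 <= \int[Q]_u h (r, u) by exact: integral_ge0.
under eq_integral => r _.
  rewrite (@eq_measure_integral _ _ _ _ Q); last first.
    by move=> A mA _; exact: UE.
  over.
transitivity (\int[lebesgue_measure]_r
    ((\int[Q]_u h (r, u)) * (exponential_pdf 1 r)%:E)).
  apply: (@ge0_integral_density _ _ (measurableTypeR R) lebesgue_measure
    (distribution P en)) => //.
  - exact: measurable_exponential_pdf.
  - by move=> x; exact: exponential_pdf_ge0.
  - by move=> A mA; exact: eE.
rewrite ge0_integral_time_mark; last 2 first.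
- apply: emeasurable_funM => //; apply/measurable_EFinP.
  exact: measurable_waiting_density.
- by move=> z; rewrite mule_ge0// lee_fin waiting_density_ge0.
rewrite /fubini_F/= [RHS](@ge0_integral_affine _ 1 t)//.
- rewrite mul1e; apply: eq_integral => r _; rewrite mul1r (addrC r).
  rewrite ge0_integralZl//.
  + rewrite muleC /exponential_pdf patchE mem_setE in_itv/= andbT.
    rewrite /waiting_density lerDl; case: ifP => _.
      by rewrite mul1r mulN1r opprD addNKr.
    by rewrite !mul0e.
  + by apply: measurableT_comp => //; exact: measurable_pair1.
  + by rewrite lee_fin waiting_density_ge0.
- apply: (@measurable_fun_fubini_tonelli_F _ _ _ _ _ Q
    (fun z => (waiting_density t z.1)%:E * g z)).
  + apply: emeasurable_funM => //; apply/measurable_EFinP.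
    exact: measurable_waiting_density.
  + by move=> z; rewrite mule_ge0// lee_fin waiting_density_ge0.
- move=> r; apply: integral_ge0 => u _.
  by rewrite mule_ge0// lee_fin waiting_density_ge0.
Qed.

Local Notation past := (past e U).
Local Notation adapted := (adapted e U).

Lemma adaptedP d (T : measurableType d) n (W : Omega -> T) :
  adapted n W <->
  measurable_fun [set: g_sigma_algebraType (past n)]
    (W : g_sigma_algebraType (past n) -> T).
Proof.
split=> [aW _ A mA|mW A mA]; first by rewrite setTI; exact: aW.
by rewrite -[_ @^-1` _]setTI; exact: mW.
Qed.

Lemma adapted_next d (T : measurableType d) n (W : Omega -> T) :
  adapted n W -> adapted n.+1 (fun w => (W w, (e n w, U n w))).
Proof.
move=> aW; apply/adaptedP.
have sub A : <<s past n >> A -> <<s past n.+1 >> A.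
  by apply: sub_smallest2r; [exact: smallest_sigma_algebra|exact: past_sub].
apply: measurable_fun_pair; first by apply/adaptedP => A mA; apply: sub; exact: aW.
apply: measurable_fun_pair; apply/adaptedP => A mA.
  rewrite -[X in <<s _ >> X]setIT -(preimage_setT (U n)).
  by apply: sub_sigma_algebra; exact: past_next.
rewrite -[X in <<s _ >> X]setTI -(preimage_setT (e n)).
by apply: sub_sigma_algebra; exact: past_next.
Qed.

Lemma adapted_comp d d' (T : measurableType d) (T' : measurableType d') n
    (W : Omega -> T) (h : T -> T') :
  measurable_fun [set: T] h -> adapted n W -> adapted n (fun w => h (W w)).
Proof.
by move=> mh /adaptedP aW; apply/adaptedP; exact: measurableT_comp.
Qed.

Lemma adapted_mark_sums (a b : R * L -> R) n :
  measurable_fun [set: R * L] a -> measurable_fun [set: R * L] b ->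
  adapted n (fun w => (arrival n w, (mark_sum a n w, mark_sum b n w))).
Proof.
move=> ma mb; elim: n => [|n IHn].
  apply/adaptedP; rewrite (_ : (fun w => _) = cst (0, (0, 0))%R).
    exact: measurable_cst.
  by apply/funext => w; rewrite /arrival /mark_sum !big_ord0.
pose h (s : (R * (R * R)) * (R * L)) : R * (R * R) :=
  let z := (s.1.1 + s.2.1, s.2.2)%R in
  (s.1.1 + s.2.1, (s.1.2.1 + a z, s.1.2.2 + b z))%R.
have mz : measurable_fun [set: (R * (R * R)) * (R * L)]
    (fun s => (s.1.1 + s.2.1, s.2.2)%R).
  apply: measurable_fun_pair; last exact: measurableT_comp.
  by apply: measurable_funD; exact: measurableT_comp.
have mh : measurable_fun [set: (R * (R * R)) * (R * L)] h.
  apply: measurable_fun_pair.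
    by apply: measurable_funD; exact: measurableT_comp.
  apply: measurable_fun_pair; apply: measurable_funD.
  - by do 2 apply: measurableT_comp => //.
  - exact: measurableT_comp.
  - by do 2 apply: measurableT_comp => //.
  - exact: measurableT_comp.
have := adapted_comp mh (adapted_next IHn).
rewrite (_ : (fun w => h _) =
  (fun w => (arrival n.+1 w, (mark_sum a n.+1 w, mark_sum b n.+1 w))))//.
by apply/funext => w; rewrite /h/= !mark_sumS /marked_point !arrivalS.
Qed.

(** The state is independent of the next gap and mark, so that their joint law
    is a product measure and Fubini-Tonelli applies. *)
Theorem gaps_marks_renewal : renewal_property P Q.
Proof.
move=> a b n Phi ma mb mPhi Phi0 Y.
have aY : adapted n Y by exact: adapted_mark_sums.
have mY : measurable_fun [set: Omega] Y.
  move=> _ A mA; rewrite setTI.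
  apply: (smallest_sub (@sigma_algebra_measurable _ Omega)
    (@past_measurable _ _ _ _ _ _ _ me mU n)); exact: aY.
have mz : measurable_fun [set: Omega] (fun w => (e n w, U n w)).
  exact: measurable_fun_pair.
pose Yn : {mfun Omega >-> (R * (R * R))%type} :=
  HB.pack Y (isMeasurableFun.Build _ _ _ _ Y mY).
pose zn : {mfun Omega >-> (R * L)%type} :=
  HB.pack (fun w => (e n w, U n w)) (isMeasurableFun.Build _ _ _ _ _ mz).
have mYz : measurable_fun [set: Omega] (fun w => (Y w, (e n w, U n w))).
  exact: measurable_fun_pair.
pose Psi (s : (R * (R * R)) * (R * L)) :=
  Phi (s.1, ((s.1.1 + s.2.1)%R, s.2.2)).
have mPsi : measurable_fun [set: (R * (R * R)) * (R * L)] Psi.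
  apply: measurableT_comp => //; apply: measurable_fun_pair => //.
  apply: measurable_fun_pair; last exact: measurableT_comp.
  by apply: measurable_funD; exact: measurableT_comp.
have Psi0 s : 0 <= Psi s by exact: Phi0.
transitivity (\int[P]_w Psi (Y w, (e n w, U n w))).
  by apply: eq_integral => w _; rewrite /Psi/= /marked_point arrivalS.
rewrite -(ge0_integral_image mYz)//.
rewrite (@eq_measure_integral _ _ _ _ (distribution P Yn \x distribution P zn));
  last first.
  move=> X mX _; apply/esym.
  apply: (@product_measure_unique _ _ _ _ _ (distribution P Yn)
    (distribution P zn) (image_measure mYz P)) => // A B mA mB.
  exact: (adapted_joint_law me mU ie iU ieU aY).
rewrite fubini_tonelli1// /fubini_F.
rewrite ge0_integral_distribution//.
- apply: eq_integral => w _ /=; rewrite ge0_integral_distribution//=.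
  + rewrite -(@gap_mark_integral n _ (fun z => Phi (Y w, z)))//.
    by apply: measurableT_comp => //; exact: measurable_pair1.
  + by apply: measurableT_comp => //; exact: measurable_pair1.
- exact: (@measurable_fun_fubini_tonelli_F _ _ _ _ _ (distribution P zn)).
- by move=> y; exact: integral_ge0.
Qed.

End renewal_step.

(** * Compensators and moments of sums over the points *)

Lemma measurable_natr (R : realType) d (T : measurableType d) (b : T -> bool) :
  measurable_fun [set: T] b -> measurable_fun [set: T] (fun x => (b x)%:R : R).
Proof.
move=> mb; rewrite (_ : (fun x => _) = (fun x => if b x then 1 else 0)).
  by apply: measurable_fun_ifT.
by apply/funext => x; case: (b x).
Qed.

Lemma integral_probability_cst (R : realType) d (T : measurableType d)
    (Q : probability T R) (c : \bar R) : (\int[Q]_x c = c)%E.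
Proof.
by rewrite (@integral_cst _ _ _ Q setT measurableT c)
  [X in (_ * X)%E]probability_setT mule1.
Qed.

Section compensator.
Context {R : realType} {dO dL : measure_display} {Omega : measurableType dO}.
Context {L : measurableType dL} (Q : probability L R).
Variables (e : nat -> Omega -> R) (U : nat -> Omega -> L).
Hypothesis me : forall n, measurable_fun [set: Omega] (e n).
Hypothesis mU : forall n, measurable_fun [set: Omega] (U n).
Hypothesis e_gt0 : forall n w, 0 < e n w.

Local Notation mu := (time_mark_measure Q).
Local Notation T := (arrival e).
Local Notation pt := (marked_point e U).
Local Notation Sum := (mark_sum e U).

Lemma measurable_arrival n : measurable_fun [set: Omega] (T n).
Proof. by apply: measurable_sum => i; exact: me. Qed.

Lemma measurable_marked_point n : measurable_fun [set: Omega] (pt n).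
Proof.
by apply: measurable_fun_pair => //; exact: measurable_arrival.
Qed.

Lemma measurable_mark_sum a n : measurable_fun [set: R * L] a ->
  measurable_fun [set: Omega] (Sum a n).
Proof.
move=> ma; apply: measurable_sum => i.
by apply: measurableT_comp => //; exact: measurable_marked_point.
Qed.

Lemma measurable_late n (B : R) : measurable [set w | T n w < B].
Proof.
have := @measurable_fun_ltr _ _ _ setT (T n) (cst B) (measurable_arrival n)
  (measurable_cst _) measurableT [set true] I.
by rewrite setTI.
Qed.

Lemma arrival_ge0 n w : 0 <= T n w.
Proof. by apply: sumr_ge0 => i _; exact: ltW. Qed.

Lemma arrival_lt n w : T n w < T n.+1 w.
Proof. by rewrite arrivalS ltrDl. Qed.

Lemma arrival_le m n w : (m <= n)%N -> T m w <= T n w.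
Proof.
elim: n => [|n IHn]; first by rewrite leqn0 => /eqP->.
rewrite leq_eqVlt => /orP[/eqP->//|]; rewrite ltnS => /IHn h.
exact: le_trans h (ltW (arrival_lt _ _)).
Qed.

Lemma sum_arrival_slots (N : nat) w (s : R) :
  \sum_(n < N) ((T n w <= s < T n.+1 w)%R%:R : R) = (0 <= s < T N w)%R%:R.
Proof.
elim: N => [|N IHN].
  by rewrite big_ord0 /arrival big_ord0; case: leP => //= s0; rewrite lt_geF.
rewrite big_ord_recr/= IHN -natrD; congr (_%:R).
have := arrival_lt N w; have := arrival_ge0 N w.
by case: (leP 0 s); case: (ltP s (T N w)); case: (ltP s (T N.+1 w)) => //= *;
  exfalso; lra.
Qed.

Local Open Scope ereal_scope.

(** The exponential law has no memory, so its density equals its tail. *)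
Lemma waiting_tail (t s : R) : (t <= s)%R ->
  \int[mu]_z (waiting_density t z.1 * (s < z.1)%R%:R)%:E =
  (waiting_density t s)%:E.
Proof.
move=> ts.
have w0 r v : 0 <= (waiting_density t r * (v < r)%R%:R)%:E.
  by rewrite lee_fin mulr_ge0// waiting_density_ge0.
rewrite ge0_integral_time_mark//; last first.
  apply/measurable_EFinP; apply: measurable_funM.
    exact: measurable_waiting_density.
  by apply: measurable_natr; exact: measurable_fun_ltr.
rewrite /fubini_F/=.
under eq_integral do rewrite integral_probability_cst.
rewrite (@ge0_integral_affine _ 1 s)//; last first.
  apply/measurable_EFinP; apply: measurable_funM.
    exact: measurable_waiting_density.
  by apply: measurable_natr; exact: measurable_fun_ltr.
rewrite mul1e.
transitivity (\int[lebesgue_measure]_x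
    ((expR (t - s))%:E * ((expR (- x))%:E * (0 < x)%R%:R%:E))).
  apply: eq_integral => x _; rewrite mul1r.
  have -> : (s < x + s)%R = (0 < x)%R by rewrite ltrDr.
  case: ltP => x0; last by rewrite mulr0 !mule0.
  rewrite /waiting_density ifT; last by lra.
  by rewrite -!EFinM !mulr1 -expRD; congr (expR _)%:E; ring.
rewrite ge0_integralZl//; last first.
  apply: emeasurable_funM; apply/measurable_EFinP.
    by apply: measurableT_comp => //; exact: measurable_oppr.
  by apply: measurable_natr; exact: measurable_fun_ltr.
rewrite {1}/waiting_density ts -[RHS]mule1; congr (_ * _).
transitivity (\int[@lebesgue_measure R]_(x in `]0%R, +oo[%classic) (exponential_pdf (1:R) x)%:E).
  rewrite [RHS]integral_mkcond; apply: eq_integral => x _.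
  rewrite patchE mem_setE in_itv/= andbT; case: ltP => x0; last by rewrite mule0.
  by rewrite mule1 exponential_pdfE ?ltW// mul1r mulN1r.
rewrite integral_itv_obnd_cbnd; last first.
  by apply/measurable_EFinP; apply: measurable_funTS; exact: measurable_exponential_pdf.
rewrite -[RHS](@integral_exponential_pdf R 1)// [LHS]integral_mkcond.
apply: eq_integral => x _; rewrite patchE mem_setE in_itv/= andbT.
by case: leP => // x0; rewrite lt0_exponential_pdf.
Qed.

End compensator.

(** Each of the two fractions x of a + b satisfies x <= x^p, as x <= 1. *)
Lemma powR_subadditive (R : realType) (p a b : R) : 0 <= a -> 0 <= b ->
  0 < p <= 1 -> (a + b) `^ p <= a `^ p + b `^ p.
Proof.
move=> a0 b0 /andP[p0 p1].
have [ab0|ab0] := eqVneq (a + b) 0.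
  by rewrite ab0 powR0 ?gt_eqF// addr_ge0// powR_ge0.
have s0 : 0 < a + b by rewrite lt_neqAle eq_sym ab0 addr_ge0.
have key x : 0 <= x -> x <= a + b -> x / (a + b) * (a + b) `^ p <= x `^ p.
  move=> x0 xs; have [->|xn0] := eqVneq x 0; first by rewrite !mul0r powR_ge0.
  rewrite -{2}(divfK ab0 x) powRM//; last 2 first.
  - by rewrite divr_ge0// ltW.
  - exact: ltW.
  rewrite ler_wpM2r ?powR_ge0// ger1_powR//.
  have x1 : 0 < x by rewrite lt_neqAle eq_sym xn0.
  by rewrite divr_gt0//= ler_pdivrMr// mul1r.
have := lerD (key a a0 _) (key b b0 _).
by rewrite -mulrDl -mulrDl divff// mul1r; apply; rewrite ?lerDl ?lerDr.
Qed.

(** If a <= b then a + b <= 2 b and the last term suffices. Otherwise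
    1 + t with t = b / a is a convex combination of 1 and 2, so that
    (1 + t)^p <= 1 + 2^p t. *)
Lemma powRD_le (R : realType) (p a b : R) : 0 <= a -> 0 <= b -> 1 <= p ->
  (a + b) `^ p <= a `^ p + 2 `^ p * (a `^ (p - 1) * b + b `^ p).
Proof.
move=> a0 b0 p1; have p0 : 0 < p by exact: lt_le_trans p1.
have [ab|ba] := leP a b.
  apply: (@le_trans _ _ ((2 * b) `^ p)).
    by apply: ge0_ler_powR; rewrite ?nnegrE; lra.
  rewrite powRM// mulrDr addrA lerDr addr_ge0 ?mulr_ge0 ?powR_ge0//.
have a0' : 0 < a by exact: le_lt_trans ba.
have [t01 tE] : (0 <= b / a <= 1) /\ b = b / a * a.
  by rewrite divfK ?gt_eqF// divr_ge0//= ler_pdivrMr// mul1r ltW.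
have h := @convex_powR R p p1.
have [t0 t1] := andP t01; pose t := Itv01 t0 t1.
have {}h : (b / a * 2 + (1 - b / a) * 1) `^ p <=
    b / a * 2 `^ p + (1 - b / a) * 1.
  have := h t 2 1; rewrite !inE/= !in_itv/= !andbT ler01 ler0n => /(_ isT isT).
  by rewrite convRE/= powR1.
rewrite mulr1 in h.
have -> : a + b = a * (1 + b / a) by rewrite mulrDr mulr1 mulrC divfK// gt_eqF.
rewrite powRM ?addr_ge0//.
have aE : a `^ (p - 1) * b = a `^ p * (b / a).
  by rewrite -(mulr_powRB1 a0 p0); field; rewrite gt_eqF.
apply: (@le_trans _ _ (a `^ p * (1 + 2 `^ p * (b / a)))); last first.
  by rewrite aE !mulrDr mulr1 -/(b / a) lerD2l mulrCA lerDl mulr_ge0 ?powR_ge0.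
rewrite ler_wpM2l ?powR_ge0//.
have tE2 : 1 + b / a = b / a * 2 + (1 - b / a) by ring.
rewrite tE2; apply: le_trans h _.
by rewrite mulrC; lra.
Qed.

Lemma measurable_slot (R : realType) d (L : measurableType d)
    (g : R * L -> \bar R) (t t' : R) : measurable_fun [set: R * L] g ->
  measurable_fun [set: R * L] (fun z => g z * (t <= z.1 < t')%R%:R%:E)%E.
Proof.
move=> mg; apply: emeasurable_funM => //.
apply/measurable_EFinP; apply: measurable_natr; apply: measurable_and.
  exact: measurable_fun_ler.
exact: measurable_fun_ltr.
Qed.

Section compensator_bounds.
Context {R : realType} {dO dL : measure_display} {Omega : measurableType dO}.
Context {L : measurableType dL} (P : probability Omega R) (Q : probability L R).
Variables (e : nat -> Omega -> R) (U : nat -> Omega -> L).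
Hypothesis me : forall n, measurable_fun [set: Omega] (e n).
Hypothesis mU : forall n, measurable_fun [set: Omega] (U n).
Hypothesis e_gt0 : forall n w, 0 < e n w.
Hypothesis step : renewal_property e U P Q.

Local Notation mu := (time_mark_measure Q).
Local Notation T := (arrival e).
Local Notation pt := (marked_point e U).
Local Notation Sum := (mark_sum e U).
Local Notation state a b n w := (T n w, (Sum a n w, Sum b n w)).
Local Open Scope ereal_scope.

Let measurable_state a b n : measurable_fun [set: R * L] a ->
  measurable_fun [set: R * L] b ->
  measurable_fun [set: Omega] (fun w => state a b n w).
Proof.
move=> ma mb; apply: measurable_fun_pair; first exact: measurable_arrival.
by apply: measurable_fun_pair; apply: measurable_mark_sum.
Qed.

Definition slot_mass (g : R * L -> \bar R) (x : R * R) : \bar R :=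
  \int[mu]_z (g z * (x.1 <= z.1 < x.2)%R%:R%:E).

Section slot_mass.
Variable g : R * L -> \bar R.
Hypothesis mg : measurable_fun [set: R * L] g.
Hypothesis g0 : forall z, 0 <= g z.

Let mgs d (S : measurableType d) (f f' : S -> R) (h : S -> R * L) :
  measurable_fun [set: S] f -> measurable_fun [set: S] f' ->
  measurable_fun [set: S] h ->
  measurable_fun [set: S]
    (fun x => g (h x) * (f x <= (h x).1 < f' x)%R%:R%:E).
Proof.
move=> mf mf' mh; apply: emeasurable_funM; first exact: measurableT_comp.
apply/measurable_EFinP; apply: measurable_natr; apply: measurable_and.
  by apply: measurable_fun_ler => //; exact: measurableT_comp.
by apply: measurable_fun_ltr => //; exact: measurableT_comp.
Qed.

Lemma slot_mass_ge0 x : 0 <= slot_mass g x.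
Proof. by apply: integral_ge0 => z _; rewrite mule_ge0. Qed.

Lemma measurable_slot_mass : measurable_fun [set: R * R] (slot_mass g).
Proof.
pose f (y : (R * R) * (measurableTypeR R * L)) : \bar R :=
  g y.2 * (y.1.1 <= y.2.1 < y.1.2)%R%:R%:E.
have mf : measurable_fun [set: (R * R) * (measurableTypeR R * L)] f.
  by apply: (@mgs _ ((R * R) * (R * L))%type) => //; exact: measurableT_comp.
have f0 y : 0 <= f y by rewrite mule_ge0.
exact: (@measurable_fun_fubini_tonelli_F _ _ (R * R)%type
  (measurableTypeR R * L)%type R mu f mf f0).
Qed.

(** By the renewal step the left side integrates g against the waiting
    density. By [waiting_tail] that density at z.1 is the conditional probability
    of T_n <= z.1 < T_(n+1), and Fubini-Tonelli brings it under the integral over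
    the next point. *)
Lemma compensator (Z : R * (R * R) -> \bar R) (a b : R * L -> R) n :
  measurable_fun [set: R * L] a -> measurable_fun [set: R * L] b ->
  measurable_fun [set: R * (R * R)] Z -> (forall s, 0 <= Z s) ->
  \int[P]_w (Z (state a b n w) * g (pt n w)) =
  \int[P]_w (Z (state a b n w) * slot_mass g (T n w, T n.+1 w)).
Proof.
move=> ma mb mZ Z0.
rewrite (@step a b n (fun s => Z s.1 * g s.2))//; last 2 first.
- by apply: emeasurable_funM; apply: measurableT_comp.
- by move=> s; rewrite mule_ge0.
pose slot (s : (R * (R * R)) * (R * L)) := Z s.1 * slot_mass g (s.1.1, s.2.1).
have mslot : measurable_fun [set: (R * (R * R)) * (R * L)] slot.
  apply: emeasurable_funM; first exact: measurableT_comp.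
  apply: measurableT_comp; first exact: measurable_slot_mass.
  by apply: measurable_fun_pair; apply: measurableT_comp.
have slot0 s : 0 <= slot s by rewrite mule_ge0// slot_mass_ge0.
apply: etrans (esym (step n ma mb mslot slot0)).
apply: eq_integral => w _; rewrite /slot/=; set t := T n w; set Zw := Z _.
have mwd : measurable_fun [set: R * L] (fun z => (waiting_density t z.1)%:E).
  by apply/measurable_EFinP; exact: measurable_waiting_density.
have wd0 z : 0 <= (waiting_density t z)%:E.
  by rewrite lee_fin waiting_density_ge0.
under eq_integral do rewrite muleCA.
under [RHS]eq_integral do rewrite muleCA.
rewrite ge0_integralZl//; last 3 first.
- exact: emeasurable_funM.
- by move=> z _; rewrite mule_ge0.
- exact: Z0.
rewrite [RHS]ge0_integralZl//; last 3 first.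
- apply: emeasurable_funM => //.
  apply: measurableT_comp; first exact: measurable_slot_mass.
  by apply: measurable_fun_pair.
- by move=> z _; rewrite mule_ge0// slot_mass_ge0.
- exact: Z0.
congr (_ * _).
transitivity (\int[mu]_z \int[mu]_z' ((waiting_density t z'.1)%:E *
    (g z * (t <= z.1 < z'.1)%R%:R%:E))).
  apply: eq_integral => z _.
  have [tz|tz] := leP t z.1; last first.
    rewrite integral0_eq => [|z' _]; last by rewrite !mule0.
    by rewrite /waiting_density leNgt tz mul0e.
  under eq_integral do rewrite muleCA -EFinM.
  rewrite ge0_integralZl//; last 2 first.
  - apply/measurable_EFinP; apply: measurable_funM.
      exact: measurable_waiting_density.
    by apply: measurable_natr; exact: measurable_fun_ltr.
  - by move=> z' _; rewrite lee_fin mulr_ge0// waiting_density_ge0.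
  by rewrite /= waiting_tail// muleC.
rewrite (@fubini_tonelli _ _ _ _ _ mu mu (fun y : (R * L) * (R * L) =>
  (waiting_density t y.2.1)%:E * (g y.1 * (t <= y.1.1 < y.2.1)%R%:R%:E))); last 2 first.
- apply: emeasurable_funM.
    apply/measurable_EFinP; apply: measurable_waiting_density => //.
    exact: measurableT_comp.
  by apply: mgs => //; exact: measurableT_comp.
- by move=> y; rewrite !mule_ge0.
apply: eq_integral => z' _ /=; rewrite ge0_integralZl//.
- by apply: mgs.
- by move=> z _; rewrite mule_ge0.
Qed.

End slot_mass.

Lemma sum_slot_mass g N w :
  measurable_fun [set: R * L] g -> (forall z, 0 <= g z) ->
  \sum_(n < N) slot_mass g (T n w, T n.+1 w) = slot_mass g (0%R, T N w).
Proof.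
move=> mg g0; rewrite -ge0_integral_sum//.
- apply: eq_integral => z _ /=.
  rewrite -ge0_sume_distrr//; congr (_ * _).
  by rewrite sumEFin sum_arrival_slots.
- by move=> n; exact: measurable_slot.
- by move=> n z _; rewrite mule_ge0.
Qed.

(** The slots tile [0, T_N[, so that the compensators of all steps together
    have at most the mass of g. *)
Lemma compensator_le (Z : R * (R * R) -> \bar R) (a b : R * L -> R)
    (g : R * L -> \bar R) (M : Omega -> \bar R) N :
  measurable_fun [set: R * L] a -> measurable_fun [set: R * L] b ->
  measurable_fun [set: R * (R * R)] Z -> (forall s, 0 <= Z s) ->
  measurable_fun [set: R * L] g -> (forall z, 0 <= g z) ->
  measurable_fun [set: Omega] M ->
  (forall n w, (n < N)%N -> Z (state a b n w) <= M w) ->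
  (forall w, 0 <= M w) ->
  \sum_(n < N) \int[P]_w (Z (state a b n w) * g (pt n w)) <=
  \int[P]_w M w * \int[mu]_z g z.
Proof.
move=> ma mb mZ Z0 mg g0 mM ZM M0.
have mslot n : measurable_fun [set: Omega]
    (fun w => slot_mass g (T n w, T n.+1 w)).
  apply: measurableT_comp; first exact: measurable_slot_mass.
  by apply: measurable_fun_pair; exact: measurable_arrival.
under eq_bigr do rewrite compensator//.
rewrite -ge0_integralZr//; last exact: integral_ge0.
rewrite -ge0_integral_sum//; last 2 first.
- move=> n; apply: emeasurable_funM => //.
  by apply: measurableT_comp => //; exact: measurable_state.
- by move=> n w _; rewrite mule_ge0// slot_mass_ge0.
apply: ge0_le_integral => //.
- by move=> w _; rewrite sume_ge0// => n _; rewrite mule_ge0// slot_mass_ge0.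
- apply: emeasurable_sum => n; apply: emeasurable_funM => //.
  by apply: measurableT_comp => //; exact: measurable_state.
- by apply: emeasurable_funM.
move=> w _; apply: (@le_trans _ _ (M w * slot_mass g (0%R, T N w))).
  rewrite -sum_slot_mass// ge0_sume_distrr//; last first.
    by move=> n _; exact: slot_mass_ge0.
  by apply: lee_sum => n _; apply: lee_wpmul2r; [exact: slot_mass_ge0|exact: ZM].
apply: lee_wpmul2l => //; apply: ge0_le_integral => //.
- by move=> z _; rewrite mule_ge0.
- exact: measurable_slot.
- by move=> z _; case: (_ && _); rewrite ?mule1// mule0.
Qed.

(** One half of Campbell's formula: the constant weight Z = 1 in
    [compensator_le]. *)
Lemma campbell_le (g : R * L -> \bar R) N :
  measurable_fun [set: R * L] g -> (forall z, 0 <= g z) ->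
  \sum_(n < N) \int[P]_w g (pt n w) <= \int[mu]_z g z.
Proof.
move=> mg g0.
have h := @compensator_le (fun=> 1) (fun=> 0%R) (fun=> 0%R) g (fun=> 1) N
  (measurable_cst _) (measurable_cst _) (measurable_cst _) (fun=> lee01) mg g0
  (measurable_cst _) (fun _ _ _ => lexx _) (fun=> lee01).
rewrite integral_probability_cst mul1e in h; apply: le_trans h.
by apply: lee_sum => n _; under [leRHS]eq_integral do rewrite mul1e.
Qed.

(** Campbell's inequality for the indicator of [0, B[: if T_N < B, then the
    first N points all lie before B. *)
Lemma late_arrival (B : R) N : (0 <= B)%R ->
  N%:R%:E * P [set w | (T N w < B)%R] <= B%:E.
Proof.
move=> B0.
pose g (z : R * L) : \bar R := (0 <= z.1 < B)%R%:R%:E.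
have mlt n := measurable_late me n B.
have mg : measurable_fun [set: R * L] g.
  apply/measurable_EFinP; apply: measurable_natr; apply: measurable_and.
    exact: measurable_fun_ler.
  exact: measurable_fun_ltr.
have g0 z : 0 <= g z by rewrite /g lee_fin.
apply: (@le_trans _ _ (\int[mu]_z g z)).
  apply: le_trans (@campbell_le _ N mg g0).
  have -> : N%:R%:E * P [set w | (T N w < B)%R] =
      \sum_(n < N) P [set w | (T N w < B)%R].
    rewrite -(fineK (fin_num_measure P _ (mlt N))) -EFinM sumEFin.
    by rewrite sumr_const card_ord mulr_natl.
  apply: lee_sum => n _.
  rewrite -[X in P X]setIT -integral_indic//; apply: ge0_le_integral => //.
  - exact/measurable_EFinP/measurable_indic.
  - by apply: measurableT_comp => //; exact: measurable_marked_point.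
  move=> w _; rewrite indicE /g/= arrival_ge0//=.
  case: (boolP (w \in _)) => [|_]; last by rewrite lee_fin.
  by rewrite inE/= => TB; rewrite (le_lt_trans _ TB)// arrival_le.
rewrite ge0_integral_time_mark//=.
rewrite /g/=; under eq_integral do rewrite integral_probability_cst.
rewrite (_ : integral _ _ _ = \int[@lebesgue_measure R]_(x in `[0%R, B[%classic) 1).
  rewrite integral_cst//= mul1e lebesgue_measure_itv/= lte_fin.
  by case: ifP => _; rewrite ?sube0// lee_fin.
rewrite [RHS]integral_mkcond; apply: eq_integral => x _.
by rewrite patchE mem_setE in_itv/= /g/=; case: (_ && _).
Qed.

Lemma mark_sum_le (g : R * L -> R) n N w : (forall z, 0 <= g z)%R ->
  (n <= N)%N -> (Sum g n w <= Sum g N w)%R.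
Proof.
move=> g0; elim: N => [|N IHN]; first by rewrite leqn0 => /eqP->.
rewrite leq_eqVlt => /orP[/eqP->//|]; rewrite ltnS => /IHN h.
by rewrite mark_sumS; apply: le_trans h _; rewrite lerDl.
Qed.

Lemma mark_sumX_le1 (p : R) (g : R * L -> R) N : (0 < p <= 1)%R ->
  measurable_fun [set: R * L] g -> (forall z, 0 <= g z)%R ->
  \int[P]_w (Sum g N w `^ p)%:E <= \int[mu]_z (g z `^ p)%:E.
Proof.
move=> p01 mg g0.
have mgp : measurable_fun [set: R * L] (fun z => (g z `^ p)%:E).
  by apply/measurable_EFinP; exact: measurableT_comp (measurable_powR _) mg.
apply: (@le_trans _ _ (\sum_(n < N) \int[P]_w (g (pt n w) `^ p)%:E)).
  rewrite -ge0_integral_sum//; last 2 first.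
  - by move=> n; apply: (measurableT_comp mgp); exact: measurable_marked_point.
  - by move=> n w _; rewrite lee_fin powR_ge0.
  apply: ge0_le_integral => //.
  - by move=> w _; rewrite lee_fin powR_ge0.
  - apply/measurable_EFinP; apply: (measurableT_comp (measurable_powR _)).
    exact: measurable_mark_sum.
  - apply: emeasurable_sum => n.
    by apply: (measurableT_comp mgp); exact: measurable_marked_point.
  move=> w _; rewrite sumEFin lee_fin /mark_sum.
  elim: N => [|N IHN].
    by rewrite !big_ord0 powR0// gt_eqF//; case/andP: p01.
  rewrite !big_ord_recr/=; apply: le_trans (powR_subadditive _ _ p01) _ => //.
    exact: sumr_ge0.
  by rewrite lerD2r.
by apply: (campbell_le _ mgp) => z; rewrite lee_fin powR_ge0.
Qed.

(** The inequality [powRD_le] is applied to each new point; the weight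
    S^(p-1) grows with the number of points, so [compensator_le] bounds it by its
    last value. *)
Lemma mark_sumX_ge1 (p : R) (g : R * L -> R) N : (1 <= p)%R ->
  measurable_fun [set: R * L] g -> (forall z, 0 <= g z)%R ->
  \int[P]_w (Sum g N w `^ p)%:E <=
  (2 `^ p)%:E * (\int[P]_w (Sum g N w `^ (p - 1))%:E * \int[mu]_z (g z)%:E +
                \int[mu]_z (g z `^ p)%:E).
Proof.
move=> p1 mg g0.
have mgE : measurable_fun [set: R * L] (fun z => (g z)%:E).
  exact/measurable_EFinP.
have mgp : measurable_fun [set: R * L] (fun z => (g z `^ p)%:E).
  by apply/measurable_EFinP; exact: measurableT_comp (measurable_powR _) mg.
have mS r n : measurable_fun [set: Omega] (fun w => (Sum g n w `^ r)%:E).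
  apply/measurable_EFinP; apply: (measurableT_comp (measurable_powR _)).
  exact: measurable_mark_sum.
have mgpt n := measurable_marked_point me mU n.
have term_ge0 n w : 0 <= (Sum g n w `^ (p - 1))%:E * (g (pt n w))%:E +
    (g (pt n w) `^ p)%:E.
  by rewrite adde_ge0 ?mule_ge0 ?lee_fin ?powR_ge0.
have mterm n : measurable_fun [set: Omega]
    (fun w => (Sum g n w `^ (p - 1))%:E * (g (pt n w))%:E + (g (pt n w) `^ p)%:E).
  apply: emeasurable_funD.
    by apply: emeasurable_funM => //; exact: (measurableT_comp mgE).
  exact: (measurableT_comp mgp).
apply: (@le_trans _ _ (\int[P]_w ((2 `^ p)%:E * \sum_(n < N)
    ((Sum g n w `^ (p - 1))%:E * (g (pt n w))%:E + (g (pt n w) `^ p)%:E)))).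
  apply: ge0_le_integral => //.
  - by move=> w _; rewrite lee_fin powR_ge0.
  - by apply: emeasurable_funM => //; exact: emeasurable_sum.
  move=> w _; elim: N => [|N IHN].
    rewrite big_ord0 mule0 /mark_sum big_ord0 powR0// gt_eqF//.
    exact: lt_le_trans p1.
  rewrite mark_sumS big_ord_recr/= ge0_muleDr//; last exact: sume_ge0.
  apply: (@le_trans _ _ ((Sum g N w `^ p)%:E +
    (2 `^ p)%:E * ((Sum g N w `^ (p - 1))%:E * (g (pt N w))%:E + (g (pt N w) `^ p)%:E))).
    rewrite -!(EFinM, EFinD) lee_fin; apply: powRD_le => //.
    exact: sumr_ge0.
  by rewrite leeD2r.
rewrite ge0_integralZl//; last 2 first.
- exact: emeasurable_sum.
- by move=> w _; exact: sume_ge0.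
rewrite lee_wpmul2l ?lee_fin ?powR_ge0//.
rewrite ge0_integral_sum//.
under eq_bigr => n _.
  rewrite ge0_integralD//; last 4 first.
  - by move=> w _; rewrite mule_ge0 ?lee_fin ?powR_ge0.
  - by apply: emeasurable_funM => //; exact: (measurableT_comp mgE).
  - by move=> w _; rewrite lee_fin powR_ge0.
  - exact: (measurableT_comp mgp).
  over.
rewrite big_split/=; apply: leeD.
- apply: (@compensator_le (fun s => (s.2.1 `^ (p - 1))%:E) g g) => //.
  + apply/measurable_EFinP; apply: (measurableT_comp (measurable_powR _)).
    exact: measurableT_comp.
  + by move=> s; rewrite lee_fin powR_ge0.
  + move=> n w nN /=; rewrite lee_fin ge0_ler_powR ?subr_ge0// ?nnegrE ?sumr_ge0//.
    exact: mark_sum_le (ltnW nN).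
  + by move=> w; rewrite lee_fin powR_ge0.
- by apply: (campbell_le _ mgp) => z; rewrite lee_fin powR_ge0.
Qed.

End compensator_bounds.

(** * Finiteness from almost sure summability *)

Lemma monotone_integral_le (R : realType) d (T : measurableType d)
    (mu : {measure set T -> \bar R}) (g : nat -> T -> \bar R)
    (f : T -> \bar R) (C : \bar R) :
  (forall n, measurable_fun [set: T] (g n)) -> (forall n x, 0 <= g n x)%E ->
  (forall x m n, (m <= n)%N -> (g m x <= g n x)%E) ->
  (forall x, g n x @[n --> \oo] --> f x) ->
  (forall n, \int[mu]_x g n x <= C)%E -> (\int[mu]_x f x <= C)%E.
Proof.
move=> mg g0 ndg gf gC.
have cvg_int := @cvg_monotone_convergence _ _ _ mu setT measurableT g mg
  (fun n x _ => g0 n x) (fun x _ => ndg x).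
have <- : (\int[mu]_x limn (g^~ x) = \int[mu]_x f x)%E.
  by apply: eq_integral => x _; apply/cvg_lim => //; exact: gf.
rewrite -(cvg_lim (@ereal_hausdorff R) cvg_int); apply: lime_le.
  by apply/cvg_ex; eexists; exact: cvg_int.
exact: nearW.
Qed.

Section summability.
Context {R : realType} {dO dL : measure_display} {Omega : measurableType dO}.
Context {L : measurableType dL} (P : probability Omega R) (Q : probability L R).
Variables (e : nat -> Omega -> R) (U : nat -> Omega -> L).
Hypothesis me : forall n, measurable_fun [set: Omega] (e n).
Hypothesis mU : forall n, measurable_fun [set: Omega] (U n).
Hypothesis e_gt0 : forall n w, 0 < e n w.
Hypothesis step : renewal_property e U P Q.

Local Notation mu := (time_mark_measure Q).
Local Notation T := (arrival e).
Local Notation pt := (marked_point e U).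
Local Notation Sum := (mark_sum e U).
Local Notation state a b n w := (T n w, (Sum a n w, Sum b n w)).
Local Open Scope ereal_scope.

Lemma late_arrival_small (B delta : R) : (0 <= B)%R -> (0 < delta)%R ->
  exists N0, forall N, (N0 <= N)%N ->
    P [set w | (T N w < B)%R] <= delta%:E.
Proof.
move=> B0 d0; exists (Num.truncn (B / delta)).+1 => N N0N.
have := late_arrival me mU e_gt0 step N B0.
rewrite -(fineK (fin_num_measure P _ (measurable_late me N B))) -EFinM !lee_fin.
set x := fine _ => NxB.
have NB : (B < N%:R * delta)%R.
  rewrite -ltr_pdivrMr//; apply: lt_le_trans (truncnS_gt _) _.
  by rewrite ler_nat.
have N0 : (0 < N%:R :> R)%R by rewrite ltr0n (leq_trans _ N0N).
by rewrite -(ler_pM2l N0); apply: le_trans NxB (ltW NB).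
Qed.

(** Stopped when it first exceeds m, the sum overshoots by one term at most. *)
Lemma stopped_sum_le (g : R * L -> R) (m : nat) N w :
  (forall z, 0 <= g z <= 1)%R ->
  (\sum_(n < N) (Sum g n w <= m%:R)%R%:R * g (pt n w) <= m%:R + 1)%R.
Proof.
move=> g01.
suff : (\sum_(n < N) (Sum g n w <= m%:R)%R%:R * g (pt n w) <=
    Num.min (Sum g N w) (m%:R + 1))%R by rewrite le_min => /andP[].
elim: N => [|N IHN]; first by rewrite /mark_sum !big_ord0 le_min lexx addr_ge0.
rewrite big_ord_recr/= mark_sumS; have /andP[g0 g1] := g01 (pt N w).
move: IHN; rewrite !le_min => /andP[h1 h2]; apply/andP.
case: (leP (Sum g N w) m%:R) => Sm /=; rewrite ?(mulr1n, mulr0n, mul1r, mul0r); split; lra.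
Qed.

(** On an event of probability eta > 0 all partial sums stay below some m. With
    the weight 1_(S_n <= m) the expected sum is at most m + 1, whereas on the part
    of that event where T_N0 >= B, of probability at least eta / 2, the compensator
    is at least the mass of g before time B. The resulting bound (m + 1) / (eta / 2)
    does not depend on B. *)
Lemma summable_integral_lty (g : R * L -> R) :
  measurable_fun [set: R * L] g -> (forall z, 0 <= g z <= 1)%R ->
  (forall z, (z.1 < 0)%R -> g z = 0%R) ->
  {ae P, forall w, exists m : nat, forall N, (Sum g N w <= m%:R)%R} ->
  \int[mu]_z (g z)%:E < +oo.
Proof.
move=> mg g01 gneg gsum.
have g0 z : (0 <= g z)%R by case/andP: (g01 z).
pose gE z := (g z)%:E.
have mgE : measurable_fun [set: R * L] gE by exact/measurable_EFinP.
have gE0 z : 0 <= gE z by rewrite lee_fin.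
pose A (m : nat) := \bigcap_N [set w | (Sum g N w <= m%:R)%R].
have mSle N (m : nat) : measurable [set w | (Sum g N w <= m%:R)%R].
  have := @measurable_fun_ler _ _ _ setT (Sum g N) (cst m%:R)
    (measurable_mark_sum me mU N mg) (measurable_cst _) measurableT [set true] I.
  by rewrite setTI.
have mA m : measurable (A m) by apply: bigcap_measurableType => N _; exact: mSle.
have [m PA] : exists m, 0 < P (A m).
  apply: contrapT => /forallNP PA0.
  have nA m : P.-negligible (A m).
    apply/negligibleP => //; apply/eqP; rewrite -measure_le0.
    by rewrite leNgt; apply/negP; exact: PA0.
  have : P.-negligible setT.
    rewrite -(setvU (\bigcup_m A m)); apply: negligibleU.
      apply: negligibleS gsum => w; apply: contra_not => -[m /= hm].
      by exists m => // N _; exact: hm.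
    exact: negligible_bigcup.
  move=> /negligibleP => /(_ measurableT) /eqP.
  by rewrite [X in X == _]probability_setT onee_eq0.
pose eta := fine (P (A m)).
have PAE : P (A m) = eta%:E by rewrite fineK// fin_num_measure.
have eta0 : (0 < eta)%R by rewrite -lte_fin -PAE.
pose C := ((m%:R + 1) / (eta / 2))%R.
have bound (B : nat) : slot_mass Q gE (0%R, B%:R) <= C%:E.
  have eta20 : (0 < eta / 2)%R by rewrite divr_gt0.
  have [N0 /(_ N0 (leqnn _)) hN0] := late_arrival_small (ler0n R B) eta20.
  pose E := A m `\` [set w | (T N0 w < B%:R)%R].
  have mE : measurable E by apply: measurableD => //; exact: measurable_late.
  have PE : (eta / 2)%:E <= P E.
    rewrite measureD//; last 2 first.
    - exact: measurable_late.
    - by rewrite ltey_eq fin_num_measure.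
    rewrite [X in _ <= X - _]PAE leeBrDr; last first.
      by rewrite fin_num_measure//; apply: measurableI => //; exact: measurable_late.
    apply: (@le_trans _ _ ((eta / 2)%:E + (eta / 2)%:E)).
      rewrite leeD2l//; apply: le_trans hN0; apply: le_measure; rewrite ?inE//.
      - by apply: measurableI => //; exact: measurable_late.
      - exact: measurable_late.
    by rewrite -EFinD lee_fin; lra.
  pose Z (s : R * (R * R)) : \bar R := (s.2.1 <= m%:R)%R%:R%:E.
  have mZ : measurable_fun [set: R * (R * R)] Z.
    apply/measurable_EFinP; apply: measurable_natr; apply: measurable_fun_ler => //.
    exact: measurableT_comp.
  have Z0 s : 0 <= Z s by rewrite lee_fin.
  have mS n : measurable_fun [set: Omega] (fun w => Z (state g g n w)).
    apply: measurableT_comp => //; apply: measurable_fun_pair.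
      exact: measurable_arrival.
    by apply: measurable_fun_pair; exact: measurable_mark_sum.
  have mslot n : measurable_fun [set: Omega]
      (fun w => slot_mass Q gE (T n w, T n.+1 w)).
    apply: measurableT_comp; first exact: measurable_slot_mass.
    by apply: measurable_fun_pair; exact: measurable_arrival.
  have h1 : \sum_(n < N0) \int[P]_w (Z (state g g n w) * gE (pt n w)) <=
      (m%:R + 1)%:E.
    rewrite -ge0_integral_sum//; last 2 first.
    - move=> n; apply: emeasurable_funM => //.
      by apply: measurableT_comp => //; exact: measurable_marked_point.
    - by move=> n w _; rewrite mule_ge0.
    rewrite -[leRHS](integral_probability_cst P); apply: ge0_le_integral => //.
    - by move=> w _; apply: sume_ge0 => n _; rewrite mule_ge0.
    - apply: emeasurable_sum => n; apply: emeasurable_funM => //.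
      by apply: measurableT_comp => //; exact: measurable_marked_point.
    move=> w _; under eq_bigr do rewrite -EFinM.
    by rewrite sumEFin lee_fin; exact: stopped_sum_le.
  have h2 : (eta / 2)%:E * slot_mass Q gE (0%R, B%:R) <= (m%:R + 1)%:E.
    apply: le_trans h1.
    under eq_bigr do rewrite (compensator step)//.
    rewrite -ge0_integral_sum//; last 2 first.
    - by move=> n; apply: emeasurable_funM.
    - by move=> n w _; rewrite mule_ge0// slot_mass_ge0.
    apply: (@le_trans _ _ (\int[P]_w ((\1_E w)%:E * slot_mass Q gE (0%R, B%:R)))).
      rewrite ge0_integralZr//; last 2 first.
      - exact/measurable_EFinP/measurable_indic.
      - exact: slot_mass_ge0.
      by rewrite integral_indic// setIT lee_wpmul2r// slot_mass_ge0.
    apply: ge0_le_integral => //.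
    - by move=> w _; rewrite mule_ge0 ?slot_mass_ge0// lee_fin.
    - apply: emeasurable_funM => //; exact/measurable_EFinP/measurable_indic.
    - by apply: emeasurable_sum => n; apply: emeasurable_funM.
    move=> w _; rewrite indicE; case: (boolP (w \in E)) => wE; last first.
      by rewrite mul0e; apply: sume_ge0 => n _; rewrite mule_ge0// slot_mass_ge0.
    move: wE; rewrite inE => -[Amw /negP]; rewrite -leNgt => BT.
    rewrite mul1e; apply: (@le_trans _ _ (slot_mass Q gE (0%R, T N0 w))).
      apply: ge0_le_integral => //.
      - by move=> z _; rewrite mule_ge0.
      - exact: measurable_slot.
      - exact: measurable_slot.
      move=> z _; apply: lee_wpmul2l => //; rewrite lee_fin ler_nat.
      by case: (leP 0%R z.1) => //= _; case: ltP => //= zB; rewrite (lt_le_trans zB).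
    rewrite -(sum_slot_mass Q e_gt0)//; apply: lee_sum => n _.
    by rewrite /Z/= (Amw n I) mul1e.
  by rewrite /C mulrC EFinM lee_pdivlMl.
apply: (@le_lt_trans _ _ C%:E); last exact: ltry.
pose h (B : nat) (z : R * L) := gE z * (0 <= z.1 < B%:R)%R%:R%:E.
have hE (B : nat) z : (z.1 < B%:R)%R -> h B z = gE z.
  move=> zB; rewrite /h zB andbT.
  by case: (leP 0%R z.1) => z0; rewrite ?mule1// mule0 /gE gneg.
apply: (@monotone_integral_le R _ (measurableTypeR R * L)%type mu h gE C%:E).
- by move=> B; exact: measurable_slot.
- by move=> B z; rewrite mule_ge0.
- move=> z B B' BB'; apply: lee_wpmul2l => //; rewrite lee_fin ler_nat.
  case: (leP 0%R z.1) => //= _; case: ltP => //= zB.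
  by rewrite (lt_le_trans zB)// ler_nat.
- move=> z; apply: cvg_near_cst; near=> B; apply: hE.
  by near: B; exact: nbhs_infty_gtr.
- exact: bound.
Unshelve. all: by end_near. Qed.

End summability.

(** * Inserting a point *)

Section insertion.
Context {R : realType} {dL : measure_display} {L : measurableType dL}.
Variable Q : probability L R.
Local Notation mu := (time_mark_measure Q).

Variables (phi : R * L -> R) (D : R * L -> bool).
Hypothesis mphi : measurable_fun [set: R * L] phi.
Hypothesis mD : measurable_fun [set: R * L] D.

Definition hit (z : R * L) : R := (D z)%:R.
Definition miss (z : R * L) : R := (~~ D z)%:R.

Local Open Scope ereal_scope.

Let mhit : measurable_fun [set: R * L] hit.
Proof. exact: measurable_natr. Qed.

Let mmiss : measurable_fun [set: R * L] miss.
Proof. by apply: measurable_natr; exact: measurableT_comp. Qed.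

Let hit0 z : (0 <= hit z)%R. Proof. exact: ler0n. Qed.
Let miss0 z : (0 <= miss z)%R. Proof. exact: ler0n. Qed.

(** The expected value of v at the next state, the next point being weighted
    by k, from the state s made of the current time and sum. *)
Definition transfer (k : R * L -> R) (v : R * R -> \bar R) (s : R * R) : \bar R :=
  \int[mu]_z ((waiting_density s.1 z.1 * k z)%:E * v (z.1, (s.2 + phi z)%R)).

(** Adds to the configuration a point of D later than the current time, without
    advancing the clock, and integrates over its position. *)
Definition insertion (v : R * R -> \bar R) (s : R * R) : \bar R :=
  \int[mu]_z (((s.1 <= z.1)%R%:R * hit z)%:E * v (s.1, (s.2 + phi z)%R)).

Section measurability.
Variables (k : R * L -> R) (v : R * R -> \bar R).
Hypothesis mk : measurable_fun [set: R * L] k.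
Hypothesis k0 : forall z, (0 <= k z)%R.
Hypothesis mv : measurable_fun [set: R * R] v.
Hypothesis v0 : forall s, 0 <= v s.

Let mtransfer2 : measurable_fun [set: (R * R) * (R * L)]
  (fun y => (waiting_density y.1.1 y.2.1 * k y.2)%:E * v (y.2.1, (y.1.2 + phi y.2)%R)).
Proof.
apply: emeasurable_funM.
  apply/measurable_EFinP; apply: measurable_funM.
    by apply: measurable_waiting_density; exact: measurableT_comp.
  exact: measurableT_comp.
apply: measurableT_comp => //; apply: measurable_fun_pair.
  exact: measurableT_comp.
by apply: measurable_funD; exact: measurableT_comp.
Qed.

Let minsertion2 : measurable_fun [set: (R * R) * (R * L)]
  (fun y => ((y.1.1 <= y.2.1)%R%:R * hit y.2)%:E * v (y.1.1, (y.1.2 + phi y.2)%R)).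
Proof.
apply: emeasurable_funM.
  apply/measurable_EFinP; apply: measurable_funM.
    by apply: measurable_natr; apply: measurable_fun_ler; exact: measurableT_comp.
  exact: measurableT_comp.
apply: measurableT_comp => //; apply: measurable_fun_pair.
  exact: measurableT_comp.
by apply: measurable_funD; exact: measurableT_comp.
Qed.

Lemma transfer_ge0 s : 0 <= transfer k v s.
Proof.
apply: integral_ge0 => z _; rewrite mule_ge0// lee_fin mulr_ge0//.
exact: waiting_density_ge0.
Qed.

Lemma insertion_ge0 s : 0 <= insertion v s.
Proof. by apply: integral_ge0 => z _; rewrite mule_ge0// lee_fin mulr_ge0. Qed.

Lemma measurable_transfer : measurable_fun [set: R * R] (transfer k v).
Proof.
apply: (@measurable_fun_fubini_tonelli_F _ _ (R * R)%type
  (measurableTypeR R * L)%type R mu _ mtransfer2) => y.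
by rewrite mule_ge0// lee_fin mulr_ge0// waiting_density_ge0.
Qed.

Lemma measurable_insertion : measurable_fun [set: R * R] (insertion v).
Proof.
apply: (@measurable_fun_fubini_tonelli_F _ _ (R * R)%type
  (measurableTypeR R * L)%type R mu _ minsertion2) => y.
by rewrite mule_ge0// lee_fin mulr_ge0.
Qed.

Lemma measurable_transfer_integrand s : measurable_fun [set: R * L]
  (fun z => (waiting_density s.1 z.1 * k z)%:E * v (z.1, (s.2 + phi z)%R)).
Proof.
exact: (measurableT_comp mtransfer2 (@measurable_pair1 _ _ _ _ s)).
Qed.

Lemma measurable_insertion_integrand s : measurable_fun [set: R * L]
  (fun z => ((s.1 <= z.1)%R%:R * hit z)%:E * v (s.1, (s.2 + phi z)%R)).
Proof.
exact: (measurableT_comp minsertion2 (@measurable_pair1 _ _ _ _ s)).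
Qed.

End measurability.

Lemma transfer_le (k : R * L -> R) (v v' : R * R -> \bar R) s : measurable_fun [set: R * L] k ->
  (forall z, (0 <= k z)%R) ->
  measurable_fun [set: R * R] v -> measurable_fun [set: R * R] v' ->
  (forall s, 0 <= v s) -> (forall s, v s <= v' s) ->
  transfer k v s <= transfer k v' s.
Proof.
move=> mk k0 mv mv' v0 vv'.
have w0 z : 0 <= (waiting_density s.1 z.1 * k z)%:E.
  by rewrite lee_fin mulr_ge0// waiting_density_ge0.
apply: ge0_le_integral => //.
- by move=> z _; rewrite mule_ge0.
- exact: measurable_transfer_integrand.
- exact: measurable_transfer_integrand.
- by move=> z _; exact: lee_wpmul2l.
Qed.

(** Let z be the inserted point and z' the next point of the process. If z'
    comes first, the insertion can wait until after the step to z'. If z comes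
    first, then exp (t - z'.1) = exp (t - z.1) exp (z.1 - z'.1) shows that z and
    z' are reached by two successive steps. The proof compares the three kernels
    in (z, z') pointwise. *)
Lemma insertion_transfer_le (v : R * R -> \bar R) s :
  measurable_fun [set: R * R] v -> (forall s, 0 <= v s) ->
  insertion (transfer miss v) s <=
  transfer hit (transfer miss v) s + transfer miss (insertion v) s.
Proof.
case: s => t x mv v0.
pose G (z z' : R * L) := (hit z * miss z')%:E * v (z'.1, (x + phi z + phi z')%R).
have G0 z z' : 0 <= G z z' by rewrite mule_ge0// lee_fin mulr_ge0.
have mG : measurable_fun [set: (R * L) * (R * L)] (fun y => G y.1 y.2).
  apply: emeasurable_funM.
    by apply/measurable_EFinP; apply: measurable_funM; exact: measurableT_comp.
  apply: measurableT_comp => //; apply: measurable_fun_pair.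
    exact: measurableT_comp.
  apply: measurable_funD; last exact: measurableT_comp.
  by apply: measurable_funD => //; exact: measurableT_comp.
pose I (c : R -> R -> R) := \int[mu]_z \int[mu]_z' ((c z.1 z'.1)%:E * G z z').
have mI (c : R -> R -> R) : measurable_fun [set: R * R] (fun y => c y.1 y.2) ->
    measurable_fun [set: (R * L) * (R * L)]
      (fun y => (c y.1.1 y.2.1)%:E * G y.1 y.2).
  move=> mc; apply: emeasurable_funM => //; apply/measurable_EFinP.
  have mp : measurable_fun [set: (R * L) * (R * L)] (fun y => (y.1.1, y.2.1)).
    by apply: measurable_fun_pair; exact: measurableT_comp.
  exact: (measurableT_comp mc mp).
have mI1 (c : R -> R -> R) (z : R * L) : measurable_fun [set: R * R] (fun y => c y.1 y.2) ->
    measurable_fun [set: R * L] (fun z' => (c z.1 z'.1)%:E * G z z').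
  by move=> /mI mc; exact: (measurableT_comp mc (@measurable_pair1 _ _ _ _ z)).
have wd0 r r' : (0 <= waiting_density r r')%R by exact: waiting_density_ge0.
have mwd d (S : measurableType d) (f g : S -> R) :
    measurable_fun [set: S] f -> measurable_fun [set: S] g ->
    measurable_fun [set: S] (fun y => waiting_density (f y) (g y)).
  exact: measurable_waiting_density.
have mle d (S : measurableType d) (f g : S -> R) :
    measurable_fun [set: S] f -> measurable_fun [set: S] g ->
    measurable_fun [set: S] (fun y => (f y <= g y)%R%:R : R).
  by move=> mf mg; apply: measurable_natr; exact: measurable_fun_ler.
have nest (b : R -> R) (c : R -> R -> R) :
    (forall r, (0 <= b r)%R) -> (forall r r', (0 <= c r r')%R) ->
    measurable_fun [set: R * R] (fun y => c y.1 y.2) ->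
    \int[mu]_z ((b z.1 * hit z)%:E * \int[mu]_z' ((c z.1 z'.1 * miss z')%:E *
      v (z'.1, (x + phi z + phi z')%R))) = I (fun r r' => b r * c r r')%R.
  move=> b0 c0 mc; apply: eq_integral => z _; rewrite -ge0_integralZl//.
  - apply: eq_integral => z' _; rewrite /G !muleA -!EFinM.
    by congr (_%:E * _); ring.
  - apply: emeasurable_funM.
      apply/measurable_EFinP; apply: measurable_funM => //.
      have mp : measurable_fun [set: R * L] (fun z' : R * L => (z.1, z'.1) : R * R).
        exact: measurable_fun_pair.
      exact: (measurableT_comp mc mp).
    apply: measurableT_comp => //; apply: measurable_fun_pair => //.
    exact: measurable_funD.
  - by move=> z' _; rewrite mule_ge0// lee_fin mulr_ge0.
  - by rewrite lee_fin mulr_ge0.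
have -> : insertion (transfer miss v) (t, x) =
    I (fun r r' => (t <= r)%R%:R * waiting_density t r')%R.
  by rewrite -(nest (fun r => (t <= r)%R%:R) (fun _ r' => waiting_density t r'))//; exact: mwd.
have -> : transfer hit (transfer miss v) (t, x) =
    I (fun r r' => waiting_density t r * waiting_density r r')%R.
  by rewrite -(nest (waiting_density t) waiting_density)//; exact: mwd.
have -> : transfer miss (insertion v) (t, x) =
    I (fun r r' => waiting_density t r' * (r' <= r)%R%:R)%R.
  rewrite /I (@fubini_tonelli _ _ _ _ _ mu mu (fun y : (R * L) * (R * L) =>
    (waiting_density t y.2.1 * (y.2.1 <= y.1.1)%R%:R)%:E * G y.1 y.2)); last 2 first.
  - apply: (mI (fun r r' => waiting_density t r' * (r' <= r)%R%:R)%R).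
    by apply: measurable_funM; [exact: mwd|exact: mle].
  - move=> y; apply: mule_ge0; last exact: G0.
    by rewrite lee_fin; apply: mulr_ge0; [exact: wd0|exact: ler0n].
  apply: eq_integral => z' _; rewrite -ge0_integralZl//.
  - apply: eq_integral => z _; rewrite /G /= !muleA -!EFinM.
    by rewrite (addrAC x); congr (_%:E * _); ring.
  - exact: (measurable_insertion_integrand mv (z'.1, (x + phi z')%R)).
  - by move=> z _; rewrite mule_ge0// lee_fin mulr_ge0.
  - by rewrite lee_fin; apply: mulr_ge0; [exact: wd0|exact: miss0].
have I0 (c : R -> R -> R) z : (forall r r', (0 <= c r r')%R) ->
    0 <= \int[mu]_z' ((c z.1 z'.1)%:E * G z z').
  by move=> c0; apply: integral_ge0 => z' _; rewrite mule_ge0// lee_fin.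
have mII (c : R -> R -> R) : (forall r r', (0 <= c r r')%R) ->
    measurable_fun [set: R * R] (fun y => c y.1 y.2) ->
    measurable_fun [set: R * L] (fun z => \int[mu]_z' ((c z.1 z'.1)%:E * G z z')).
  move=> c0 mc; apply: (@measurable_fun_fubini_tonelli_F _ _ (R * L)%type
    (measurableTypeR R * L)%type R mu _ (mI c mc)) => y.
  by rewrite mule_ge0// lee_fin.
pose c1 := (fun r r' => (t <= r)%R%:R * waiting_density t r')%R.
have c10 r r' : (0 <= c1 r r')%R by apply: mulr_ge0; [exact: ler0n|exact: wd0].
pose c2 := (fun r r' => waiting_density t r * waiting_density r r')%R.
have c20 r r' : (0 <= c2 r r')%R by apply: mulr_ge0; exact: wd0.
pose c3 := (fun r r' => waiting_density t r' * (r' <= r)%R%:R)%R.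
have c30 r r' : (0 <= c3 r r')%R by apply: mulr_ge0; [exact: wd0|exact: ler0n].
have mc1 : measurable_fun [set: R * R]
    (fun y => (t <= y.1)%R%:R * waiting_density t y.2)%R.
  by apply: measurable_funM; [exact: mle|exact: mwd].
have mc2 : measurable_fun [set: R * R]
    (fun y => waiting_density t y.1 * waiting_density y.1 y.2)%R.
  by apply: measurable_funM; exact: mwd.
have mc3 : measurable_fun [set: R * R]
    (fun y => waiting_density t y.2 * (y.2 <= y.1)%R%:R)%R.
  by apply: measurable_funM; [exact: mwd|exact: mle].
rewrite -/c1 -/c2 -/c3 /I -ge0_integralD//; last 4 first.
- by move=> z _; exact: (I0 c2).
- exact: (mII c2).
- by move=> z _; exact: (I0 c3).
- exact: (mII c3).
apply: ge0_le_integral => //.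
- by move=> z _; exact: (I0 c1).
- exact: (mII c1).
- apply: emeasurable_funD.
    exact: (mII c2).
  exact: (mII c3).
move=> z _; rewrite -ge0_integralD//; last 4 first.
- by move=> z' _; apply: mule_ge0 => //; rewrite lee_fin.
- exact: (mI1 c2 z mc2).
- by move=> z' _; apply: mule_ge0 => //; rewrite lee_fin.
- exact: (mI1 c3 z mc3).
apply: ge0_le_integral => //.
- by move=> z' _; apply: mule_ge0 => //; rewrite lee_fin.
- exact: (mI1 c1 z mc1).
- apply: emeasurable_funD.
    exact: (mI1 c2 z mc2).
  exact: (mI1 c3 z mc3).
move=> z' _; rewrite -ge0_muleDl ?lee_fin//.
apply: lee_wpmul2r => //; rewrite lee_fin /c1 /c2 /c3.
case: (leP t z.1) => tz /=; last first.
  by rewrite mul0r; apply: addr_ge0; [exact: c20|exact: c30].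
case: (leP z'.1 z.1) => zz /=; first by rewrite mul1r mulr1 lerDr; apply: mulr_ge0; exact: wd0.
rewrite mul1r mulr0 addr0 /waiting_density tz (ltW zz) (le_trans tz (ltW zz)).
by rewrite -expRD le_eqVlt; apply/orP; left; apply/eqP; congr expR; ring.
Qed.

End insertion.

Section insertion_bound.
Context {R : realType} {dO dL : measure_display} {Omega : measurableType dO}.
Context {L : measurableType dL} (P : probability Omega R) (Q : probability L R).
Variables (e : nat -> Omega -> R) (U : nat -> Omega -> L).
Hypothesis me : forall n, measurable_fun [set: Omega] (e n).
Hypothesis mU : forall n, measurable_fun [set: Omega] (U n).
Hypothesis e_gt0 : forall n w, 0 < e n w.
Hypothesis step : renewal_property e U P Q.

Local Notation mu := (time_mark_measure Q).
Local Notation T := (arrival e).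
Local Notation pt := (marked_point e U).
Local Notation Sum := (mark_sum e U).

Variables (phi : R * L -> R) (D : R * L -> bool) (B : R) (psi : R -> R).
Hypothesis mphi : measurable_fun [set: R * L] phi.
Hypothesis mD : measurable_fun [set: R * L] D.
Hypothesis D_lt : forall z, D z -> 0 <= z.1 < B.
Hypothesis mpsi : measurable_fun [set: R] psi.
Hypothesis psi_ge0 : forall x, 0 <= psi x.

Local Notation hit := (hit D).
Local Notation miss := (miss D).
Local Notation transfer := (transfer Q phi).
Local Notation insertion := (insertion Q phi D).
Local Notation X := (Sum phi).
Local Notation N := (Sum hit).
Local Open Scope ereal_scope.

Let mhit : measurable_fun [set: R * L] hit.
Proof. exact: measurable_natr. Qed.

Let mmiss : measurable_fun [set: R * L] miss.
Proof. by apply: measurable_natr; exact: measurableT_comp. Qed.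

Let hit0 z : (0 <= hit z)%R. Proof. exact: ler0n. Qed.
Let miss0 z : (0 <= miss z)%R. Proof. exact: ler0n. Qed.

(** The clock must have passed B, so that no later point lies in D. *)
Definition late_value (s : R * R) : \bar R := (psi s.2 * (B <= s.1)%R%:R)%:E.

(** The expected late value after M further points, none of which lies in D. *)
Fixpoint avoid_value M : R * R -> \bar R :=
  if M is M'.+1 then transfer miss (avoid_value M') else late_value.

(** The expected late value after M further points, exactly one of which lies
    in D. *)
Fixpoint one_hit_value M : R * R -> \bar R :=
  if M is M'.+1 then
    fun s => transfer hit (avoid_value M') s + transfer miss (one_hit_value M') s
  else fun=> 0.

Lemma late_value_ge0 s : 0 <= late_value s.
Proof. by rewrite lee_fin mulr_ge0. Qed.

Lemma measurable_late_value : measurable_fun [set: R * R] late_value.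
Proof.
apply/measurable_EFinP; apply: measurable_funM; first exact: measurableT_comp.
by apply: measurable_natr; apply: measurable_fun_ler => //; exact: measurableT_comp.
Qed.

Lemma avoid_value_ge0 M s : 0 <= avoid_value M s.
Proof.
elim: M s => [|M IHM] s /=; first exact: late_value_ge0.
by apply: transfer_ge0 => //; exact: IHM.
Qed.

Lemma measurable_avoid_value M : measurable_fun [set: R * R] (avoid_value M).
Proof.
elim: M => [|M IHM] /=; first exact: measurable_late_value.
by apply: measurable_transfer => // s; exact: avoid_value_ge0.
Qed.

Lemma one_hit_value_ge0 M s : 0 <= one_hit_value M s.
Proof.
elim: M s => [|M IHM] s //=; apply: adde_ge0; apply: transfer_ge0 => //.
exact: avoid_value_ge0.
Qed.

Lemma measurable_one_hit_value M : measurable_fun [set: R * R] (one_hit_value M).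
Proof.
elim: M => [|M IHM] /=; first exact: measurable_cst.
apply: emeasurable_funD; apply: measurable_transfer => //.
- exact: measurable_avoid_value.
- exact: avoid_value_ge0.
- exact: one_hit_value_ge0.
Qed.

(** [insertion_transfer_le] pushes the insertion through the M steps. It ends
    with 0: once the clock has passed B nothing can be inserted. *)
Lemma insertion_avoid_le M s : insertion (avoid_value M) s <= one_hit_value M.+1 s.
Proof.
elim: M s => [|M IHM] s.
  apply: (@le_trans _ _ 0); last exact: one_hit_value_ge0.
  rewrite le_eqVlt; apply/orP; left; apply/eqP.
  apply: integral0_eq => z _ /=; rewrite /late_value /hit.
  case Dz : (D z); last by rewrite mulr0 mul0e.
  have /andP[_ zB] := D_lt Dz.
  case: (leP s.1 z.1) => sz; last by rewrite mul0r mul0e.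
  have -> : (B <= s.1)%R = false by apply/negbTE; rewrite -ltNge (le_lt_trans sz).
  by rewrite mulr0 mule0.
apply: (@le_trans _ _ (transfer hit (transfer miss (avoid_value M)) s +
    transfer miss (insertion (avoid_value M)) s)).
  apply: insertion_transfer_le => //; first exact: measurable_avoid_value.
  exact: avoid_value_ge0.
rewrite leeD2l//; apply: transfer_le => //.
- by apply: measurable_insertion => //;
    [exact: measurable_avoid_value|exact: avoid_value_ge0].
- exact: measurable_one_hit_value M.+1.
- by move=> s'; apply: insertion_ge0; exact: avoid_value_ge0.
Qed.

Lemma renewal_transfer (kappa : R -> R) (k : R * L -> R) (v : R * R -> \bar R) n
    (x0 : R) :
  measurable_fun [set: R] kappa -> (forall r, (0 <= kappa r)%R) ->
  measurable_fun [set: R * L] k -> (forall z, (0 <= k z)%R) ->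
  measurable_fun [set: R * R] v -> (forall s, 0 <= v s) ->
  \int[P]_w ((kappa (N n w) * k (pt n w))%:E * v (T n.+1 w, x0 + X n.+1 w)%R) =
  \int[P]_w ((kappa (N n w))%:E * transfer k v (T n w, x0 + X n w)%R).
Proof.
move=> mkappa kappa0 mk k0 mv v0.
pose Phi (s : (R * (R * R)) * (R * L)) :=
  (kappa s.1.2.2 * k s.2)%:E * v (s.2.1, x0 + s.1.2.1 + phi s.2)%R.
have mPhi : measurable_fun [set: (R * (R * R)) * (R * L)] Phi.
  apply: emeasurable_funM.
    apply/measurable_EFinP; apply: measurable_funM; apply: measurableT_comp => //.
    by do 2 apply: measurableT_comp => //.
  apply: measurableT_comp => //; apply: measurable_fun_pair.
    exact: measurableT_comp.
  apply: measurable_funD; last exact: measurableT_comp.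
  by apply: measurable_funD => //; do 2 apply: measurableT_comp => //.
have Phi0 s : 0 <= Phi s by rewrite mule_ge0// lee_fin mulr_ge0.
have := step n mphi mhit mPhi Phi0; rewrite /Phi/= => h.
transitivity (\int[P]_w ((kappa (N n w) * k (pt n w))%:E *
    v (T n.+1 w, x0 + X n w + phi (pt n w))%R)).
  by apply: eq_integral => w _; rewrite mark_sumS addrA.
rewrite h; apply: eq_integral => w _ /=.
rewrite -ge0_integralZl//; last 3 first.
- exact: (measurable_transfer_integrand mphi mk mv (T n w, x0 + X n w)%R).
- move=> z _; apply: mule_ge0 => //; rewrite lee_fin; apply: mulr_ge0 => //.
  exact: waiting_density_ge0.
- by rewrite lee_fin.
by apply: eq_integral => z _; rewrite !muleA -!EFinM/=; congr (_%:E * _); ring.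
Qed.

Definition eq0r (r : R) : R := (r == 0%R)%:R.
Definition eq1r (r : R) : R := (r == 1%R)%:R.

Let meq0 : measurable_fun [set: R] eq0r.
Proof. by apply: measurable_natr; exact: measurable_fun_eqr. Qed.
Let meq1 : measurable_fun [set: R] eq1r.
Proof. by apply: measurable_natr; exact: measurable_fun_eqr. Qed.

Lemma hit_count n w : N n w = (\sum_(i < n) D (pt i w))%:R.
Proof. by rewrite /mark_sum natr_sum. Qed.

Lemma no_hitS n w : eq0r (N n.+1 w) = (eq0r (N n w) * miss (pt n w))%R.
Proof.
rewrite mark_sumS hit_count /hit /miss /eq0r -natrD !pnatr_eq0 -natrM addn_eq0.
by case: (_ == 0)%N; case: (D _).
Qed.

Lemma one_hitS n w : eq1r (N n.+1 w) =
  (eq0r (N n w) * hit (pt n w) + eq1r (N n w) * miss (pt n w))%R.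
Proof.
rewrite mark_sumS hit_count /hit /miss /eq0r /eq1r -natrD !pnatr_eq1 pnatr_eq0.
rewrite -!natrM -natrD.
by case: (\sum_(i < n) _)%N => [|[|m]]; case: (D _).
Qed.

Let mX n : measurable_fun [set: Omega] (X n).
Proof. exact: measurable_mark_sum. Qed.
Let mN n : measurable_fun [set: Omega] (N n).
Proof. exact: measurable_mark_sum. Qed.

Let mstate n (x0 : R) :
  measurable_fun [set: Omega] (fun w => (T n w, x0 + X n w)%R).
Proof.
by apply: measurable_fun_pair; [exact: measurable_arrival|exact: measurable_funD].
Qed.

Lemma avoid_valueE k n (x0 : R) :
  \int[P]_w ((eq0r (N n w))%:E * avoid_value k (T n w, x0 + X n w)%R) =
  \int[P]_w ((eq0r (N (n + k) w))%:E * late_value (T (n + k) w, x0 + X (n + k) w)%R).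
Proof.
elim: k n => [|k IHk] n; first by rewrite addn0.
rewrite addnS -addSn -IHk /= -renewal_transfer//.
- by apply: eq_integral => w _; rewrite no_hitS.
- exact: measurable_avoid_value.
- exact: avoid_value_ge0.
Qed.

Lemma one_hit_valueE k n :
  \int[P]_w ((eq0r (N n w))%:E * one_hit_value k (T n w, 0 + X n w)%R) +
  \int[P]_w ((eq1r (N n w))%:E * avoid_value k (T n w, 0 + X n w)%R) =
  \int[P]_w ((eq1r (N (n + k) w))%:E * late_value (T (n + k) w, 0 + X (n + k) w)%R).
Proof.
have k0 r : (0 <= eq0r r)%R by exact: ler0n.
have k1 r : (0 <= eq1r r)%R by exact: ler0n.
elim: k n => [|k IHk] n.
  by rewrite addn0 [X in X + _]integral0_eq ?add0e// => w _; rewrite mule0.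
rewrite addnS -addSn -IHk /=.
pose a n w := avoid_value k (T n w, 0 + X n w)%R.
have a0 m w : 0 <= a m w by exact: avoid_value_ge0.
have ma m : measurable_fun [set: Omega] (a m).
  by apply: measurableT_comp; [exact: measurable_avoid_value|exact: mstate].
have mEN f m : measurable_fun [set: R] f ->
    measurable_fun [set: Omega] (fun w => (f (N m w))%:E).
  by move=> mf; apply/measurable_EFinP; exact: measurableT_comp.
transitivity (\int[P]_w ((eq0r (N n w))%:E * transfer hit (avoid_value k) (T n w, 0 + X n w)%R) +
  \int[P]_w ((eq0r (N n w))%:E * transfer miss (one_hit_value k) (T n w, 0 + X n w)%R) +
  \int[P]_w ((eq1r (N n w))%:E * transfer miss (avoid_value k) (T n w, 0 + X n w)%R)).
  congr (_ + _); rewrite -ge0_integralD//.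
  - apply: eq_integral => w _; rewrite ge0_muleDr//; apply: transfer_ge0 => //.
      exact: avoid_value_ge0.
    exact: one_hit_value_ge0.
  - move=> w _; rewrite mule_ge0 ?lee_fin//; apply: transfer_ge0 => //.
    exact: avoid_value_ge0.
  - apply: emeasurable_funM; first exact: mEN.
    apply: measurableT_comp; last exact: mstate.
    by apply: measurable_transfer => //; [exact: measurable_avoid_value|exact: avoid_value_ge0].
  - move=> w _; rewrite mule_ge0 ?lee_fin//; apply: transfer_ge0 => //.
    exact: one_hit_value_ge0.
  - apply: emeasurable_funM; first exact: mEN.
    apply: measurableT_comp; last exact: mstate.
    by apply: measurable_transfer => //; [exact: measurable_one_hit_value|exact: one_hit_value_ge0].
rewrite -!renewal_transfer//; last 6 first.
- exact: measurable_avoid_value.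
- exact: avoid_value_ge0.
- exact: measurable_one_hit_value.
- exact: one_hit_value_ge0.
- exact: measurable_avoid_value.
- exact: avoid_value_ge0.
rewrite [X in X + _]addeC -addeA; congr (_ + _).
  by apply: eq_integral => w _; rewrite no_hitS.
have mh (z : R * L -> R) : measurable_fun [set: R * L] z -> measurable_fun [set: Omega] (fun w => (z (pt n w))).
  by move=> mz; apply: measurableT_comp => //; exact: measurable_marked_point.
rewrite -ge0_integralD//.
- apply: eq_integral => w _; rewrite one_hitS EFinD ge0_muleDl// lee_fin mulr_ge0//.
- by move=> w _; rewrite mule_ge0 ?lee_fin ?mulr_ge0//; exact: a0.
- apply: emeasurable_funM; last exact: ma.
  apply/measurable_EFinP; apply: measurable_funM; last exact: mh.
  exact: (measurableT_comp meq0 (mN n)).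
- by move=> w _; rewrite mule_ge0 ?lee_fin ?mulr_ge0//; exact: a0.
- apply: emeasurable_funM; last exact: ma.
  apply/measurable_EFinP; apply: measurable_funM; last exact: mh.
  exact: (measurableT_comp meq1 (mN n)).
Qed.

Definition avoid_late M w : R := (eq0r (N M w) * (B <= T M w)%R%:R)%R.

Let avoid_late_ge0 M w : (0 <= avoid_late M w)%R.
Proof. by rewrite mulr_ge0. Qed.

Let mavoid_late M : measurable_fun [set: Omega] (avoid_late M).
Proof.
apply: measurable_funM; first exact: (measurableT_comp meq0 (mN M)).
apply: measurable_natr; apply: measurable_fun_ler => //.
exact: measurable_arrival.
Qed.

(** Pointwise 1 <= avoid_late + N_M + 1_(T_M < B). By Campbell's inequality the
    expectation of N_M is at most mu(D), which leaves 1 - 1/2 - 1/4. *)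
Lemma avoid_late_ge M :
  \int[mu]_z (hit z)%:E <= 2^-1%:E ->
  P [set w | (T M w < B)%R] <= 4^-1%:E ->
  4^-1%:E <= \int[P]_w (avoid_late M w)%:E.
Proof.
move=> hD hT.
have mNE : measurable_fun [set: Omega] (fun w => (N M w)%:E).
  exact/measurable_EFinP.
have N0 w : (0 <= N M w)%R by rewrite hit_count.
have mlt := measurable_late me M B.
have hN : \int[P]_w (N M w)%:E <= 2^-1%:E.
  apply: le_trans hD; apply: le_trans (campbell_le me mU e_gt0 step M _ _).
  - rewrite -ge0_integral_sum//; last 2 first.
    + move=> n; apply/measurable_EFinP; apply: measurableT_comp => //.
      exact: measurable_marked_point.
    + by move=> n w _; rewrite lee_fin.
    by under [leRHS]eq_integral do rewrite sumEFin.
  - exact/measurable_EFinP.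
  - by move=> z; rewrite lee_fin.
have h1 : 1 <= \int[P]_w ((avoid_late M w)%:E + (N M w)%:E +
    (\1_[set w | (T M w < B)%R] w)%:E).
  rewrite -[leLHS](integral_probability_cst P); apply: ge0_le_integral => //.
    apply: emeasurable_funD; last exact/measurable_EFinP/measurable_indic.
    by apply: emeasurable_funD => //; exact/measurable_EFinP.
  move=> w _; rewrite -!EFinD lee_fin indicE /avoid_late.
  rewrite (_ : (w \in _) = (T M w < B)%R); last by apply/idP/idP; rewrite inE.
  rewrite hit_count /eq0r.
  case: (leP B (T M w)) => /= BT; last by rewrite mulr0 add0r ?mulr1n lerDr.
  rewrite mulr1 addr0 -natrD ler1n pnatr_eq0.
  by case: (\sum_(i < M) _)%N.
rewrite ge0_integralD// in h1; last 3 first.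
- by move=> w _; rewrite adde_ge0// lee_fin.
- by apply: emeasurable_funD => //; exact/measurable_EFinP.
- exact/measurable_EFinP/measurable_indic.
rewrite ge0_integralD// in h1; last 3 first.
- by move=> w _; rewrite lee_fin.
- exact/measurable_EFinP.
- by move=> w _; rewrite lee_fin.
rewrite integral_indic// setIT in h1.
have h2 : 1 <= \int[P]_w (avoid_late M w)%:E + (2^-1 + 4^-1)%:E.
  by apply: le_trans h1 _; rewrite EFinD addeA; apply: leeD hT; rewrite leeD2l.
move: h2; have : 0 <= \int[P]_w (avoid_late M w)%:E.
  by apply: integral_ge0 => w _; rewrite lee_fin.
case: (\int[P]_w (avoid_late M w)%:E) => [r| |] //; rewrite ?leey//.
by rewrite -EFinD !lee_fin => _ ?; lra.
Qed.

Lemma avoid_value_start M x : avoid_value M (0%R, x) =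
  \int[P]_w (avoid_late M w * psi (x + X M w))%:E.
Proof.
have := avoid_valueE M 0 x.
under eq_integral do rewrite /arrival /mark_sum !big_ord0 addr0 /eq0r eqxx mul1e.
rewrite integral_probability_cst add0n => ->.
apply: eq_integral => w _; rewrite /late_value/= -EFinM /avoid_late.
by congr (_%:E); ring.
Qed.

Lemma one_hit_value_start M : one_hit_value M (0%R, 0%R) <=
  \int[P]_w (psi (X M w))%:E.
Proof.
have := one_hit_valueE M 0.
under eq_integral do rewrite /arrival /mark_sum !big_ord0 addr0 /eq0r eqxx mul1e.
rewrite integral_probability_cst add0n [X in _ + X]integral0_eq; last first.
  move=> w _; rewrite /mark_sum big_ord0 /eq1r.
  by rewrite eq_sym oner_eq0 mul0e.
rewrite adde0 => ->; apply: ge0_le_integral => //.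
- by move=> w _; rewrite mule_ge0 ?late_value_ge0// lee_fin.
- apply: emeasurable_funM.
    by apply/measurable_EFinP; exact: (measurableT_comp meq1 (mN M)).
  by apply: measurableT_comp; [exact: measurable_late_value|exact: mstate].
- by apply/measurable_EFinP; exact: measurableT_comp.
move=> w _; rewrite /late_value/= add0r -EFinM lee_fin /eq1r.
case: eqP => _; case: (leP B (T M w)) => _ /=;
  by rewrite ?mulr1n ?mulr0n ?mulr0 ?mul0r ?mulr1 ?mul1r.
Qed.

(** A point z of D is inserted into a configuration with sum x and no point in
    D, and psi (phi z) <= c (psi (phi z + x) + psi x) is averaged over both. The
    first term yields at most the expectation of psi over configurations with one
    point in D; the second, at most mu(D) times the expectation of psi. *)
Theorem insertion_moment (c : R) M : (0 <= c)%R ->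
  (forall u x, (psi u <= c * (psi (u + x) + psi x))%R) ->
  \int[mu]_z (hit z)%:E <= 2^-1%:E ->
  P [set w | (T M w < B)%R] <= 4^-1%:E ->
  \int[mu]_z (hit z * psi (phi z))%:E <=
  (4 * c)%:E * (\int[P]_w (psi (X M.+1 w))%:E + \int[P]_w (psi (X M w))%:E).
Proof.
move=> c0 psi_sub hD hT.
have := avoid_late_ge hD hT; set p := \int[P]_w _ => p4.
set I := \int[mu]_z _; set A := \int[P]_w (psi (X M.+1 w))%:E.
set K := \int[P]_w (psi (X M w))%:E.
have mpX x n : measurable_fun [set: Omega] (fun w => psi (x + X n w)).
  by apply: measurableT_comp => //; exact: measurable_funD.
have mpX' n : measurable_fun [set: Omega] (fun w => psi (X n w)).
  exact: measurableT_comp.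
have mpz : measurable_fun [set: R * L] (fun z => (hit z * psi (phi z))%:E).
  apply/measurable_EFinP; apply: measurable_funM => //.
  exact: measurableT_comp.
pose K' := \int[P]_w (avoid_late M w * psi (X M w))%:E.
have p0 : 0 <= p by apply: integral_ge0 => w _; rewrite lee_fin.
have K'0 : 0 <= K' by apply: integral_ge0 => w _; rewrite lee_fin mulr_ge0.
have A0 : 0 <= A by apply: integral_ge0 => w _; rewrite lee_fin.
have K0 : 0 <= K by apply: integral_ge0 => w _; rewrite lee_fin.
have I0 : 0 <= I by apply: integral_ge0 => z _; rewrite lee_fin mulr_ge0.
have K'K : K' <= K.
  apply: ge0_le_integral => //.
  - by move=> w _; rewrite lee_fin mulr_ge0.
  - by apply/measurable_EFinP; exact: measurable_funM.
  - exact/measurable_EFinP.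
  move=> w _; rewrite lee_fin ler_piMl// /avoid_late /eq0r.
  case: (_ == _); case: (B <= T M w)%R => /=;
  by rewrite ?mulr1n ?mulr0n ?mulr0 ?mul0r ?mulr1.
have m_av : measurable_fun [set: R * L] (fun z => avoid_value M (0%R, phi z)).
  by apply: measurableT_comp; [exact: measurable_avoid_value|exact: measurable_fun_pair].
have J_le : \int[mu]_z ((hit z)%:E * avoid_value M (0%R, phi z)) <= A.
  apply: le_trans (one_hit_value_start M.+1); apply: le_trans (insertion_avoid_le M _).
  apply: ge0_le_integral => //.
  - by move=> z _; rewrite mule_ge0 ?avoid_value_ge0// lee_fin.
  - by apply: emeasurable_funM => //; exact/measurable_EFinP.
  - apply: (measurable_insertion_integrand mphi mD _ (0, 0)%R).
    exact: measurable_avoid_value.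
  move=> z _ /=; rewrite add0r /hit; case Dz : (D z); last by rewrite mulr0 mul0e.
  by have /andP[-> _] := D_lt Dz; rewrite mul1r.
have point z : p * (hit z * psi (phi z))%:E <=
    c%:E * ((hit z)%:E * avoid_value M (0%R, phi z) + (hit z)%:E * K').
  rewrite -ge0_integralZr ?lee_fin ?mulr_ge0//; last 2 first.
  - exact/measurable_EFinP.
  - by move=> w _; rewrite lee_fin.
  rewrite avoid_value_start -ge0_muleDr; last 2 first.
  - by apply: integral_ge0 => w _; rewrite lee_fin mulr_ge0.
  - exact: K'0.
  rewrite /K' -ge0_integralD//; last 4 first.
  - by move=> w _; rewrite lee_fin mulr_ge0.
  - by apply/measurable_EFinP; exact: measurable_funM.
  - by move=> w _; rewrite lee_fin mulr_ge0.
  - by apply/measurable_EFinP; exact: measurable_funM.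
  rewrite muleA -EFinM -ge0_integralZl//; last 3 first.
  - by apply: emeasurable_funD; apply/measurable_EFinP; exact: measurable_funM.
  - by move=> w _; rewrite adde_ge0// lee_fin mulr_ge0.
  - by rewrite lee_fin mulr_ge0.
  apply: ge0_le_integral => //.
  - by move=> w _; rewrite -EFinM lee_fin !mulr_ge0.
  - by apply/measurable_EFinP; exact: measurable_funM.
  - apply: emeasurable_funM => //.
    by apply: emeasurable_funD; apply/measurable_EFinP; exact: measurable_funM.
  move=> w _; rewrite -!(EFinM, EFinD) lee_fin -mulrDr.
  rewrite (_ : (c * hit z * _ = avoid_late M w * (hit z *
    (c * (psi (phi z + X M w) + psi (X M w)))))%R); last by ring.
  by rewrite !ler_wpM2l.
have main : p * I <= c%:E * (A + K).
  rewrite -ge0_integralZl//; last by move=> z _; rewrite lee_fin mulr_ge0.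
  apply: (@le_trans _ _ (\int[mu]_z (c%:E *
    ((hit z)%:E * avoid_value M (0%R, phi z) + (hit z)%:E * K')))).
    apply: ge0_le_integral => //.
    - by move=> z _; rewrite mule_ge0// lee_fin mulr_ge0.
    - exact: measurable_funeM.
    - apply: measurable_funeM; apply: emeasurable_funD.
        by apply: emeasurable_funM => //; exact/measurable_EFinP.
      by apply: emeasurable_funM => //; exact/measurable_EFinP.
  have mhK : measurable_fun [set: R * L] (fun z => (hit z)%:E * K').
    by apply: emeasurable_funM => //; exact/measurable_EFinP.
  have mhav : measurable_fun [set: R * L]
      (fun z => (hit z)%:E * avoid_value M (0%R, phi z)).
    by apply: emeasurable_funM => //; exact/measurable_EFinP.
  have hav0 z : 0 <= (hit z)%:E * avoid_value M (0%R, phi z).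
    by rewrite mule_ge0 ?avoid_value_ge0// lee_fin.
  have hK0 z : 0 <= (hit z)%:E * K' by rewrite mule_ge0// lee_fin.
  rewrite ge0_integralZl//; last 2 first.
  - exact: emeasurable_funD.
  - by move=> z _; rewrite adde_ge0.
  rewrite lee_wpmul2l ?lee_fin// ge0_integralD//; apply: leeD => //.
  rewrite ge0_integralZr//; last 2 first.
  - exact/measurable_EFinP.
  - by move=> z _; rewrite lee_fin.
  apply: le_trans K'K; rewrite -[leRHS]mul1e; apply: lee_wpmul2r => //.
  by apply: le_trans hD _; rewrite lee_fin; lra.
rewrite EFinM -muleA -lee_pdivrMl//.
by apply: le_trans main; exact: lee_wpmul2r.
Qed.

End insertion_bound.

(** * The exponential integral and its inverse *)

Section exponential_integral.
Context {R : realType}.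
Local Notation leb := (@lebesgue_measure R).

Definition gamma_density (x : R) : R := if 0 < x then expR (- x) * x `^ (-1) else 0.

Lemma gamma_densityE x : 0 < x -> gamma_density x = expR (- x) / x.
Proof. by move=> x0; rewrite /gamma_density x0 powR_inv1// ltW. Qed.

Lemma gamma_density_ge0 x : 0 <= gamma_density x.
Proof.
by rewrite /gamma_density; case: ifP => // _; rewrite mulr_ge0 ?expR_ge0 ?powR_ge0.
Qed.

Lemma measurable_gamma_density : measurable_fun [set: R] gamma_density.
Proof.
apply: measurable_fun_ifT => //; first exact: measurable_fun_ltr.
apply: measurable_funM; last exact: measurable_powR.
by apply: measurableT_comp => //; exact: measurable_oppr.
Qed.

Let mgd (b : R -> bool) : measurable_fun [set: R] b ->
  measurable_fun [set: R] (fun x => (gamma_density x * (b x)%:R)%:E).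
Proof.
move=> mb; apply/measurable_EFinP; apply: measurable_funM.
  exact: measurable_gamma_density.
exact: measurable_natr.
Qed.

Let gd0 x (b : bool) : (0 <= (gamma_density x * b%:R)%:E)%E.
Proof. by rewrite lee_fin mulr_ge0// gamma_density_ge0. Qed.

Lemma measurable_oc (a b : R) : measurable_fun [set: R] (fun x => a < x <= b).
Proof. by apply: measurable_and; [exact: measurable_fun_ltr|exact: measurable_fun_ler]. Qed.

Lemma E1E v : 0 <= v ->
  E1 v = (\int[leb]_x (gamma_density x * (v < x)%R%:R)%:E)%E.
Proof.
move=> v0; rewrite /E1 integral_mkcond; apply: eq_integral => x _.
rewrite patchE mem_setE in_itv/= andbT; case: ltP => vx /=.
  by rewrite gamma_densityE ?(le_lt_trans v0)// mulr1.
by rewrite mulr0.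
Qed.

Lemma E1_ge0 (v : R) : 0 <= v -> (0 <= E1 v)%E.
Proof. by move=> v0; rewrite E1E//; apply: integral_ge0 => x _. Qed.

Lemma integral_oc (a b c : R) : a <= b ->
  (\int[leb]_x (c * (a < x <= b)%R%:R)%:E = (c * (b - a))%:E)%E.
Proof.
move=> ab; transitivity (\int[leb]_(x in (`]a, b]%classic : set R)) (c%:E : \bar R))%E.
  rewrite [RHS]integral_mkcond; apply: eq_integral => x _.
  by rewrite patchE mem_setE in_itv/=; case: (_ && _); rewrite ?mulr1 ?mulr0.
rewrite (integral_cst leb)//= lebesgue_measure_itv/= lte_fin EFinM.
have [//|ba] := ltP a b.
by rewrite (_ : b = a) ?subrr//; apply/eqP; rewrite eq_le ab ba.
Qed.

Lemma E1_slice (a b : R) : 0 <= a -> a <= b -> E1 a =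
  (E1 b + \int[leb]_x (gamma_density x * (a < x <= b)%R%:R)%:E)%E.
Proof.
move=> a0 ab; rewrite !E1E//; last exact: le_trans ab.
rewrite -ge0_integralD//; last 2 first.
- by apply: mgd; exact: measurable_fun_ltr.
- by apply: mgd; exact: measurable_oc.
apply: eq_integral => x _; rewrite -EFinD -mulrDr; congr (_ * _)%:E.
rewrite -natrD; congr (_%:R).
case: (leP x b) => xb; last by rewrite andbF addn0 (le_lt_trans ab).
by rewrite andbT add0n.
Qed.

Lemma E1_slice_le (a b : R) : 0 < a -> a <= b ->
  (E1 a <= E1 b + ((b - a) / a)%:E)%E.
Proof.
move=> a0 ab; rewrite (E1_slice (ltW a0) ab) leeD2l// (mulrC (b - a)).
rewrite -integral_oc//; apply: ge0_le_integral => //.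
- by apply: mgd; exact: measurable_oc.
- apply/measurable_EFinP; apply: measurable_funM => //; apply: measurable_natr.
  exact: measurable_oc.
move=> x _; rewrite lee_fin; case: (ltP a x) => ax /=; last by rewrite !mulr0.
rewrite ler_wpM2r// gamma_densityE; last exact: lt_trans ax.
have x0 : 0 < x by exact: lt_trans ax.
apply: (@le_trans _ _ (1 / x)).
  rewrite ler_wpM2r ?invr_ge0 ?(ltW x0)// -[leRHS]expR0 ler_expR.
  by rewrite oppr_le0 ltW.
by rewrite div1r lef_pV2 ?posrE// ltW.
Qed.

Lemma E1_slice_ge (a b : R) : 0 < a -> a <= b ->
  (E1 b + ((b - a) * (expR (- b) / b))%:E <= E1 a)%E.
Proof.
move=> a0 ab; rewrite (E1_slice (ltW a0) ab) leeD2l// (mulrC (b - a)).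
rewrite -integral_oc//; apply: ge0_le_integral => //.
- move=> x _; rewrite lee_fin mulr_ge0// divr_ge0 ?expR_ge0//.
  by rewrite (le_trans (ltW a0)).
- apply/measurable_EFinP; apply: measurable_funM => //; apply: measurable_natr.
  exact: measurable_oc.
- by apply: mgd; exact: measurable_oc.
move=> x _; rewrite lee_fin; case: (ltP a x) => ax /=; last by rewrite !mulr0.
case: (leP x b) => xb /=; last by rewrite !mulr0.
have x0 : 0 < x by exact: lt_trans ax.
rewrite ler_wpM2r// gamma_densityE// ler_pM ?expR_ge0 ?invr_ge0//.
- by rewrite (le_trans (ltW x0)).
- by rewrite ler_expR lerN2.
- by rewrite lef_pV2 ?posrE// (lt_le_trans x0).
Qed.

Lemma integral_powR_itv (c v w : R) : c + 1 != 0 -> 0 < v -> v < w ->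
  (\int[leb]_(x in `[v, w]%classic) (x `^ c)%:E =
   ((w `^ (c + 1) - v `^ (c + 1)) / (c + 1))%:E)%E.
Proof.
move=> c1 v0 vw.
pose F (x : R) : R := x `^ (c + 1) / (c + 1).
have dF (x : R) : 0 < x -> is_derive x (1 : R) F (x `^ c).
  move=> x0; have h := is_derive1_powR (c + 1) x0.
  have -> : x `^ c = (c + 1)^-1 *: ((c + 1) * x `^ (c + 1 - 1)).
    by rewrite addrK /GRing.scale/= mulrA mulVf// mul1r.
  rewrite (_ : F = (c + 1)^-1 \*: (fun x => x `^ (c + 1))); last first.
    by apply/funext => y; rewrite /F mulrC.
  exact: is_deriveZ.
have pc r : {in `]0, +oo[%R, continuous ((@powR R) ^~ r)}.
  move=> x; rewrite in_itv/= andbT => x0.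
  apply: differentiable_continuous; apply/derivable1_diffP.
  by have [] := is_derive1_powR r x0.
have Fc (x : R) : 0 < x -> {for x, continuous F}.
  move=> x0; apply: differentiable_continuous; apply/derivable1_diffP.
  by have [] := dF x x0.
rewrite (@continuous_FTC2 _ (fun x => x `^ c) F)//.
- by rewrite /F -EFinB mulrBl.
- apply: continuous_in_subspaceT => x; rewrite inE/= in_itv/= => /andP[vx _].
  by apply: pc; rewrite in_itv/= andbT (lt_le_trans v0).
- split.
  + move=> x; rewrite in_itv/= => /andP[vx _].
    by have [] := dF x (lt_trans v0 vx).
  + by apply: cvg_at_right_filter; exact: Fc.
  + by apply: cvg_at_left_filter; apply: Fc; exact: lt_trans vw.
- move=> x; rewrite in_itv/= => /andP[vx _].
  by rewrite derive1E; have [_ ->] := dF x (lt_trans v0 vx).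
Qed.

End exponential_integral.

Section inverse_exponential_integral.
Context {R : realType}.
Local Notation leb := (@lebesgue_measure R).

(** Equivalent to x^a <= a^a exp x, which is the a-th power of
    x / a <= exp (x / a). *)
Lemma gamma_density_le_powR (a x : R) : 0 < a -> 0 < x ->
  gamma_density x <= a `^ a * x `^ (- a - 1).
Proof.
move=> a0 x0; rewrite /gamma_density x0.
rewrite powRD; last by rewrite (gt_eqF x0) implybT.
rewrite mulrA ler_wpM2r ?powR_ge0// powRN ler_pdivlMr ?powR_gt0//.
rewrite -(ler_pM2l (expR_gt0 x)) mulrA -expRD subrr expR0 mul1r.
have -> : x `^ a = a `^ a * (x / a) `^ a.
  by rewrite -powRM ?ltW ?divr_gt0// mulrC divfK// gt_eqF.
rewrite mulrC ler_wpM2r ?powR_ge0//.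
have -> : expR x = (expR (x / a)) `^ a.
  by rewrite /powR gt_eqF ?expR_gt0// expRK mulrC divfK// gt_eqF.
apply: ge0_ler_powR; rewrite ?nnegrE ?expR_ge0 ?divr_ge0 ?ltW//.
by apply: lt_le_trans (expR_ge1Dx _); rewrite ltrDr.
Qed.

Lemma E1_le_powR (a v : R) : 0 < a -> 0 < v ->
  (E1 v <= (a `^ a / a * v `^ (- a))%:E)%E.
Proof.
move=> a0 v0; rewrite E1E ?(ltW v0)//.
apply: (@monotone_integral_le R _ (measurableTypeR R) leb (fun n x =>
  (gamma_density x * (v < x <= v + n.+1%:R)%R%:R)%:E)
  (fun x => (gamma_density x * (v < x)%R%:R)%:E)
  (a `^ a / a * v `^ (- a))%:E).
- move=> n; apply/measurable_EFinP; apply: measurable_funM.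
    exact: measurable_gamma_density.
  by apply: measurable_natr; exact: measurable_oc.
- by move=> n x; rewrite lee_fin mulr_ge0// gamma_density_ge0.
- move=> x m n mn; rewrite lee_fin ler_wpM2l ?gamma_density_ge0// ler_nat.
  case: (ltP v x) => //= _; case: leP => //= xm.
  by rewrite (le_trans xm)// lerD2l ler_nat ltnS.
- move=> x; apply: cvg_near_cst; near=> n; congr (_ * _%:R)%:E.
  case: (ltP v x) => //= _; suff -> : x <= v + n.+1%:R by [].
  rewrite -lerBlDl; near: n; apply: filterS (nbhs_infty_gtr (x - v)) => n xn.
  by rewrite (le_trans (ltW xn))// ler_nat.
move=> n; pose w := v + n.+1%:R; have vw : v < w by rewrite ltrDl.
have ac : - a - 1 + 1 != 0 by rewrite subrK oppr_eq0 gt_eqF.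
apply: (@le_trans _ _ ((a `^ a)%:E *
    \int[leb]_(x in `[v, w]%classic) (x `^ (- a - 1))%:E)%E).
  have mp : measurable_fun [set: R] (fun x : R => (x `^ (- a - 1))%:E).
    by apply/measurable_EFinP; exact: measurable_powR.
  rewrite -ge0_integralZl//; last 3 first.
  - exact: measurable_funTS.
  - by move=> x _; rewrite lee_fin powR_ge0.
  - by rewrite lee_fin powR_ge0.
  rewrite [leRHS]integral_mkcond; apply: ge0_le_integral => //.
  - by move=> x _; rewrite lee_fin mulr_ge0// gamma_density_ge0.
  - apply/measurable_EFinP; apply: measurable_funM.
      exact: measurable_gamma_density.
    by apply: measurable_natr; exact: measurable_oc.
  - apply/(measurable_restrictT _ _).1 => //; apply: measurable_funTS.
    exact: measurable_funeM.
  move=> x _; rewrite patchE mem_setE in_itv/=.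
  case: (ltP v x) => vx /=; last first.
    rewrite mulr0; case: ifP => // _.
    by rewrite -EFinM lee_fin mulr_ge0 ?powR_ge0.
  rewrite (ltW vx)/= -/w; case: (leP x w) => xw; last by rewrite mulr0.
  rewrite mulr1 -EFinM lee_fin; apply: gamma_density_le_powR => //.
  exact: lt_trans vx.
rewrite integral_powR_itv// -EFinM lee_fin subrK -mulrA ler_wpM2l ?powR_ge0//.
rewrite invrN mulrN -mulNr opprB mulrC ler_wpM2l ?invr_ge0 ?(ltW a0)//.
by rewrite gerBl powR_ge0.
Unshelve. all: by end_near. Qed.

Lemma E1_fin_num (v : R) : 0 < v -> E1 v \is a fin_num.
Proof.
move=> v0; rewrite ge0_fin_numE ?E1_ge0 ?(ltW v0)//.
by apply: le_lt_trans (E1_le_powR ltr01 v0) _; rewrite ltry.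
Qed.

Lemma E1_lt (a b : R) : 0 < a -> a < b -> (E1 b < E1 a)%E.
Proof.
move=> a0 ab; have b0 := lt_trans a0 ab.
apply: lt_le_trans (E1_slice_ge a0 (ltW ab)).
rewrite lteDl ?E1_fin_num// lte_fin mulr_gt0 ?subr_gt0//.
by rewrite divr_gt0 ?expR_gt0.
Qed.

Lemma E1_ltE (a b : R) : 0 < a -> 0 < b -> (E1 b < E1 a)%E = (a < b).
Proof.
move=> a0 b0; apply/idP/idP; last exact: E1_lt.
apply: contraTT; rewrite -!leNgt le_eqVlt => /orP[/eqP->//|/E1_lt h].
exact/ltW/h.
Qed.

(** Over each dyadic slice ]2^-(n+1), 2^-n] the integral of the density is at
    least exp (-1) / 2. *)
Lemma E1_unbounded (s : R) : exists2 a, 0 < a <= 1 & (s%:E <= E1 a)%E.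
Proof.
have step (n : nat) : ((n%:R * (expR (-1) / 2))%:E <= E1 ((2^-1) ^+ n : R))%E.
  elim: n => [|n IHn]; first by rewrite mul0r E1_ge0.
  have h0 : (0 : R) < 2^-1 ^+ n.+1 by rewrite exprn_gt0.
  have h1 : (2^-1 ^+ n.+1 : R) <= 2^-1 ^+ n.
    by rewrite exprS ler_piMl ?exprn_ge0//; lra.
  apply: le_trans (E1_slice_ge h0 h1); rewrite -natr1 mulrDl mul1r EFinD.
  apply: leeD => //; rewrite lee_fin exprS.
  set t := 2^-1 ^+ n; have t0 : 0 < t by rewrite exprn_gt0.
  have -> : (t - 2^-1 * t) * (expR (- t) / t) = expR (- t) / 2.
    by field; rewrite gt_eqF.
  rewrite ler_wpM2r// ler_expR lerN2 /t exprn_ile1//; lra.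
pose n := (Num.truncn (s / (expR (-1) / 2))).+1.
exists (2^-1 ^+ n); first by rewrite exprn_gt0//= exprn_ile1//; lra.
apply: le_trans (step n); rewrite lee_fin -ler_pdivrMr ?divr_gt0 ?expR_gt0//.
exact/ltW/truncnS_gt.
Qed.

(** The intermediate value theorem on [a, b] with E1 b <= s <= E1 a. Freezing
    E1 to the left of a gives a Lipschitz function on the whole line. *)
Lemma E1_surjective (s : R) : 0 < s -> exists v, 0 < v /\ E1 v = s%:E.
Proof.
move=> s0; have [a /andP[a0 a1] sa] := E1_unbounded s.
pose b := Num.max 1 (1 / s).
have b1 : 1 <= b by rewrite le_max lexx.
have b0 : 0 < b by exact: lt_le_trans b1.
have bs : (E1 b <= s%:E)%E.
  apply: le_trans (E1_le_powR ltr01 b0) _.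
  rewrite lee_fin powR1 divr1 mul1r powR_inv1 ?(ltW b0)//.
  rewrite -[leRHS]invrK lef_pV2 ?posrE ?invr_gt0//.
  by rewrite -div1r /b le_max lexx orbT.
have ab : a <= b by exact: le_trans b1.
pose f (x : R) := fine (E1 (Num.max a x)).
have m0 x : 0 < Num.max a x by rewrite lt_max a0.
have fE x : (f x)%:E = E1 (Num.max a x) by rewrite fineK// E1_fin_num.
have lip x y : x <= y -> 0 <= f x - f y <= (y - x) / a.
  move=> xy; have mxy : Num.max a x <= Num.max a y by rewrite ge_max !le_max lexx xy !orbT.
  have := E1_slice_le (m0 x) mxy; rewrite -!fE -EFinD lee_fin => h.
  have : f y <= f x.
    move: mxy; rewrite le_eqVlt => /orP[/eqP h'|/(E1_lt (m0 x))]; first by rewrite /f h'.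
    by rewrite -!fE lte_fin => /ltW.
  rewrite subr_ge0 => -> /=; rewrite lerBlDl; apply: le_trans h _; rewrite lerD2l.
  apply: ler_pM; rewrite ?subr_ge0 ?invr_ge0 ?(ltW (m0 x))//.
    by rewrite /Num.max; case: ifP => h1; case: ifP => h2; lra.
  by rewrite lef_pV2 ?posrE// le_max lexx.
have cf : continuous f.
  move=> x; apply/cvgrPdist_le => eps eps0; near=> y.
  apply: (@le_trans _ _ (`|x - y| / a)).
    have [xy|yx] := leP x y.
      have /andP[h1 h2] := lip x y xy.
      by rewrite ger0_norm// (le_trans h2)// ler_wpM2r ?invr_ge0 ?(ltW a0)// distrC ler_norm.
    have /andP[h1 h2] := lip y x (ltW yx).
    by rewrite distrC ger0_norm// (le_trans h2)// ler_wpM2r ?invr_ge0 ?(ltW a0)// ler_norm.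
  rewrite ler_pdivrMr//; near: y.
  by apply: (@cvgr_dist_le _ _ _ _ _ id x); [exact: cvg_id|exact: mulr_gt0].
have fas : s <= f a by rewrite -lee_fin fE maxxx.
have fbs : f b <= s by rewrite -lee_fin fE (max_idPr ab).
have fab : Num.min (f a) (f b) <= s <= Num.max (f a) (f b).
  by rewrite ge_min fbs orbT le_max fas.
have [c] := IVT ab (continuous_subspaceT cf) fab.
rewrite in_itv/= => /andP[ac cb] fc; exists c; split; first exact: lt_le_trans ac.
by rewrite -fc fE (max_idPr ac).
Unshelve. all: by end_near. Qed.

Lemma E1_invP (s : R) : 0 < s -> 0 < E1_inv s /\ E1 (E1_inv s) = s%:E.
Proof. by move=> /E1_surjective h; have := getPex h. Qed.

(** The inverse H of E1, with the value 0 where E1_inv is junk: marked points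
    with negative time then contribute nothing. *)
Definition jump (s : R) : R := if 0 < s then E1_inv s else 0.

Lemma jump_gt0 s : 0 < s -> 0 < jump s.
Proof. by move=> s0; rewrite /jump s0; have [] := E1_invP s0. Qed.

Lemma jump_ge0 s : 0 <= jump s.
Proof. by rewrite /jump; case: ifP => // /E1_invP[/ltW]. Qed.

Lemma jump_gtE (v s : R) : 0 < v -> 0 < s -> (v < jump s) = (s%:E < E1 v)%E.
Proof.
move=> v0 s0; rewrite /jump s0; have [h0 hE] := E1_invP s0.
by rewrite -hE E1_ltE.
Qed.

Lemma measurable_jump : measurable_fun [set: R] jump.
Proof.
apply: (measurability _ (RGenOInfty.measurableE R)) => //.
move=> _ [_ [c ->] <-]; rewrite setTI.
have [c0|c0] := ltP c 0.
  rewrite (_ : _ @^-1` _ = setT)//; apply/seteqP; split => // x _ /=.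
  by rewrite in_itv/= andbT (lt_le_trans c0)// jump_ge0.
have [->|cn0] := eqVneq c 0.
  rewrite (_ : _ @^-1` _ = `]0, +oo[%classic)//; apply/seteqP; split => x /=;
    rewrite !in_itv/= !andbT; last exact: jump_gt0.
  by rewrite /jump; case: ifP => //; rewrite ltxx.
have {}c0 : 0 < c by rewrite lt_neqAle eq_sym cn0.
rewrite (_ : _ @^-1` _ = `]0, fine (E1 c)[%classic)//.
apply/seteqP; split => x /=; rewrite !in_itv/= andbT.
  move=> h; have x0 : 0 < x.
    by move: h; rewrite /jump; case: ifP => // _ /(lt_trans c0); rewrite ltxx.
  by rewrite x0/= -lte_fin fineK ?E1_fin_num// -jump_gtE.
by move=> /andP[x0]; rewrite -lte_fin fineK ?E1_fin_num// -jump_gtE.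
Qed.

(** [E1_le_powR] at the point v = jump s, solved for v. *)
Lemma jump_le_powR (a p : R) : 0 < a -> 0 < p -> exists2 C, 0 < C &
  forall s, 0 < s -> jump s `^ p <= C * s `^ (- (p / a)).
Proof.
move=> a0 p0; have A0 : 0 < a `^ a / a by rewrite divr_gt0 ?powR_gt0.
exists ((a `^ a / a) `^ (p / a)); first by rewrite powR_gt0.
move=> s s0; have j0 := jump_gt0 s0.
have := E1_le_powR a0 j0; have [_] := E1_invP s0; rewrite -/(jump s).
have -> : E1_inv s = jump s by rewrite /jump s0.
move=> ->; rewrite lee_fin powRN => h.
have {h} : jump s `^ a <= a `^ a / a / s.
  by rewrite ler_pdivlMr// mulrC -ler_pdivlMr ?powR_gt0.
move=> h; have -> : jump s `^ p = (jump s `^ a) `^ (p / a).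
  by rewrite -powRrM mulrC divfK// gt_eqF.
have pa : 0 <= p / a by rewrite divr_ge0 ?ltW.
apply: (@le_trans _ _ ((a `^ a / a / s) `^ (p / a))).
  by apply: ge0_ler_powR; rewrite // nnegrE ?powR_ge0// ltW// divr_gt0.
rewrite powRM ?invr_ge0 ?(ltW A0) ?(ltW s0)//.
rewrite ler_wpM2l ?powR_ge0//.
by rewrite -[in leLHS](powR_inv1 (ltW s0)) -powRrM mulN1r.
Qed.

(** H(s)^p = O(s^-(p/a)) for every a > 0: a = 2 p gives the integrable singularity
    s^(-1/2) at 0, and a = p / 2 the integrable tail s^-2. *)
Lemma jump_powR_integral (p : R) : 0 < p ->
  (\int[leb]_s (jump s `^ p)%:E < +oo)%E.
Proof.
move=> p0.
have p1 : 0 < 2 * p by rewrite mulr_gt0.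
have p2 : 0 < p / 2 by rewrite divr_gt0.
have [C1 C10 hC1] := jump_le_powR p1 p0.
have [C2 C20 hC2] := jump_le_powR p2 p0.
have e1 : - (p / (2 * p)) = - 2^-1 by field; rewrite gt_eqF.
have e2 : - (p / (p / 2)) = - 2 by field; rewrite gt_eqF.
rewrite e1 in hC1; rewrite e2 in hC2.
apply: (@le_lt_trans _ _ (C1 * 2 + C2)%:E); last exact: ltry.
have mj : measurable_fun [set: R] (fun s => jump s `^ p).
  by apply: (measurableT_comp (measurable_powR p)); exact: measurable_jump.
have mcut n : measurable_fun [set: R]
    (fun s : R => (n.+2%:R^-1 <= s <= n.+2%:R)%R%:R : R).
  by apply: measurable_natr; apply: measurable_and; exact: measurable_fun_ler.
apply: (@monotone_integral_le R _ (measurableTypeR R) leb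
  (fun n s => (jump s `^ p * (n.+2%:R^-1 <= s <= n.+2%:R)%R%:R)%:E)
  (fun s => (jump s `^ p)%:E) (C1 * 2 + C2)%:E).
- by move=> n; apply/measurable_EFinP; exact: (measurable_funM mj (mcut n)).
- by move=> n s; rewrite lee_fin mulr_ge0 ?powR_ge0.
- move=> s m n mn; rewrite lee_fin ler_wpM2l ?powR_ge0// ler_nat.
  case: (leP _ s) => //= ms; case: leP => //= sm.
  rewrite (le_trans sm) ?ler_nat ?ltnS// andbT.
  by rewrite (le_trans _ ms)// lef_pV2 ?posrE ?ltr0n// ler_nat.
- move=> s; have [s0|s0] := leP s 0.
    apply: cvg_near_cst; apply: nearW => n.
    by rewrite /jump ltNge s0 powR0 ?gt_eqF// mul0r.
  apply: cvg_near_cst; near=> n; rewrite (_ : _ <= _ <= _); first by rewrite mulr1.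
  apply/andP; split.
    rewrite -[leRHS]invrK lef_pV2 ?posrE ?ltr0n ?invr_gt0//.
    near: n; apply: filterS (nbhs_infty_gtr s^-1) => n sn.
    by rewrite (le_trans (ltW sn))// ler_nat -addn2 leq_addr.
  near: n; apply: filterS (nbhs_infty_gtr s) => n sn.
  by rewrite (le_trans (ltW sn))// ler_nat -addn2 leq_addr.
move=> n; set N : R := n.+2%:R.
have N1 : 1 < N by rewrite ltr1n.
have N0 : 0 < N by exact: lt_trans N1.
have mp r : measurable_fun [set: R] (fun s : R => (s `^ r)%:E).
  by apply/measurable_EFinP; exact: measurable_powR.
have pos r (A : set R) : measurable A ->
    (0 <= \int[leb]_(s in A) (s `^ r)%:E)%E.
  by move=> _; apply: integral_ge0 => s _; rewrite lee_fin powR_ge0.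
pose X1 := (\int[leb]_(s in `[(N^-1)%R, 1%R]%classic) (s `^ (- 2^-1))%:E)%E.
pose X2 := (\int[leb]_(s in `[1%R, N]%classic) (s `^ (- 2))%:E)%E.
have h1 : - 2^-1 + 1 != 0 :> R by apply/eqP; lra.
have h2 : - 2 + 1 != 0 :> R by apply/eqP; lra.
have EX1 : X1 = ((1 `^ (- 2^-1 + 1) - N^-1 `^ (- 2^-1 + 1)) / (- 2^-1 + 1))%:E.
  by apply: integral_powR_itv; rewrite // ?invr_gt0// invf_lt1.
have EX2 : X2 = ((N `^ (- 2 + 1) - 1 `^ (- 2 + 1)) / (- 2 + 1))%:E.
  exact: integral_powR_itv.
apply: (@le_trans _ _ (C1%:E * X1 + C2%:E * X2)%E).
  rewrite /X1 /X2.
  rewrite [X in (C1%:E * X)%E]integral_mkcond [X in (C2%:E * X)%E]integral_mkcond.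
  have mr r (a b : R) : measurable_fun [set: R]
      ((fun s : R => (s `^ r)%:E) \_ `[a, b]%classic).
    by apply/(measurable_restrictT _ _).1 => //; exact: measurable_funTS.
  have r0 r (a b s : R) : (0 <= ((fun s : R => (s `^ r)%:E) \_ `[a, b]%classic) s)%E.
    by rewrite patchE; case: ifP => // _; rewrite lee_fin powR_ge0.
  rewrite -!ge0_integralZl ?lee_fin ?(ltW C10) ?(ltW C20)//; last 2 first.
  - exact: mr.
  - exact: mr.
  rewrite -ge0_integralD//; last 4 first.
  - by move=> s _; apply: mule_ge0; [rewrite lee_fin ltW|exact: r0].
  - by apply: measurable_funeM; exact: mr.
  - by move=> s _; apply: mule_ge0; [rewrite lee_fin ltW|exact: r0].
  - by apply: measurable_funeM; exact: mr.
  apply: ge0_le_integral => //.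
  - by move=> s _; rewrite lee_fin mulr_ge0 ?powR_ge0.
  - by apply/measurable_EFinP; exact: (measurable_funM mj (mcut n)).
  - by apply: emeasurable_funD; apply: measurable_funeM; exact: mr.
  move=> s _; case: (boolP (N^-1 <= s <= N)) => [/andP[Ns sN]|_]; last first.
    by rewrite mulr0; apply: adde_ge0; apply: mule_ge0; rewrite ?lee_fin ?(ltW C10) ?(ltW C20)//; exact: r0.
  have s0 : 0 < s by rewrite (lt_le_trans _ Ns)// invr_gt0.
  rewrite mulr1; have [s1|s1] := leP s 1.
    apply: (@le_trans _ _ (C1 * s `^ (- 2^-1))%:E); first by rewrite lee_fin hC1.
    rewrite {1}patchE mem_setE in_itv/= Ns s1/= -EFinM leeDl//.
    by apply: mule_ge0; [rewrite lee_fin ltW|exact: r0].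
  apply: (@le_trans _ _ (C2 * s `^ (- 2))%:E); first by rewrite lee_fin hC2.
  rewrite [X in (_ + C2%:E * X)%E]patchE mem_setE in_itv/= sN (ltW s1)/= -EFinM leeDr//.
  by apply: mule_ge0; [rewrite lee_fin ltW|exact: r0].
rewrite EX1 EX2 !powR1 -!EFinM -EFinD lee_fin.
apply: lerD.
  rewrite ler_pM2l// (_ : - 2^-1 + 1 = 2^-1 :> R); last by lra.
  by rewrite invrK ler_piMl// gerBl powR_ge0.
rewrite (_ : - 2 + 1 = -1 :> R); last by lra.
rewrite invrN1 mulrN1 opprB ler_piMr ?(ltW C20)// gerBl powR_ge0//.
Unshelve. all: by end_near. Qed.

End inverse_exponential_integral.

(** * Measurable limits and the intensity of the jumps *)

Lemma cvg_limn_esup_einf (R : realType) (u : nat -> R) (l : R) :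
  (u @ \oo --> l) <->
  limn_esup (EFin \o u) = l%:E /\ limn_einf (EFin \o u) = l%:E.
Proof.
split=> [ul|[us ui]].
  have : (EFin \o u) x @[x --> \oo] --> l%:E.
    by apply: cvg_EFin => //; exact: nearW.
  by move=> /cvg_limn_einf_sup[-> ->].
suff : (EFin \o u) x @[x --> \oo] --> l%:E by move=> /fine_cvgP[].
apply: (@squeeze_cvge _ _ _ _ (einfs (EFin \o u)) _ (esups (EFin \o u))).
- apply: nearW => n; rewrite /einfs /esups.
  by apply/andP; split; [apply: ereal_inf_lbound|apply: ereal_sup_ubound];
    exists n => //=.
- by rewrite -ui limn_einf_lim; exact: is_cvg_einfs.
- by rewrite -us limn_esup_lim; exact: is_cvg_esups.
Qed.

(** The upper and lower limits are measurable; the limit is their common value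
    where they agree and are finite, and the default value of limn elsewhere. *)
Lemma measurable_limn (R : realType) d (T : measurableType d)
    (u : nat -> T -> R) : (forall n, measurable_fun [set: T] (u n)) ->
  measurable_fun [set: T] (fun x => limn (u ^~ x)).
Proof.
move=> mu.
pose U x := limn_esup (EFin \o u ^~ x); pose V x := limn_einf (EFin \o u ^~ x).
have mU : measurable_fun [set: T] U.
  by apply: measurable_fun_limn_esup => n; exact/measurable_EFinP.
have mV : measurable_fun [set: T] V.
  rewrite (_ : V = fun x => - limn_esup (fun n => (- u n x)%:E))%E.
    apply: measurableT_comp => //; apply: measurable_fun_limn_esup => n.
    by apply/measurable_EFinP; exact: measurableT_comp.
  by apply/funext => x; rewrite /V -[LHS]oppeK -limn_esupN.
pose b x := (U x == V x) && (U x == (fine (U x))%:E).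
have mb : measurable_fun [set: T] b.
  apply: measurable_and; first exact: measurable_fun_eqe.
  apply: measurable_fun_eqe => //; apply/measurable_EFinP.
  exact: measurableT_comp.
rewrite (_ : (fun x => _) = (fun x => if b x then fine (U x) else point)).
  by apply: measurable_fun_ifT => //; exact: measurableT_comp.
apply/funext => x; case: ifPn => [/andP[/eqP UV /eqP Uf]|bx].
  apply/cvg_lim => //; apply/cvg_limn_esup_einf.
  by split; [exact: Uf|rewrite -[LHS]/(V x) -UV; exact: Uf].
apply: getPN => l ul; move/negP: bx; apply.
have [Ul Vl] := (cvg_limn_esup_einf (u ^~ x) l).1 ul.
by rewrite /b /U /V Ul Vl !eqxx.
Qed.

(** The power is differentiable away from 0; at 0 it is small because
    x <= eps^(1/p) implies x^p <= eps. *)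
Lemma cvg_powR_norm (R : realType) (p : R) (u : nat -> R) (l : R) : 0 < p ->
  u @ \oo --> l -> (fun n => `|u n| `^ p) @ \oo --> `|l| `^ p.
Proof.
move=> p0 ul; have {ul} nul : (fun n => `|u n|) @ \oo --> `|l| by exact: cvg_norm.
have [l0|l0] := eqVneq `|l| 0; last first.
  have l1 : 0 < `|l| by rewrite lt_neqAle eq_sym l0 normr_ge0.
  have cp : {for `|l|, continuous ((@powR R) ^~ p)}.
    apply: differentiable_continuous; apply/derivable1_diffP.
    by have [] := is_derive1_powR p l1.
  exact: (cvg_comp _ _ nul cp).
rewrite l0 powR0 ?gt_eqF//; rewrite l0 in nul.
apply/cvgrPdist_le => eps eps0; near=> n.
rewrite sub0r normrN ger0_norm ?powR_ge0//.
have -> : eps = (eps `^ p^-1) `^ p.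
  by rewrite -powRrM mulVf ?gt_eqF// powRr1// ltW.
apply: ge0_ler_powR; rewrite ?nnegrE ?powR_ge0//; first exact: ltW.
near: n; have /cvgrPdist_le /(_ _ (powR_gt0 p^-1 eps0)) := nul.
by apply: filterS => n; rewrite sub0r normrN normr_id.
Unshelve. all: by end_near. Qed.

Section intensity.
Context {R : realType} {dL : measure_display} {L : measurableType dL}.
Variables (lam : {sigma_finite_measure set L -> \bar R}) (Q : probability L R).
Variable q : L -> R.
Hypothesis mq : measurable_fun [set: L] q.
Hypothesis q_gt0 : forall x, 0 < q x.
Hypothesis QE : forall A, measurable A -> (Q A = \int[lam]_(x in A) (q x)%:E)%E.
Local Open Scope ereal_scope.
Local Notation leb := (@lebesgue_measure R).

(** For a fixed mark u the substitution s = t q(u) produces the factor 1 / q(u),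
    which cancels the density of the marks. *)
Lemma time_mark_integralE (F : R * L -> \bar R) :
  measurable_fun [set: R * L] F -> (forall z, 0 <= F z) ->
  \int[time_mark_measure Q]_z F ((z.1 * q z.2)%R, z.2) =
  \int[lam]_u \int[leb]_s F (s, u).
Proof.
move=> mF F0.
have mFq : measurable_fun [set: R * L] (fun z => F ((z.1 * q z.2)%R, z.2)).
  apply: measurableT_comp => //; apply: measurable_fun_pair => //.
  by apply: measurable_funM => //; exact: measurableT_comp.
rewrite ge0_integral_time_mark//.
rewrite (@fubini_tonelli _ _ _ _ _ leb Q (fun z => F ((z.1 * q z.2)%R, z.2)))//.
rewrite (@ge0_integral_density _ _ _ lam _ q)//.
- apply: eq_integral => u _ /=.
  rewrite [RHS](@ge0_integral_affine _ (q u) 0)//.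
  + by rewrite muleC; congr (_ * _); apply: eq_integral => s _;
      rewrite addr0 mulrC.
  + by apply: measurableT_comp => //; exact: measurable_fun_pair.
- by move=> u; exact: ltW.
- exact: (@measurable_fun_fubini_tonelli_G _ _ _ _ _ leb _ mFq).
- by move=> u; apply: integral_ge0.
Qed.

End intensity.

(** * Jumps of the Gamma integral *)

Section jump_functional.
Context {R : realType} {dL : measure_display} {L : measurableType dL}.
Variables (lam : {sigma_finite_measure set L -> \bar R}) (Q : probability L R).
Variable q : L -> R.
Hypothesis mq : measurable_fun [set: L] q.
Hypothesis q_gt0 : forall x, 0 < q x.
Hypothesis QE : forall A, measurable A -> (Q A = \int[lam]_(x in A) (q x)%:E)%E.
Local Open Scope ereal_scope.
Local Notation leb := (@lebesgue_measure R).
Local Notation mu := (time_mark_measure Q).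

Definition jump_of (f : L -> R) (z : R * L) : R := (jump (z.1 * q z.2) * f z.2)%R.

Lemma measurable_jump_of f : measurable_fun [set: L] f ->
  measurable_fun [set: R * L] (jump_of f).
Proof.
move=> mf; apply: measurable_funM; last exact: measurableT_comp.
apply: (measurableT_comp measurable_jump); apply: measurable_funM => //.
exact: measurableT_comp.
Qed.

Lemma normr_jump_of (f : L -> R) z : `|jump_of f z|%R = jump_of (fun x => `|f x|%R) z.
Proof. by rewrite /jump_of normrM ger0_norm ?jump_ge0. Qed.

Lemma jump_of_ge0 (f : L -> R) z : (0 <= jump_of (fun x => `|f x|%R) z)%R.
Proof. by rewrite mulr_ge0 ?jump_ge0. Qed.

Lemma jump_of_neg f z : (z.1 <= 0)%R -> jump_of f z = 0%R.
Proof.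
move=> z0; rewrite /jump_of /jump ltNge mulr_le0_ge0 ?mul0r//.
exact/ltW/q_gt0.
Qed.

Definition jump_moment (p : R) : R := fine (\int[leb]_s (jump s `^ p)%:E).

Lemma jump_momentE (p : R) : (0 < p)%R ->
  \int[leb]_s (jump s `^ p)%:E = (jump_moment p)%:E.
Proof.
move=> p0; rewrite fineK// ge0_fin_numE ?jump_powR_integral//.
by apply: integral_ge0 => s _; rewrite lee_fin powR_ge0.
Qed.

Lemma jump_moment_ge0 p : (0 <= jump_moment p)%R.
Proof.
by apply/fine_ge0/integral_ge0 => s _; rewrite lee_fin powR_ge0.
Qed.

Lemma jump_of_powR_integral (p : R) (f : L -> R) : (0 < p)%R -> measurable_fun [set: L] f ->
  \int[mu]_z (jump_of (fun x => `|f x|%R) z `^ p)%:E =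
  (jump_moment p)%:E * \int[lam]_u (`|f u| `^ p)%:E.
Proof.
move=> p0 mf.
have mfp : measurable_fun [set: L] (fun u => (`|f u| `^ p)%:E).
  apply/measurable_EFinP; apply: (measurableT_comp (measurable_powR p)).
  exact: measurableT_comp.
have mjp : measurable_fun [set: R] (fun s => (jump s `^ p)%:E).
  apply/measurable_EFinP; apply: (measurableT_comp (measurable_powR p)).
  exact: measurable_jump.
pose F (z : R * L) : \bar R := ((jump z.1 * `|f z.2|) `^ p)%R%:E.
have mF : measurable_fun [set: R * L] F.
  apply/measurable_EFinP; apply: (measurableT_comp (measurable_powR p)).
  apply: measurable_funM; first exact: (measurableT_comp measurable_jump).
  by apply: measurableT_comp => //; exact: measurableT_comp.
have F0 z : 0 <= F z by rewrite lee_fin powR_ge0.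
rewrite -[LHS]/(\int[mu]_z F ((z.1 * q z.2)%R, z.2)).
rewrite (time_mark_integralE mq q_gt0 QE)//.
transitivity (\int[lam]_u ((jump_moment p)%:E * (`|f u| `^ p)%:E)).
  apply: eq_integral => u _; rewrite /F/=.
  under eq_integral do rewrite powRM ?jump_ge0// EFinM.
  rewrite ge0_integralZr//; first by rewrite jump_momentE.
  by move=> s _; rewrite lee_fin powR_ge0.
by rewrite ge0_integralZl// lee_fin jump_moment_ge0.
Qed.

Lemma jump_of_integral (f : L -> R) : measurable_fun [set: L] f ->
  \int[mu]_z (jump_of (fun x => `|f x|%R) z)%:E =
  (jump_moment 1)%R%:E * \int[lam]_u (`|f u|)%:E.
Proof.
move=> mf; have := jump_of_powR_integral ltr01 mf.
under eq_integral do rewrite powRr1 ?jump_of_ge0//.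
by under [X in _ = _ * X -> _]eq_integral do rewrite powRr1//.
Qed.

Lemma jump_anti (s t : R) : (0 < s)%R -> (s <= t)%R -> (jump t <= jump s)%R.
Proof.
move=> s0; rewrite le_eqVlt => /orP[/eqP->//|st].
have t0 := lt_trans s0 st; rewrite leNgt; apply/negP => js.
have := js; rewrite jump_gtE ?jump_gt0//.
rewrite /jump s0; have [_ ->] := E1_invP s0.
by rewrite lte_fin ltNge (ltW st).
Qed.

Lemma truncated_jump_integral_ge (f : L -> R) : measurable_fun [set: L] f ->
  \int[lam]_u (Num.min (jump 1 * `|f u|) 1)%R%:E <=
  \int[mu]_z (Num.min (jump_of (fun x => `|f x|%R) z) 1)%R%:E.
Proof.
move=> mf.
pose F (z : R * L) : \bar R := (Num.min (jump z.1 * `|f z.2|) 1)%R%:E.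
have mF : measurable_fun [set: R * L] F.
  apply/measurable_EFinP; apply: measurable_minr => //.
  apply: measurable_funM; first exact: (measurableT_comp measurable_jump).
  by apply: measurableT_comp => //; exact: measurableT_comp.
have F0 z : 0 <= F z by rewrite lee_fin le_min ler01 mulr_ge0 ?jump_ge0.
rewrite -[leRHS]/(\int[mu]_z F ((z.1 * q z.2)%R, z.2)).
rewrite (time_mark_integralE mq q_gt0 QE)//.
apply: ge0_le_integral => //.
- by move=> u _; rewrite lee_fin le_min ler01 mulr_ge0 ?jump_ge0.
- apply/measurable_EFinP; apply: measurable_minr => //.
  by apply: measurable_funM => //; exact: measurableT_comp.
- exact: (@measurable_fun_fubini_tonelli_G _ _ _ _ _ leb _ mF).
move=> u _; set m := Num.min _ _; have m0 : (0 <= m)%R.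
  by rewrite le_min ler01 mulr_ge0 ?jump_ge0.
have -> : m = (m * (1 - 0))%R by rewrite subr0 mulr1.
rewrite -integral_oc//; apply: ge0_le_integral => //.
- by move=> s _; rewrite lee_fin mulr_ge0.
- apply/measurable_EFinP; apply: measurable_funM => //; apply: measurable_natr.
  exact: measurable_oc.
- by apply: measurableT_comp => //; exact: measurable_fun_pair.
move=> s _; rewrite /F/=; case: (boolP (0 < s <= 1)%R) => [/andP[s0 s1]|_].
  by rewrite mulr1 lee_fin le_min !ge_min lexx orbT andbT ler_wpM2r ?jump_anti.
by rewrite mulr0 lee_fin le_min ler01 mulr_ge0 ?jump_ge0.
Qed.

End jump_functional.

(** * Upper moment bounds *)

Section power_integrals.
Context {R : realType} {d : measure_display} {L : measurableType d}.
Variable lam : {measure set L -> \bar R}.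
Variable f : L -> R.
Hypothesis mf : measurable_fun [set: L] f.
Local Open Scope ereal_scope.

Lemma measurable_supp : measurable (supp f).
Proof.
have -> : supp f = f @^-1` [set~ 0%R].
  by apply/seteqP; split => x /=; rewrite /supp/= => /eqP.
by rewrite -[X in measurable X]setTI; apply: mf => //; apply: measurableC.
Qed.

Lemma measurable_normr_powR (p : R) :
  measurable_fun [set: L] (fun u => (`|f u| `^ p)%:E).
Proof.
apply/measurable_EFinP; apply: (measurableT_comp (measurable_powR p)).
exact: measurableT_comp.
Qed.

Lemma powR_mulr_le (p a b : R) : (0 < a)%R -> (0 < b)%R -> (1 < p)%R ->
  (b * a `^ (p - 1) <= a `^ p + b `^ p)%R.
Proof.
move=> a0 b0 p1; have pE (x : R) : (0 < x)%R -> (x `^ p = x * x `^ (p - 1))%R.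
  move=> x0; rewrite -{2}(powRr1 (ltW x0)) -powRD; first by rewrite addrC subrK.
  by apply/implyP => _; rewrite gt_eqF.
have [ba|ab] := leP b a.
  by rewrite (pE a)//; apply: ler_wpDr; rewrite ?powR_ge0// ler_wpM2r// powR_ge0.
rewrite (pE b)//; apply: ler_wpDl; rewrite ?powR_ge0// ler_wpM2l ?(ltW b0)//.
by apply: ge0_ler_powR; rewrite ?nnegrE ?subr_ge0 ?(ltW p1) ?(ltW a0) ?(ltW b0)// ltW.
Qed.

(** Integrate b a^(p-1) <= a^p + b^p over pairs of points of the support. *)
Lemma integral_powR_mul_le (p s : R) : (1 < p)%R -> lam (supp f) = s%:E ->
  (\int[lam]_u (`|f u| `^ (p - 1))%:E) * (\int[lam]_u (`|f u|)%:E) <=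
  (2 * s)%:E * \int[lam]_u (`|f u| `^ p)%:E.
Proof.
move=> p1 sE; set I := \int[lam]_u (`|f u| `^ p)%:E.
set J := \int[lam]_u _.
have mfa : measurable_fun [set: L] (fun u => (`|f u|)%:E).
  by apply/measurable_EFinP; exact: measurableT_comp.
have I0 : 0 <= I by apply: integral_ge0 => u _; rewrite lee_fin powR_ge0.
have J0 : 0 <= J by apply: integral_ge0 => u _; rewrite lee_fin powR_ge0.
have s0 : (0 <= s)%R by rewrite -lee_fin -sE measure_ge0.
have iA : \int[lam]_u (\1_(supp f) u)%:E = s%:E.
  by rewrite integral_indic ?setIT//; exact: measurable_supp.
have mA : measurable_fun [set: L] (fun u => (\1_(supp f) u : R)%:E).
  by apply/measurable_EFinP; apply: measurable_indic; exact: measurable_supp.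
have A0 u : 0 <= (\1_(supp f) u : R)%:E by rewrite lee_fin.
have key v : (`|f v|)%:E * J <= s%:E * (`|f v| `^ p)%:E + I * (\1_(supp f) v)%:E.
  have -> : (`|f v|)%:E * J = \int[lam]_u ((`|f v|)%:E * (`|f u| `^ (p - 1))%:E).
    by rewrite ge0_integralZl ?lee_fin//; exact: measurable_normr_powR.
  have -> : s%:E * (`|f v| `^ p)%:E + I * (\1_(supp f) v)%:E =
      \int[lam]_u ((\1_(supp f) u)%:E * (`|f v| `^ p)%:E +
                   (`|f u| `^ p)%:E * (\1_(supp f) v)%:E).
    rewrite ge0_integralD//=.
    - rewrite !ge0_integralZr ?lee_fin ?powR_ge0// ?iA//.
      exact: measurable_normr_powR.
    - by apply: emeasurable_funM => //; exact: measurable_cst.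
    - by apply: emeasurable_funM => //; exact: measurable_normr_powR.
  apply: ge0_le_integral => //.
  - by apply: emeasurable_funM => //; exact: measurable_normr_powR.
  - apply: emeasurable_funD; first exact: emeasurable_funM.
    by apply: emeasurable_funM => //; exact: measurable_normr_powR.
  move=> u _; rewrite -!EFinM -EFinD lee_fin !indicE.
  have nulp : (p - 1 != 0)%R by rewrite subr_eq0 gt_eqF.
  have [fu|fu] := eqVneq (f u) 0%R.
    by rewrite fu normr0 powR0// mulr0 addr_ge0// mulr_ge0// ?powR_ge0.
  have [fv|fv] := eqVneq (f v) 0%R.
    by rewrite fv normr0 mul0r addr_ge0// mulr_ge0// ?powR_ge0.
  rewrite !mem_set// mul1r mulr1 [leRHS]addrC.
  by apply: powR_mulr_le; rewrite ?normr_gt0.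
have -> : J * (\int[lam]_u (`|f u|)%:E) = \int[lam]_v ((`|f v|)%:E * J).
  by rewrite ge0_integralZr// muleC.
have -> : (2 * s)%:E * I =
    \int[lam]_v (s%:E * (`|f v| `^ p)%:E + I * (\1_(supp f) v)%:E).
  rewrite ge0_integralD//=.
  - rewrite !ge0_integralZl ?lee_fin//; last exact: measurable_normr_powR.
    rewrite iA -/I [I * _]muleC -ge0_muleDl ?lee_fin// -EFinD.
    by rewrite mulr_natl mulr2n.
  - by move=> u _; rewrite mule_ge0// lee_fin powR_ge0.
  - by apply: measurable_funeM; exact: measurable_normr_powR.
  - by move=> u _; rewrite mule_ge0.
  - exact: measurable_funeM.
apply: ge0_le_integral => //.
- by move=> v _; rewrite mule_ge0// lee_fin.
- by under eq_fun do rewrite muleC; exact: measurable_funeM.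
- apply: emeasurable_funD; last exact: measurable_funeM.
  by apply: measurable_funeM; exact: measurable_normr_powR.
Qed.

End power_integrals.

Section moment_bounds.
Context {R : realType} {dO dL : measure_display} {Omega : measurableType dO}.
Context {L : measurableType dL} (P : probability Omega R) (Q : probability L R).
Variables (e : nat -> Omega -> R) (U : nat -> Omega -> L).
Hypothesis me : forall n, measurable_fun [set: Omega] (e n).
Hypothesis mU : forall n, measurable_fun [set: Omega] (U n).
Hypothesis e_gt0 : forall n w, 0 < e n w.
Hypothesis step : renewal_property e U P Q.
Variables (lam : {sigma_finite_measure set L -> \bar R}) (q : L -> R).
Hypothesis mq : measurable_fun [set: L] q.
Hypothesis q_gt0 : forall x, 0 < q x.
Hypothesis QE : forall A, measurable A -> (Q A = \int[lam]_(x in A) (q x)%:E)%E.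
Local Open Scope ereal_scope.
Local Notation Sum := (mark_sum e U).
Local Notation jumps f := (jump_of q (fun x => `|f x|%R)).
Local Notation jm := (@jump_moment R).

Lemma measurable_jumps (f : L -> R) : measurable_fun [set: L] f ->
  measurable_fun [set: R * L] (jumps f).
Proof. by move=> mf; apply: measurable_jump_of => //; exact: measurableT_comp. Qed.

Lemma mark_sum_ge0 (f : L -> R) N w : (0 <= Sum (jumps f) N w)%R.
Proof. by apply: sumr_ge0 => i _; exact: jump_of_ge0. Qed.

Lemma moment_le1 (p : R) (f : L -> R) N : (0 < p <= 1)%R ->
  measurable_fun [set: L] f ->
  \int[P]_w (Sum (jumps f) N w `^ p)%:E <=
  (jm p)%:E * \int[lam]_u (`|f u| `^ p)%:E.
Proof.
move=> p01 mf; case/andP: (p01) => p0 _.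
rewrite -(jump_of_powR_integral mq q_gt0 QE p0 mf).
apply: (mark_sumX_le1 me mU e_gt0 step) => //.
  exact: measurable_jumps.
by move=> z; exact: jump_of_ge0.
Qed.

Lemma moment_ge1 (p : R) (f : L -> R) N : (1 <= p)%R ->
  measurable_fun [set: L] f ->
  \int[P]_w (Sum (jumps f) N w `^ p)%:E <=
  (2 `^ p)%:E * (\int[P]_w (Sum (jumps f) N w `^ (p - 1))%:E *
                   ((jm 1)%:E * \int[lam]_u (`|f u|)%:E) +
                 (jm p)%:E * \int[lam]_u (`|f u| `^ p)%:E).
Proof.
move=> p1 mf; have p0 : (0 < p)%R := lt_le_trans ltr01 p1.
rewrite -(jump_of_powR_integral mq q_gt0 QE p0 mf).
rewrite -(jump_of_integral mq q_gt0 QE mf).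
apply: (mark_sumX_ge1 me mU e_gt0 step) => //.
  exact: measurable_jumps.
by move=> z; exact: jump_of_ge0.
Qed.

(** The constant produced by k steps of the induction from p - 1 to p. *)
Fixpoint moment_const (s : R) (k : nat) (p : R) : R :=
  if k is k'.+1 then
    if (p <= 1)%R then jm p
    else (2 `^ p * (moment_const s k' (p - 1) * jm 1 * (2 * s) + jm p))%R
  else jm p.

Lemma moment_const_ge0 s k p : (0 <= s)%R -> (0 <= moment_const s k p)%R.
Proof.
move=> s0; elim: k p => [|k IHk] p /=; first exact: jump_moment_ge0.
have [_|_] := leP p 1%R; first exact: jump_moment_ge0.
by rewrite mulr_ge0 ?powR_ge0// addr_ge0 ?jump_moment_ge0// !mulr_ge0// jump_moment_ge0.
Qed.

(** One step of [moment_ge1] leaves a product of the integrals of |f|^(p-1) and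
    |f|, which [integral_powR_mul_le] absorbs. *)
Lemma moment_le_const (s p : R) k (f : L -> R) N : (0 < p <= k.+1%:R)%R ->
  measurable_fun [set: L] f -> lam (supp f) = s%:E ->
  \int[P]_w (Sum (jumps f) N w `^ p)%:E <=
  (moment_const s k p)%:E * \int[lam]_u (`|f u| `^ p)%:E.
Proof.
move=> + mf sE; have s0 : (0 <= s)%R by rewrite -lee_fin -sE measure_ge0.
elim: k p => [|k IHk] p /andP[p0 pk]; first by apply: moment_le1; rewrite ?p0.
rewrite [moment_const _ _ _]/=; have [p1|p1] := leP p 1%R.
  by apply: moment_le1; rewrite ?p0.
apply: le_trans (moment_ge1 _ (ltW p1) mf) _.
have /IHk : (0 < p - 1 <= k.+1%:R)%R.
  by rewrite subr_gt0 p1 lerBlDr -natr1 in pk *.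
have := integral_powR_mul_le mf p1 sE.
have : (0 <= moment_const s k (p - 1))%R by exact: moment_const_ge0.
have [] : (0 <= jm 1)%R /\ (0 <= jm p)%R by split; exact: jump_moment_ge0.
have : 0 <= \int[lam]_u (`|f u|)%:E by apply: integral_ge0 => u _; rewrite lee_fin.
have : 0 <= \int[lam]_u (`|f u| `^ p)%:E.
  by apply: integral_ge0 => u _; rewrite lee_fin powR_ge0.
move: (moment_const _ _ _) (jm 1) (jm p) (2 `^ p)%R (powR_ge0 2 p).
move: (\int[lam]_u (`|f u| `^ (p - 1))%:E) (\int[lam]_u _) (\int[lam]_u _).
move: (\int[P]_w _) => J K F I M j1 jp a a0 I0 F0 j10 jp0 M0 KF JM.
rewrite !EFinM -muleA; apply: lee_wpmul2l; first by rewrite lee_fin.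
rewrite EFinD ge0_muleDl ?lee_fin ?mulr_ge0//; apply: leeD2r.
apply: (@le_trans _ _ ((M%:E * K) * (j1%:E * F))).
  by apply: lee_wpmul2r JM; rewrite mule_ge0// lee_fin.
rewrite muleACA -EFinM [in leRHS]EFinM -muleA; apply: lee_wpmul2l => //.
by rewrite lee_fin mulr_ge0.
Qed.

(** Powers below 1 satisfy x^p <= 1 + x. *)
Lemma moment_le_first (p : R) (f : L -> R) N : (0 < p <= 1)%R ->
  measurable_fun [set: L] f ->
  \int[P]_w (Sum (jumps f) N w `^ p)%:E <=
  1 + (jm 1)%:E * \int[lam]_u (`|f u|)%:E.
Proof.
move=> /andP[p0 p1] mf.
have mS : measurable_fun [set: Omega] (Sum (jumps f) N).
  by apply: measurable_mark_sum => //; exact: measurable_jumps.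
apply: (@le_trans _ _ (\int[P]_w (1 + (Sum (jumps f) N w `^ 1)%:E))).
  apply: ge0_le_integral => //.
  - by move=> w _; rewrite lee_fin powR_ge0.
  - by apply/measurable_EFinP; apply: (measurableT_comp (measurable_powR _)).
  - apply: emeasurable_funD => //.
    by apply/measurable_EFinP; apply: (measurableT_comp (measurable_powR _)).
  move=> w _; rewrite -EFinD lee_fin.
  have [S1|S1] := leP (Sum (jumps f) N w) 1%R.
    apply: ler_wpDr; rewrite ?powR_ge0//.
    rewrite (_ : 1%R = 1 `^ p)%R; last by rewrite powR1.
    by apply: ge0_ler_powR; rewrite ?nnegrE ?mark_sum_ge0 ?(ltW p0).
  by apply: ler_wpDl => //; apply: ler_powR => //; exact: ltW.
rewrite ge0_integralD//; last 2 first.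
- by move=> w _; rewrite lee_fin powR_ge0.
- by apply/measurable_EFinP; apply: (measurableT_comp (measurable_powR _)).
rewrite (integral_probability_cst P 1)//; apply: leeD2l.
have := @moment_le1 1 f N; rewrite ltr01 lexx => /(_ isT mf) h.
apply: le_trans h _; under [X in _ * X <= _]eq_integral do rewrite powRr1//.
by [].
Qed.

(** The induction of [moment_le_const] for supports of any measure: as long as
    p - 1 > 1, use |f|^(p-1) <= |f| + |f|^p, and once the exponent is at most 1 the
    first moment is enough. *)
Lemma moment_finite (p : R) k (f : L -> R) : (0 < p <= k.+1%:R)%R ->
  measurable_fun [set: L] f -> \int[lam]_u (`|f u|)%:E < +oo ->
  ((1 < p)%R -> \int[lam]_u (`|f u| `^ p)%:E < +oo) ->
  exists C : R, forall N, \int[P]_w (Sum (jumps f) N w `^ p)%:E <= C%:E.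
Proof.
move=> + mf f1.
have F0 : 0 <= \int[lam]_u (`|f u|)%:E by apply: integral_ge0 => u _; rewrite lee_fin.
have F1 : \int[lam]_u (`|f u|)%:E = (fine (\int[lam]_u (`|f u|)%:E))%:E.
  by rewrite fineK// ge0_fin_numE.
have small (r : R) : (0 < r <= 1)%R ->
    exists C : R, forall N, \int[P]_w (Sum (jumps f) N w `^ r)%:E <= C%:E.
  move=> r01; eexists => N; apply: le_trans (moment_le_first _ r01 mf) _.
  by rewrite F1 -EFinM -EFinD.
elim: k p => [|k IHk] p /andP[p0 pk] fp; first by apply: small; rewrite p0.
have [p1|p1] := leP p 1%R; first by apply: small; rewrite p0.
have {}fp := fp p1.
have [|fp'|C hC] := IHk (p - 1)%R.
- by rewrite subr_gt0 p1 lerBlDr -natr1 in pk *.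
- apply: (@le_lt_trans _ _ (\int[lam]_u ((`|f u|)%:E + (`|f u| `^ p)%:E))).
    apply: ge0_le_integral => //.
    + exact: measurable_normr_powR.
    + apply: emeasurable_funD; last exact: measurable_normr_powR.
      by apply/measurable_EFinP; exact: measurableT_comp.
    move=> u _; rewrite -EFinD lee_fin.
    have [u1|u1] := leP (`|f u|)%R 1%R.
      apply: ler_wpDr; rewrite ?powR_ge0//.
      have [->|fu] := eqVneq (f u) 0%R.
        by rewrite normr0 powR0// subr_eq0 gt_eqF.
      by apply: ge1r_powR; rewrite ?normr_gt0 ?fu// ltW.
    apply: ler_wpDl => //; apply: ler_powR; first exact: ltW.
    by rewrite lerBlDr lerDl.
  rewrite ge0_integralD//.
  - exact: lte_add_pinfty.
  - by apply/measurable_EFinP; exact: measurableT_comp.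
  - exact: measurable_normr_powR.
have fpE : \int[lam]_u (`|f u| `^ p)%:E = (fine (\int[lam]_u (`|f u| `^ p)%:E))%:E.
  rewrite fineK// ge0_fin_numE//.
  by apply: integral_ge0 => u _; rewrite lee_fin powR_ge0.
eexists => N; apply: le_trans (moment_ge1 _ (ltW p1) mf) _.
apply: (@le_trans _ _ ((2 `^ p)%:E * (C%:E * ((jm 1)%:E * \int[lam]_u (`|f u|)%:E) +
  (jm p)%:E * \int[lam]_u (`|f u| `^ p)%:E))); last first.
  by rewrite fpE F1 -!EFinM.
apply: lee_wpmul2l; first by rewrite lee_fin powR_ge0.
by apply/leeD2r/lee_wpmul2r => //; rewrite mule_ge0// lee_fin jump_moment_ge0.
Qed.

End moment_bounds.

(** * Moments of the limit *)

Section set_integrals.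
Context {R : realType} {d : measure_display} {L : measurableType d}.
Variable lam : {measure set L -> \bar R}.
Local Open Scope ereal_scope.

Lemma subset_integral_le (D : set L) (g h : L -> \bar R) : measurable D ->
  measurable_fun [set: L] g -> measurable_fun [set: L] h ->
  (forall x, 0 <= g x) -> (forall x, 0 <= h x) -> (forall x, D x -> g x <= h x) ->
  \int[lam]_(x in D) g x <= \int[lam]_x h x.
Proof.
move=> mD mg mh g0 h0 gh; apply: (@le_trans _ _ (\int[lam]_(x in D) h x)).
  by apply: ge0_le_integral => //; exact: measurable_funTS.
exact: ge0_subset_integral.
Qed.

Lemma integral_setC_split (D : set L) (g : L -> \bar R) : measurable D ->
  measurable_fun [set: L] g -> (forall x, 0 <= g x) ->
  \int[lam]_x g x = \int[lam]_(x in D) g x + \int[lam]_(x in ~` D) g x.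
Proof.
move=> mD mg g0; rewrite -ge0_integral_setU ?setUv//.
- exact: measurableC.
- by rewrite disj_set2E setICr.
Qed.

End set_integrals.

Section limit_moments.
Context {R : realType} {dO dL : measure_display} {Omega : measurableType dO}.
Context {L : measurableType dL} (P : probability Omega R) (Q : probability L R).
Variables (e : nat -> Omega -> R) (U : nat -> Omega -> L).
Hypothesis me : forall n, measurable_fun [set: Omega] (e n).
Hypothesis mU : forall n, measurable_fun [set: Omega] (U n).
Hypothesis e_gt0 : forall n w, 0 < e n w.
Hypothesis step : renewal_property e U P Q.
Variables (lam : {sigma_finite_measure set L -> \bar R}) (q : L -> R).
Hypothesis mq : measurable_fun [set: L] q.
Hypothesis q_gt0 : forall x, 0 < q x.
Hypothesis QE : forall A, measurable A -> (Q A = \int[lam]_(x in A) (q x)%:E)%E.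
Local Open Scope ereal_scope.
Local Notation Sum := (mark_sum e U).
Local Notation jumps f := (jump_of q (fun x => `|f x|%R)).
Local Notation jm := (@jump_moment R).
Variables (f : L -> R) (S : Omega -> R).
Hypothesis mf : measurable_fun [set: L] f.
Hypothesis mS : measurable_fun [set: Omega] S.
Hypothesis SE : {ae P, forall w, Sum (jump_of q f) n w @[n --> \oo] --> S w}.
Hypothesis bounded : {ae P, forall w, exists m : nat,
  forall N, (Sum (jumps f) N w <= m%:R)%R}.

(** The sums of absolute values increase, and they dominate the partial sums
    whose limit is S. *)
Lemma moment_limit (p : R) (C : \bar R) : (0 < p)%R ->
  (forall N, \int[P]_w (Sum (jumps f) N w `^ p)%:E <= C) ->
  \int[P]_w (`|S w| `^ p)%:E <= C.
Proof.
move=> p0 hC; pose g N w := (Sum (jumps f) N w `^ p)%:E : \bar R.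
have mg N : measurable_fun [set: Omega] (g N).
  apply/measurable_EFinP; apply: (measurableT_comp (measurable_powR p)).
  by apply: measurable_mark_sum => //; exact: measurable_jumps.
have g0 N w : 0 <= g N w by rewrite lee_fin powR_ge0.
have ndg w m n : (m <= n)%N -> g m w <= g n w.
  move=> mn; rewrite lee_fin; apply: ge0_ler_powR; rewrite ?nnegrE ?mark_sum_ge0 ?(ltW p0)//.
  by apply: mark_sum_le => // z; exact: jump_of_ge0.
have cg w : g n w @[n --> \oo] --> limn (g ^~ w).
  by apply: ereal_nondecreasing_is_cvgn => m n; exact: ndg.
apply: (@le_trans _ _ (\int[P]_w limn (g ^~ w))); last first.
  by apply: (@monotone_integral_le _ _ _ P g _ C mg g0 _ cg hC) => w m n; exact: ndg.
apply: ae_ge0_le_integral => //.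
- apply/measurable_EFinP; apply: (measurableT_comp (measurable_powR p)).
  exact: measurableT_comp.
- by move=> w _; apply: lime_ge; [exact: cg|exact: nearW].
- by apply: (emeasurable_fun_cvg g) => // w _; exact: cg.
apply: filterS SE => w Sw _.
have cS : (`|Sum (jump_of q f) n w| `^ p)%:E @[n --> \oo] --> (`|S w| `^ p)%:E.
  by apply/fine_cvgP; split; [exact: nearW|exact: cvg_powR_norm].
rewrite -(cvg_lim _ cS)//; apply: lee_lim; [exact: cvgP cS|exact: cg|].
apply: nearW => n; rewrite lee_fin; apply: ge0_ler_powR; rewrite ?nnegrE ?(ltW p0) ?mark_sum_ge0//.
apply: le_trans (ler_norm_sum _ _ _) _; apply: ler_sum => i _.
by rewrite normr_jump_of.
Qed.

(** The sum of min(|phi|, 1) over the points is almost surely bounded too, so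
    that min(|phi|, 1) is integrable. *)
Lemma truncation_integrable :
  \int[lam]_u (Num.min (jump 1 * `|f u|) 1)%R%:E < +oo.
Proof.
apply: le_lt_trans (truncated_jump_integral_ge mq q_gt0 QE mf) _.
apply: (summable_integral_lty me mU e_gt0 step).
- by apply: measurable_minr => //; exact: measurable_jumps.
- by move=> z; rewrite le_min ler01 jump_of_ge0 ge_min lexx orbT.
- by move=> z /ltW z0; rewrite jump_of_neg// min_l.
- apply: filterS bounded => w [m hm]; exists m => N; apply: le_trans (hm N).
  by apply: ler_sum => i _; rewrite ge_min lexx.
Qed.

Let mabs : measurable_fun [set: L] (fun u => `|f u|%R).
Proof. exact: measurableT_comp. Qed.

Let mtrunc : measurable_fun [set: L] (fun u => (Num.min (jump 1 * `|f u|) 1)%R%:E : \bar R).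
Proof.
by apply/measurable_EFinP; apply: measurable_minr => //; exact: measurable_funM.
Qed.

Let trunc0 u : 0 <= (Num.min (jump 1 * `|f u|) 1)%R%:E :> \bar R.
Proof. by rewrite lee_fin le_min ler01 mulr_ge0 ?jump_ge0. Qed.

Lemma measurable_small (c : R) : measurable [set x | (`|f x| <= c)%R].
Proof.
rewrite -[X in measurable X]setTI; apply: (measurable_fun_ler mabs) => //.
Qed.

Lemma large_setC (c : R) : [set x | (`|f x| > c)%R] = ~` [set x | (`|f x| <= c)%R].
Proof. by apply/seteqP; split => x /=; rewrite ltNge => /negP. Qed.

Lemma measurable_large (c : R) : measurable [set x | (`|f x| > c)%R].
Proof. by rewrite large_setC; apply/measurableC/measurable_small. Qed.

Lemma small_part_integrable (c : R) : (0 < c)%R ->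
  \int[lam]_(x in [set x | (`|f x| <= c)%R]) (`|f x|)%:E < +oo.
Proof.
move=> c0; pose K := Num.max (jump 1)^-1%R c.
have j0 : (0 < jump (1 : R))%R by exact: jump_gt0.
have K0 : (0 <= K)%R by rewrite le_max (ltW c0) orbT.
apply: (@le_lt_trans _ _ (\int[lam]_u (K%:E * (Num.min (jump 1 * `|f u|) 1)%R%:E))).
  apply: subset_integral_le => //.
  - exact: measurable_small.
  - exact/measurable_EFinP.
  - exact: measurable_funeM.
  - by move=> u; rewrite mule_ge0// lee_fin.
  move=> u /= uc; rewrite -EFinM lee_fin.
  have [fu|fu] := leP (jump 1 * `|f u|)%R 1%R.
    rewrite mulrA ler_peMl//; apply: (@le_trans _ _ ((jump 1)^-1 * jump 1)%R).
      by rewrite mulVf// gt_eqF.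
    by rewrite ler_wpM2r ?(ltW j0)// le_max lexx.
  by rewrite mulr1 le_max uc orbT.
rewrite ge0_integralZl//; apply: lte_mul_pinfty => //.
exact: truncation_integrable.
Qed.

Lemma large_part_finite (c : R) : (0 < c)%R -> lam [set x | (`|f x| > c)%R] < +oo.
Proof.
move=> c0; pose k := Num.min (jump 1 * c)%R 1%R.
have k0 : (0 < k)%R by rewrite lt_min ltr01 mulr_gt0 ?jump_gt0.
rewrite -[ltLHS]mul1e -(integral_cst lam (measurable_large c)).
apply: (@le_lt_trans _ _ (\int[lam]_u (k^-1%:E * (Num.min (jump 1 * `|f u|) 1)%R%:E))).
  apply: subset_integral_le => //.
  - exact: measurable_large.
  - exact: measurable_funeM.
  - by move=> u; rewrite mule_ge0// lee_fin invr_ge0 ltW.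
  move=> u /= uc; rewrite -EFinM lee_fin ler_pdivlMl// mulr1.
  by rewrite le_min !ge_min lexx orbT andbT ler_wpM2l ?jump_ge0 ?(ltW uc).
rewrite ge0_integralZl// ?lee_fin ?invr_ge0 ?(ltW k0)//; apply: lte_mul_pinfty => //.
  by rewrite lee_fin invr_ge0 ltW.
exact: truncation_integrable.
Qed.

(** Outside {|f| > c} the integrand is at most c^p, on a set of finite measure. *)
Lemma large_part_threshold (p c c' : R) : (0 < p)%R -> (0 < c)%R -> (0 < c')%R ->
  \int[lam]_(x in [set x | (`|f x| > c)%R]) (`|f x| `^ p)%:E < +oo ->
  \int[lam]_(x in [set x | (`|f x| > c')%R]) (`|f x| `^ p)%:E < +oo.
Proof.
move=> p0 c0 c'0 hc.
have mp := measurable_normr_powR mf p; have p0' u : 0 <= (`|f u| `^ p)%:E.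
  by rewrite lee_fin powR_ge0.
have mc := measurable_large c; have mc' := measurable_large c'.
rewrite (@integral_mkcond _ _ _ lam [set x | (`|f x| > c)%R]) in hc.
have mres : measurable_fun [set: L]
    ((fun u => (`|f u| `^ p)%:E) \_ [set x | (`|f x| > c)%R]).
  by apply/(measurable_restrictT _ mc); exact: measurable_funTS.
apply: (@le_lt_trans _ _ (\int[lam]_(x in [set x | (`|f x| > c')%R])
   (((fun u => (`|f u| `^ p)%:E) \_ [set x | (`|f x| > c)%R]) x + (c `^ p)%:E))).
  apply: ge0_le_integral => //.
  - exact: measurable_funTS.
  - by apply: emeasurable_funD => //; exact: measurable_funTS.
  move=> u _; rewrite patchE; case: ifPn => [_|].
    by rewrite -EFinD lee_fin lerDl powR_ge0.
  rewrite notin_setE/= => /negP; rewrite -leNgt => uc; rewrite add0e lee_fin.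
  by apply: ge0_ler_powR; rewrite ?nnegrE ?(ltW p0) ?(ltW c0).
rewrite ge0_integralD//; last 3 first.
- by move=> u _; rewrite patchE; case: ifP.
- exact: measurable_funTS.
- by move=> u _; rewrite lee_fin powR_ge0.
rewrite integral_cst// lte_add_pinfty//.
  apply: le_lt_trans hc; apply: ge0_subset_integral => //.
  by move=> u _; rewrite patchE; case: ifP.
by rewrite lte_mul_pinfty ?lee_fin ?powR_ge0//; exact: large_part_finite.
Qed.

Lemma powR_integral_parts (r p : R) : (1 <= r <= p)%R ->
  \int[lam]_u (`|f u| `^ r)%:E <=
  \int[lam]_(x in [set x | (`|f x| <= 1)%R]) (`|f x|)%:E +
  \int[lam]_(x in [set x | (`|f x| > 1)%R]) (`|f x| `^ p)%:E.
Proof.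
move=> /andP[r1 rp]; have ms := measurable_small 1; have ml := measurable_large 1.
rewrite (integral_setC_split _ ms); last 2 first.
- exact: measurable_normr_powR.
- by move=> u; rewrite lee_fin powR_ge0.
rewrite -large_setC; apply: leeD; apply: ge0_le_integral => //.
- by apply: measurable_funTS; exact: measurable_normr_powR.
- by apply: measurable_funTS; exact/measurable_EFinP.
- move=> u /= u1; rewrite lee_fin; have [->|fu] := eqVneq (f u) 0%R.
    by rewrite normr0 powR0// gt_eqF// (lt_le_trans ltr01).
  by apply: ge1r_powR => //; rewrite normr_gt0 fu.
- by apply: measurable_funTS; exact: measurable_normr_powR.
- by apply: measurable_funTS; exact: measurable_normr_powR.
by move=> u /= u1; rewrite lee_fin; apply: ler_powR => //; exact: ltW.
Qed.

(** For p > 1 the function f lies in L^1 and L^p. For p <= 1 it is cut at level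
    1: the first moment controls the sum over the bounded part, subadditivity of the
    power the sum over the rest. *)
Lemma moment_of_large_part (p : R) : (0 < p)%R ->
  \int[lam]_(x in [set x | (`|f x| > 1)%R]) (`|f x| `^ p)%:E < +oo ->
  \int[P]_w (`|S w| `^ p)%:E < +oo.
Proof.
move=> p0 large; have small := small_part_integrable ltr01.
have [p1|p1] := leP p 1%R; last first.
  have fin r : (1 <= r <= p)%R -> \int[lam]_u (`|f u| `^ r)%:E < +oo.
    by move=> rp; apply: le_lt_trans (powR_integral_parts rp) _; exact: lte_add_pinfty.
  have [||_|C hC] := moment_finite me mU e_gt0 step mq q_gt0 QE (k := Num.truncn p) _ mf
      (p := p).
  - by rewrite p0/= ltW// truncnS_gt.
  - have := fin 1%R; rewrite lexx (ltW p1) => /(_ isT).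
    by under eq_integral do rewrite powRr1//.
  - by apply: fin; rewrite lexx ltW.
  by apply: le_lt_trans (moment_limit p0 hC) _; rewrite ltry.
have ms := measurable_small 1; have ml := measurable_large 1.
pose f1 u := (f u * \1_[set x | (`|f x| <= 1)%R] u)%R.
pose f2 u := (f u * \1_[set x | (`|f x| > 1)%R] u)%R.
have mf1 : measurable_fun [set: L] f1 by apply: measurable_funM => //; exact: measurable_indic.
have mf2 : measurable_fun [set: L] f2 by apply: measurable_funM => //; exact: measurable_indic.
have fE u : (`|f u| = `|f1 u| + `|f2 u|)%R.
  rewrite /f1 /f2 !indicE; have [u1|u1] := leP (`|f u|)%R 1%R.
    by rewrite mem_set// memNset ?mulr1 ?mulr0 ?normr0 ?addr0//= ltNge u1.
  by rewrite memNset ?mem_set ?mulr1 ?mulr0 ?normr0 ?add0r//= leNgt u1.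
have p01 : (0 < p <= 1)%R by rewrite p0.
have SumE N w : Sum (jumps f) N w = (Sum (jumps f1) N w + Sum (jumps f2) N w)%R.
  rewrite /mark_sum -big_split/=; apply: eq_bigr => i _.
  by rewrite /jump_of fE mulrDr.
have mSp (g : L -> R) N : measurable_fun [set: L] g ->
    measurable_fun [set: Omega] (fun w => (Sum (jumps g) N w `^ p)%:E).
  move=> mg; apply/measurable_EFinP; apply: (measurableT_comp (measurable_powR p)).
  by apply: measurable_mark_sum => //; exact: measurable_jumps.
apply: (@le_lt_trans _ _ ((1 + (jm 1)%:E * \int[lam]_u (`|f1 u|)%:E) +
  (jm p)%:E * \int[lam]_u (`|f2 u| `^ p)%:E)).
  apply: moment_limit => // N.
  have mS1 := mSp _ N mf1; have mS2 := mSp _ N mf2.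
  apply: (@le_trans _ _ (\int[P]_w (Sum (jumps f1) N w `^ p)%:E +
                         \int[P]_w (Sum (jumps f2) N w `^ p)%:E)).
    rewrite -ge0_integralD//; last 2 first.
    - by move=> w _; rewrite lee_fin powR_ge0.
    - by move=> w _; rewrite lee_fin powR_ge0.
    apply: ge0_le_integral => //.
    - by move=> w _; rewrite lee_fin powR_ge0.
    - exact: mSp.
    - exact: emeasurable_funD.
    move=> w _; rewrite -EFinD lee_fin SumE.
    by apply: powR_subadditive => //; exact: mark_sum_ge0.
  apply: leeD; first exact: (moment_le_first me mU e_gt0 step mq q_gt0 QE).
  exact: (moment_le1 me mU e_gt0 step mq q_gt0 QE).
have f1E : \int[lam]_u (`|f1 u|)%:E =
    \int[lam]_(x in [set x | (`|f x| <= 1)%R]) (`|f x|)%:E.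
  rewrite [RHS]integral_mkcond; apply: eq_integral => u _.
  by rewrite patchE /f1 indicE; case: ifPn => _; rewrite ?mulr1 ?mulr0 ?normr0.
have f2E : \int[lam]_u (`|f2 u| `^ p)%:E =
    \int[lam]_(x in [set x | (`|f x| > 1)%R]) (`|f x| `^ p)%:E.
  rewrite [RHS]integral_mkcond; apply: eq_integral => u _.
  rewrite patchE /f2 indicE; case: ifPn => _; rewrite ?mulr1 ?mulr0 ?normr0//.
  by rewrite powR0// gt_eqF.
rewrite f1E f2E; apply: lte_add_pinfty.
  apply: lte_add_pinfty; first exact: ltry.
  by apply: lte_mul_pinfty small; rewrite ?lee_fin ?jump_moment_ge0.
by apply: lte_mul_pinfty large; rewrite ?lee_fin ?jump_moment_ge0.
Qed.

End limit_moments.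

(** * Lower moment bound *)

Lemma powR_norm_triangle (R : realType) (p u x : R) : 0 < p ->
  `|u| `^ p <= 2 `^ p * (`|u + x| `^ p + `|x| `^ p).
Proof.
move=> p0; have mono (a b : R) : 0 <= a -> a <= b -> a `^ p <= b `^ p.
  by move=> a0 ab; apply: ge0_ler_powR; rewrite ?nnegrE ?(ltW p0) ?a0 ?(le_trans a0 ab).
have tri : `|u| <= `|u + x| + `|x| by rewrite -[in leLHS](addrK x u) ler_normB.
have double (a : R) : 0 <= a -> (2 * a) `^ p = 2 `^ p * a `^ p.
  by move=> a0; rewrite powRM.
have [ux|xu] := leP `|u + x| `|x|.
  apply: le_trans (mono _ (2 * `|x|) _ _) _ => //; first by lra.
  by rewrite double// ler_wpM2l ?powR_ge0// lerDr powR_ge0.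
apply: le_trans (mono _ (2 * `|u + x|) _ _) _ => //; first by lra.
by rewrite double// ler_wpM2l ?powR_ge0// lerDl powR_ge0.
Qed.

Lemma min_subadditive (R : realType) (a b d c k : R) : 0 <= a -> 0 <= b -> 0 <= d ->
  0 <= k -> 1 <= c -> a <= c * (b + d) ->
  Num.min a k <= c * (Num.min b k + Num.min d k).
Proof.
move=> a0 b0 d0 k0 c1 h.
case: (leP b k) => bk; case: (leP d k) => dk; case: (leP a k) => ak; nra.
Qed.

Lemma cvg_minr (R : realType) (u : nat -> R) (l k : R) :
  u n @[n --> \oo] --> l -> Num.min (u n) k @[n --> \oo] --> Num.min l k.
Proof.
move=> /cvgrPdist_le ul; apply/cvgrPdist_le => eps eps0.
apply: filterS (ul _ eps0) => n; apply: le_trans.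
case: (leP l k) => lk; case: (leP (u n) k) => uk.
- by [].
- by rewrite !ler0_norm; lra.
- by rewrite !ger0_norm; lra.
- by rewrite subrr normr0.
Qed.

Section lower_moment.
Context {R : realType} {dO dL : measure_display} {Omega : measurableType dO}.
Context {L : measurableType dL} (P : probability Omega R) (Q : probability L R).
Variables (e : nat -> Omega -> R) (U : nat -> Omega -> L).
Hypothesis me : forall n, measurable_fun [set: Omega] (e n).
Hypothesis mU : forall n, measurable_fun [set: Omega] (U n).
Hypothesis e_gt0 : forall n w, 0 < e n w.
Hypothesis step : renewal_property e U P Q.
Variables (lam : {sigma_finite_measure set L -> \bar R}) (q : L -> R).
Hypothesis mq : measurable_fun [set: L] q.
Hypothesis q_gt0 : forall x, 0 < q x.
Hypothesis QE : forall A, measurable A -> (Q A = \int[lam]_(x in A) (q x)%:E)%E.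
Local Open Scope ereal_scope.
Local Notation mu := (time_mark_measure Q).
Local Notation Sum := (mark_sum e U).
Variables (f : L -> R) (S : Omega -> R).
Hypothesis mf : measurable_fun [set: L] f.
Hypothesis mS : measurable_fun [set: Omega] S.
Local Notation phi := (jump_of q f).
Hypothesis SE : {ae P, forall w, Sum phi n w @[n --> \oo] --> S w}.
Variables (p K : R) (A : set L).
Hypothesis p_gt0 : (0 < p)%R.
Hypothesis K_gt0 : (0 < K)%R.
Hypothesis mA : measurable A.
Hypothesis AK : lam A * K%:E <= 2^-1%:E.

(** The points with mark in A and jump at least jump K. The bound on the time
    makes the region end at a fixed time, as [insertion_moment] requires. *)
Definition early_jump (k : nat) (z : R * L) : bool :=
  [&& z.2 \in A, (0 < z.1 * q z.2 <= K)%R & (z.1 < k%:R)%R].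

(** The cap allows dominated convergence as the number of points grows. *)
Definition capped_power (k : nat) (x : R) : R := (Num.min (`|x| `^ p) k%:R)%R.

Lemma capped_power_ge0 k x : (0 <= capped_power k x)%R.
Proof. by rewrite le_min powR_ge0 ler0n. Qed.

Lemma measurable_capped_power k : measurable_fun [set: R] (capped_power k).
Proof.
apply: measurable_minr => //.
exact: (measurableT_comp (measurable_powR p) (@normr_measurable R setT)).
Qed.

Lemma measurable_in_mark : measurable_fun [set: R * L] (fun z => z.2 \in A).
Proof.
apply: (measurable_fun_bool true); rewrite setTI.
have -> : (fun z : R * L => z.2 \in A) @^-1` [set true] = snd @^-1` A.
  by apply/seteqP; split => z /= => [/set_mem|/mem_set].
by rewrite -[X in measurable X]setTI; exact: measurable_snd.
Qed.

Lemma measurable_scaled_time : measurable_fun [set: R * L] (fun z => (z.1 * q z.2)%R).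
Proof. by apply: measurable_funM => //; exact: measurableT_comp. Qed.

Lemma measurable_early_jump k : measurable_fun [set: R * L] (early_jump k).
Proof.
apply: measurable_and; first exact: measurable_in_mark.
apply: measurable_and; last exact: measurable_fun_ltr.
apply: measurable_and; last exact: measurable_fun_ler measurable_scaled_time _.
exact: measurable_fun_ltr _ measurable_scaled_time.
Qed.

Lemma early_jump_time k z : early_jump k z -> (0 <= z.1 < k%:R)%R.
Proof.
move=> /and3P[_ /andP[z0 _] ->]; rewrite andbT.
by rewrite ltW// -(pmulr_lgt0 _ (q_gt0 z.2)).
Qed.

(* in the time s = t q(u) the region [early_jump] is the strip ]0, K] over A *)
Let slab (c : L -> R) (z : R * L) : \bar R :=
  (c z.2 * (z.2 \in A)%R%:R * (0 < z.1 <= K)%R%:R)%R%:E.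

Lemma measurable_slab (c : L -> R) : measurable_fun [set: L] c ->
  measurable_fun [set: R * L] (slab c).
Proof.
move=> mc; apply/measurable_EFinP; apply: measurable_funM.
  apply: measurable_funM; first exact: measurableT_comp.
  by apply: measurable_natr; exact: measurable_in_mark.
by apply/measurable_natr/measurable_and; [exact: measurable_fun_ltr|exact: measurable_fun_ler].
Qed.

Lemma measurable_scaled_slab (c : L -> R) : measurable_fun [set: L] c ->
  measurable_fun [set: R * L] (fun z => slab c ((z.1 * q z.2)%R, z.2)).
Proof.
move=> mc; apply: (measurableT_comp (measurable_slab mc)).
by apply: measurable_fun_pair => //; exact: measurable_scaled_time.
Qed.

Lemma slab_integral (c : L -> R) : measurable_fun [set: L] c ->
  (forall u, 0 <= c u)%R ->
  \int[mu]_z (slab c) ((z.1 * q z.2)%R, z.2) =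
  K%:E * \int[lam]_(u in A) (c u)%:E.
Proof.
move=> mc c0; rewrite (time_mark_integralE mq q_gt0 QE); last 2 first.
- exact: measurable_slab.
- by move=> z; rewrite lee_fin !mulr_ge0.
rewrite [in RHS]integral_mkcond.
transitivity (\int[lam]_u (K%:E * ((fun u => (c u)%:E) \_ A) u)).
  apply: eq_integral => u _; rewrite /slab/= integral_oc ?(ltW K_gt0)// subr0 patchE.
  by case: ifP => _; rewrite ?mulr1 ?mulr0 ?mul0r ?mule0// mulrC EFinM.
rewrite ge0_integralZl//.
- by apply/(measurable_restrictT _ mA); apply: measurable_funTS; exact/measurable_EFinP.
- by move=> u _; rewrite patchE; case: ifP => // _; rewrite lee_fin.
- by rewrite lee_fin ltW.
Qed.

Lemma early_jump_mass k : \int[mu]_z (hit (early_jump k) z)%:E <= 2^-1%:E.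
Proof.
apply: le_trans AK; rewrite muleC.
rewrite -[lam A]mul1e -(integral_cst lam mA).
rewrite -[_ * _](@slab_integral (cst 1%R)) => //.
apply: ge0_le_integral => //.
- by move=> z _; rewrite lee_fin /hit ler0n.
- by apply/measurable_EFinP; apply: measurable_natr; exact: measurable_early_jump.
- exact: measurable_scaled_slab.
move=> z _; rewrite lee_fin /hit /early_jump /slab/= mul1r.
by case: (z.2 \in A) => //=; rewrite ?mul0r// mul1r; case: (0 < _ <= _)%R => //=; case: ltP.
Qed.

Lemma capped_power_limit k :
  \int[P]_w (capped_power k (Sum phi n w))%:E @[n --> \oo] -->
  \int[P]_w (capped_power k (S w))%:E.
Proof.
have mX n : measurable_fun [set: Omega] (fun w => (capped_power k (Sum phi n w))%:E).
  apply/measurable_EFinP; apply: (measurableT_comp (measurable_capped_power k)).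
  by apply: measurable_mark_sum => //; exact: measurable_jump_of.
have [||||_ _ //] := @dominated_convergence _ _ _ P setT measurableT
  (fun n w => (capped_power k (Sum phi n w))%:E)
  (fun w => (capped_power k (S w))%:E) (cst k%:R%:E) mX.
- apply/measurable_EFinP; exact: (measurableT_comp (measurable_capped_power k)).
- apply: filterS SE => w Sw _; apply/fine_cvgP; split; first exact: nearW.
  by apply: cvg_minr; exact: cvg_powR_norm.
- by apply: finite_measure_integrable_cst.
- apply: aeW => w n _; rewrite gee0_abs ?lee_fin ?capped_power_ge0//.
  by rewrite ge_min lexx orbT.
Qed.

(** [insertion_moment] for the capped power, in the limit of infinitely many
    points. *)
Lemma early_jump_moment k :
  \int[mu]_z (hit (early_jump k) z * capped_power k (phi z))%:E <=
  (8 * 2 `^ p)%:E * \int[P]_w (`|S w| `^ p)%:E.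
Proof.
apply: (@le_trans _ _ ((8 * 2 `^ p)%:E * \int[P]_w (capped_power k (S w))%:E)); last first.
  apply: lee_wpmul2l; first by rewrite lee_fin mulr_ge0// powR_ge0.
  apply: ge0_le_integral => //.
  - by move=> w _; rewrite lee_fin capped_power_ge0.
  - apply/measurable_EFinP; exact: (measurableT_comp (measurable_capped_power k)).
  - apply/measurable_EFinP; apply: (measurableT_comp (measurable_powR p)).
    exact: measurableT_comp.
  - by move=> w _; rewrite lee_fin ge_min lexx.
have [N0 hN0] : exists N0, forall N, (N0 <= N)%N ->
    P [set w | (arrival e N w < k%:R)%R] <= 4^-1%:E.
  by apply: (late_arrival_small me mU e_gt0 step); rewrite ?ler0n ?invr_gt0.
have J0 : 0 <= \int[P]_w (capped_power k (S w))%:E.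
  by apply: integral_ge0 => w _; rewrite lee_fin capped_power_ge0.
pose I n := \int[P]_w (capped_power k (Sum phi n w))%:E.
have cI : (4 * 2 `^ p)%:E * (I n.+1 + I n) @[n --> \oo] -->
    (4 * 2 `^ p)%:E * (\int[P]_w (capped_power k (S w))%:E +
                       \int[P]_w (capped_power k (S w))%:E).
  apply: cvgeZl => //; apply: cvgeD.
  - by rewrite ge0_adde_def// inE.
  - by rewrite (cvg_shiftS I); exact: capped_power_limit.
  - exact: capped_power_limit.
have -> : (8 * 2 `^ p)%:E * \int[P]_w (capped_power k (S w))%:E =
    (4 * 2 `^ p)%:E * (\int[P]_w (capped_power k (S w))%:E +
                       \int[P]_w (capped_power k (S w))%:E).
  have c0 : (0 <= 4 * 2 `^ p)%R by rewrite mulr_ge0// powR_ge0.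
  move: (\int[P]_w _) J0 => J J0.
  rewrite ge0_muleDr//; transitivity ((4 * 2 `^ p + 4 * 2 `^ p)%:E * J).
    by congr (_%:E * _); lra.
  by rewrite EFinD ge0_muleDl ?lee_fin.
rewrite -(cvg_lim _ cI)//; apply: lime_ge; first exact: cvgP cI.
near=> n; have n0 : (N0 <= n)%N by near: n; exact: nbhs_infty_ge.
apply: (insertion_moment me mU e_gt0 step _ (measurable_early_jump k)
  (@early_jump_time k) (measurable_capped_power k) (capped_power_ge0 k)).
- exact: measurable_jump_of.
- by rewrite powR_ge0.
- move=> u x; apply: min_subadditive; rewrite ?powR_ge0 ?ler0n//.
    by rewrite -[leLHS](powRr0 2); apply: ler_powR; rewrite ?ler1n// ltW.
  exact: powR_norm_triangle.
- exact: early_jump_mass.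
- exact: hN0.
Unshelve. all: by end_near. Qed.

(** The caps are removed by monotone convergence. In the region that remains
    the jump is at least jump K, and its section at each mark of A has length K. *)
Lemma lower_moment :
  (K * jump K `^ p)%:E * \int[lam]_(u in A) (`|f u| `^ p)%:E <=
  (8 * 2 `^ p)%:E * \int[P]_w (`|S w| `^ p)%:E.
Proof.
pose g (z : R * L) : \bar R :=
  ((z.2 \in A)%R%:R * (0 < z.1 * q z.2 <= K)%R%:R * `|phi z| `^ p)%R%:E.
have mphi := measurable_jump_of mq mf.
apply: (@le_trans _ _ (\int[mu]_z g z)); last first.
  apply: (@monotone_integral_le R _ (measurableTypeR R * L)%type mu
    (fun k z => (hit (early_jump k) z * capped_power k (phi z))%:E)).
  - move=> k; apply/measurable_EFinP; apply: measurable_funM.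
      by apply: measurable_natr; exact: measurable_early_jump.
    exact: (measurableT_comp (measurable_capped_power k)).
  - by move=> k z; rewrite lee_fin mulr_ge0 ?capped_power_ge0.
  - move=> z m n mn; rewrite lee_fin; apply: ler_pM; rewrite ?capped_power_ge0//.
      rewrite /hit /early_jump; case: (_ \in _) => //=; case: (0 < _ <= _)%R => //=.
      have [zm|] := ltP z.1 m%:R; last by rewrite ler0n.
      by rewrite (lt_le_trans zm) ?ler_nat.
    rewrite /capped_power le_min !ge_min lexx/= ler_nat mn orbT//.
  - move=> z; apply: cvg_near_cst; near=> k.
    rewrite /g /hit /early_jump /capped_power (_ : (z.1 < k%:R)%R); last first.
      by near: k; exact: nbhs_infty_gtr.
    rewrite min_l; last by apply: ltW; near: k; exact: nbhs_infty_gtr.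
    by case: (_ \in _); case: (0 < _ <= _)%R; rewrite ?mulr0 ?mul0r ?mulr1 ?mul1r.
  - exact: early_jump_moment.
have mpow := measurable_normr_powR mf p.
have -> : (K * jump K `^ p)%:E * \int[lam]_(u in A) (`|f u| `^ p)%:E =
    K%:E * \int[lam]_(u in A) (jump K `^ p * `|f u| `^ p)%:E.
  rewrite EFinM -muleA; congr (_ * _); under [RHS]eq_integral do rewrite EFinM.
  by rewrite ge0_integralZl ?lee_fin ?powR_ge0//; exact: measurable_funTS.
have mc : measurable_fun [set: L] (fun u => jump K `^ p * `|f u| `^ p)%R.
  by apply: measurable_funM => //; exact/measurable_EFinP.
rewrite -slab_integral//; last by move=> u; rewrite mulr_ge0 ?powR_ge0.
apply: ge0_le_integral => //.
- by move=> z _; rewrite lee_fin !mulr_ge0 ?powR_ge0.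
- exact: measurable_scaled_slab.
- apply/measurable_EFinP; apply: measurable_funM; last first.
    by apply: (measurableT_comp (measurable_powR p)); exact: measurableT_comp.
  apply: measurable_funM; first by apply: measurable_natr; exact: measurable_in_mark.
  apply: measurable_natr; apply: measurable_and.
    exact: measurable_fun_ltr _ measurable_scaled_time.
  exact: measurable_fun_ler measurable_scaled_time _.
move=> z _; rewrite lee_fin /=; case: (z.2 \in A); last by rewrite mulr0 !mul0r.
case: (boolP (0 < z.1 * q z.2 <= K)%R) => [/andP[z0 zK]|_]; last by rewrite !(mulr0,mul0r).
rewrite !mulr1 !mul1r /jump_of normrM powRM// ler_wpM2r ?powR_ge0//.
apply: ge0_ler_powR; rewrite ?nnegrE ?(ltW p_gt0) ?jump_ge0//.
by rewrite ger0_norm ?jump_ge0// jump_anti.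
Unshelve. all: by end_near. Qed.

End lower_moment.

(** * Gaps of the Poisson process *)

(** The exponential law is carried by ]0, +oo[. *)
Lemma exponential_prob_ext (R : realType) (A B : set R) :
  measurable A -> measurable B -> (forall x, 0 < x -> A x <-> B x) ->
  exponential_prob 1 A = exponential_prob 1 B.
Proof.
move=> mA mB AB; pose g (x : R) := ((exponential_pdf 1 x)%:E : \bar R).
have mg : measurable_fun [set: measurableTypeR R] g.
  by apply/measurable_EFinP; exact: measurable_exponential_pdf.
have g0 x : (0 <= g x)%E by rewrite lee_fin exponential_pdf_ge0.
rewrite /exponential_prob [LHS]integral_mkcond [RHS]integral_mkcond.
apply: ge0_ae_eq_integral => //.
- by apply/(measurable_restrictT _ mA); exact: measurable_funTS.
- by apply/(measurable_restrictT _ mB); exact: measurable_funTS.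
- by move=> x _; rewrite patchE; case: ifP => // _; exact: g0.
- by move=> x _; rewrite patchE; case: ifP => // _; exact: g0.
exists [set 0]; split.
- exact: measurable_set1.
- exact: lebesgue_measure_set1.
move=> x /= /not_implyP [_ neq]; apply/eqP/negPn/negP => x0; apply: neq.
rewrite !patchE; have [xgt0|xlt0|x00] := ltgtP 0 x.
- by rewrite (_ : (x \in A) = (x \in B))//; apply/idP/idP; rewrite !inE; apply AB.
- by rewrite lt0_exponential_pdf//; case: ifP; case: ifP.
- by rewrite x00 eqxx in x0.
Qed.

Section positive_gaps.
Context {R : realType} {dO dL : measure_display} {Omega : measurableType dO}.
Context {L : measurableType dL} (P : probability Omega R).
Variables (tau : nat -> {RV P >-> R}) (U : nat -> {RV P >-> L}).
Hypothesis Poisson : unit_Poisson_arrivals tau.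
Hypothesis indep : independent_sequences P tau U.

Definition positive_part_or1 (x : R) : R := if 0 < x then x else 1.

(** The gaps are positive almost surely. Replacing the others by 1 makes the
    arrival times strictly increasing everywhere. *)
Definition gap (n : nat) (w : Omega) : R := positive_part_or1 (interarrival tau n w).

Lemma gap_gt0 n w : 0 < gap n w.
Proof. by rewrite /gap /positive_part_or1; case: ifP. Qed.

Lemma measurable_positive_part_or1 : measurable_fun [set: R] positive_part_or1.
Proof. by apply: measurable_fun_ifT => //; exact: measurable_fun_ltr. Qed.

Lemma measurable_interarrival n : measurable_fun [set: Omega] (interarrival tau n).
Proof. by case: n => [|n]//=; exact: measurable_funB. Qed.

Lemma measurable_gap n : measurable_fun [set: Omega] (gap n).
Proof.
exact: (measurableT_comp measurable_positive_part_or1 (measurable_interarrival n)).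
Qed.

Lemma measurable_gap_preimage A : measurable A -> measurable (positive_part_or1 @^-1` A).
Proof.
move=> mA; rewrite -[X in measurable X]setTI; exact: measurable_positive_part_or1.
Qed.

Lemma gap_independent : mutually_independent P gap.
Proof.
move=> J A uJ mA.
apply: (Poisson.1 J (fun i => positive_part_or1 @^-1` (A i)) uJ) => i.
exact: measurable_gap_preimage.
Qed.

Lemma gap_exponential n (A : set R) : measurable A ->
  P (gap n @^-1` A) = exponential_prob 1 A.
Proof.
move=> mA; have mA' := measurable_gap_preimage mA.
rewrite -(@exponential_prob_ext R (positive_part_or1 @^-1` A))//; last first.
  by move=> x x0 /=; rewrite /positive_part_or1 x0.
exact: Poisson.2.
Qed.

Lemma gap_mark_independent : independent_sequences P gap U.
Proof.
move=> A B sA sB; apply: indep => //.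
pose G := [set C | exists n (D : set R), measurable D /\ C = tau n @^-1` D].
have mtau n : measurable_fun [set: g_sigma_algebraType G]
    (tau n : g_sigma_algebraType G -> R).
  by move=> _ D mD; rewrite setTI; apply: sub_sigma_algebra; exists n, D.
have mgap n : measurable_fun [set: g_sigma_algebraType G]
    (gap n : g_sigma_algebraType G -> R).
  have mi : measurable_fun [set: g_sigma_algebraType G]
      (interarrival tau n : g_sigma_algebraType G -> R).
    by case: n => [|n]; [exact: mtau|exact: (measurable_funB (mtau _) (mtau _))].
  exact: (measurableT_comp measurable_positive_part_or1 mi).
apply: (smallest_sub (smallest_sigma_algebra _ _)) sA => _ [n [D [mD ->]]].
by rewrite -[X in _ X]setTI; exact: mgap.
Qed.

Lemma interarrival_gt0 : {ae P, forall w, forall n, 0 < interarrival tau n w}.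
Proof.
apply: ae_foralln => n; exists (interarrival tau n @^-1` [set x | x <= 0]).
have mneg : measurable [set x : R | x <= 0].
  by rewrite -set_itvNyc; exact: measurable_itv.
split.
- by rewrite -[X in measurable X]setTI; exact: measurable_interarrival.
- rewrite [LHS](Poisson.2 n _ mneg).
  rewrite (@exponential_prob_ext R _ set0)//; first by rewrite /exponential_prob integral_set0.
  by move=> x x0; split => //=; rewrite leNgt x0.
- by move=> w /= /negP; rewrite -leNgt.
Qed.

Lemma arrival_gap w n : (forall m, 0 < interarrival tau m w) ->
  arrival gap n.+1 w = tau n w.
Proof.
move=> pos; have gE m : gap m w = interarrival tau m w.
  by rewrite /gap /positive_part_or1 pos.
elim: n => [|n IHn]; first by rewrite arrivalS /arrival big_ord0 add0r gE.
by rewrite arrivalS IHn gE/= addrC subrK.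
Qed.

End positive_gaps.

Lemma E1_gt0 (R : realType) (v : R) : 0 < v -> (0 < E1 v)%E.
Proof.
move=> v0; apply: (@le_lt_trans _ _ (E1 (v + 1))); last by apply: E1_lt; rewrite ?ltrDl.
by apply: E1_ge0; rewrite addr_ge0// ltW.
Qed.

(** Off ]0, +oo[ the set of preimages is empty, so that E1_inv is constant
    there; this makes E1_inv, and the Gamma integral with it, measurable. *)
Lemma E1_invE (R : realType) (s : R) :
  E1_inv s = if 0 < s then jump s else E1_inv 0.
Proof.
rewrite /jump; have [//|s0] := ltP 0 s.
have none (r : R) : r <= 0 -> [set v : R | 0 < v /\ E1 v = r%:E] = set0.
  move=> r0; rewrite -subset0 => v /= [/E1_gt0 + Ev].
  by rewrite Ev lte_fin ltNge r0.
by rewrite /E1_inv !none.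
Qed.

Lemma measurable_E1_inv (R : realType) : measurable_fun [set: R] (@E1_inv R).
Proof.
rewrite (_ : @E1_inv R = fun s => if 0 < s then jump s else E1_inv 0); last first.
  by apply/funext => s; exact: E1_invE.
apply: measurable_fun_ifT => //; last exact: measurable_jump.
exact: measurable_fun_ltr.
Qed.

(** * Moments of the Gamma integral *)

Lemma half_room (R : realType) (s : R) : 0 <= s -> s * (2 * (s + 1))^-1 <= 2^-1.
Proof.
move=> s0; rewrite invfM mulrCA ger_pMr ?invr_gt0//.
by rewrite ler_pdivrMr ?mul1r ?lerDl// ltr_wpDl.
Qed.

Section gamma_moments.
Context {R : realType} {dL dO : measure_display}.
Context {L : measurableType dL} {Omega : measurableType dO}.
Variables (lam : {sigma_finite_measure set L -> \bar R}).
Variables (P : probability Omega R) (q : L -> R).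
Variables (tau : nat -> {RV P >-> R}) (U : nat -> {RV P >-> L}) (f : L -> R).
Hypothesis rep : gamma_representation lam q tau U.
Hypothesis mf : measurable_fun [set: L] f.
Hypothesis ex : gamma_integral_exists P q tau U f.
Local Open Scope ereal_scope.
Local Notation e := (gap tau).
Local Notation Q := (distribution P (U 0%N)).
Local Notation S := (gamma_integral q tau U f).
Local Notation Sum := (mark_sum e U).
Local Notation jumps f := (jump_of q (fun x => `|f x|%R)).

Let mq : measurable_fun [set: L] q := density_measurable rep.
Let q_gt0 : forall x, (0 < q x)%R := density_gt0 rep.

Let QE A : measurable A -> Q A = \int[lam]_(x in A) (q x)%:E.
Proof. exact: (marks_iid rep).2. Qed.

Let me n : measurable_fun [set: Omega] (e n).
Proof. exact: measurable_gap. Qed.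

Let mU n : measurable_fun [set: Omega] (U n).
Proof. by []. Qed.

Let e_gt0 n w : (0 < e n w)%R.
Proof. exact: gap_gt0. Qed.

Let step : renewal_property e U P Q.
Proof.
apply: gaps_marks_renewal => //.
- exact/gap_independent/(arrivals_Poisson rep).
- exact: (marks_iid rep).1.
- exact/gap_mark_independent/(arrivals_marks_independent rep).
- by move=> n A mA; apply: gap_exponential mA; exact: arrivals_Poisson rep.
- move=> n A mA; rewrite -[LHS]/(distribution P (U n) A).
  by rewrite (marks_iid rep).2// -QE.
Qed.

(** Almost surely the arrival times are the partial sums of the gaps and are
    positive, where E1_inv and jump agree. *)
Let series_mark_sum : {ae P, forall w,
  series (gamma_term q tau U f w) = (fun n => Sum (jump_of q f) n w) /\
  [normed series (gamma_term q tau U f w)] = (fun n => Sum (jumps f) n w)}.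
Proof.
apply: filterS (interarrival_gt0 (arrivals_Poisson rep)) => w pos.
have termE n : gamma_term q tau U f w n = jump_of q f (marked_point e U n w).
  rewrite /gamma_term /jump_of /marked_point arrival_gap//= E1_invE mulr_gt0//.
  rewrite -(arrival_gap n pos) arrivalS ltr_wpDl//.
  by apply: sumr_ge0 => i _; exact: ltW.
split; apply/funext => n.
  by rewrite seriesEord/=; apply: eq_bigr => i _; exact: termE.
by rewrite /= seriesEord/=; apply: eq_bigr => i _; rewrite termE normr_jump_of.
Qed.

Let SE : {ae P, forall w, Sum (jump_of q f) n w @[n --> \oo] --> S w}.
Proof.
apply: filterS2 series_mark_sum ex => w [sE _] /normed_cvg; rewrite sE => c.
by rewrite /gamma_integral sE.
Qed.

Let bounded : {ae P, forall w, exists m : nat, forall N, (Sum (jumps f) N w <= m%:R)%R}.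
Proof.
apply: filterS2 series_mark_sum ex => w [_ ->] c.
exists (Num.truncn (limn (fun n => Sum (jumps f) n w))).+1 => N.
apply: le_trans (ltW (truncnS_gt _)); apply: nondecreasing_cvgn_le => // m n mn.
by apply: mark_sum_le => // z; exact: jump_of_ge0.
Qed.

Lemma measurable_gamma_integral : measurable_fun [set: Omega] S.
Proof.
apply: (measurable_limn (u := fun n w => series (gamma_term q tau U f w) n)) => n.
rewrite (_ : (fun w => _) = fun w => \sum_(i < n) gamma_term q tau U f w i)%R; last first.
  by apply/funext => w; rewrite seriesEord.
apply: measurable_sum => i; apply: measurable_funM; last exact: measurableT_comp.
apply: (measurableT_comp (@measurable_E1_inv R)); apply: measurable_funM => //.
exact: measurableT_comp.
Qed.

Let mS := measurable_gamma_integral.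

Lemma gamma_moment_le (s p : R) : (0 < p)%R -> lam (supp f) = s%:E ->
  \int[P]_w (`|S w| `^ p)%:E <=
  (moment_const s (Num.truncn p) p)%:E * \int[lam]_u (`|f u| `^ p)%:E.
Proof.
move=> p0 sE; apply: (moment_limit me mU mq mf mS SE) => // N.
apply: (moment_le_const me mU e_gt0 step mq q_gt0 QE) => //.
by rewrite p0/= ltW// truncnS_gt.
Qed.

Definition lower_const (K p : R) : R := (K * jump K `^ p / (8 * 2 `^ p))%R.

Lemma lower_const_gt0 K p : (0 < K)%R -> (0 < lower_const K p)%R.
Proof. by move=> K0; rewrite divr_gt0 ?mulr_gt0 ?powR_gt0 ?jump_gt0. Qed.

Lemma gamma_moment_ge (A : set L) (K p : R) : (0 < p)%R -> (0 < K)%R ->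
  measurable A -> lam A * K%:E <= 2^-1%:E ->
  (lower_const K p)%:E * \int[lam]_(u in A) (`|f u| `^ p)%:E <=
  \int[P]_w (`|S w| `^ p)%:E.
Proof.
move=> p0 K0 mA AK; rewrite /lower_const mulrC EFinM -muleA.
have c0 : (0 < 8 * 2 `^ p)%R by rewrite mulr_gt0 ?powR_gt0.
rewrite lee_pdivrMl//.
exact: (lower_moment me mU e_gt0 step mq q_gt0 QE mf mS SE p0 K0 mA AK).
Qed.

Lemma gamma_moment_large_part (p c : R) : (0 < p)%R -> (0 < c)%R ->
  \int[P]_w (`|S w| `^ p)%:E < +oo ->
  \int[lam]_(x in [set x | (`|f x| > c)%R]) (`|f x| `^ p)%:E < +oo.
Proof.
move=> p0 c0 SP; pose A := [set x | (`|f x| > c)%R].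
have Afin : lam A < +oo.
  exact: (large_part_finite me mU e_gt0 step mq q_gt0 QE mf bounded).
have mA : measurable A by exact: measurable_large.
pose s := fine (lam A); have sE : lam A = s%:E by rewrite fineK// ge0_fin_numE.
have s0 : (0 <= s)%R by exact: fine_ge0.
pose K := (2 * (s + 1))^-1%R; have K0 : (0 < K)%R by rewrite invr_gt0 mulr_gt0// ltr_wpDl.
have AK : lam A * K%:E <= 2^-1%:E by rewrite sE -EFinM lee_fin half_room.
have := gamma_moment_ge p0 K0 mA AK; have := lower_const_gt0 p K0.
move=> l0 /le_lt_trans/(_ SP); case: (\int[lam]_(u in A) _) => //=; first by move=> r _; rewrite ltry.
  by rewrite gt0_muley ?lte_fin.
Qed.

Lemma gamma_moment_finite (p c : R) : (0 < p)%R -> (0 < c)%R ->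
  \int[lam]_(x in [set x | (`|f x| > c)%R]) (`|f x| `^ p)%:E < +oo ->
  \int[P]_w (`|S w| `^ p)%:E < +oo.
Proof.
move=> p0 c0 large.
apply: (moment_of_large_part me mU e_gt0 step mq q_gt0 QE mf mS SE bounded p0).
exact: (large_part_threshold me mU e_gt0 step mq q_gt0 QE mf bounded p0 c0 ltr01 large).
Qed.

Lemma gamma_small_part (c : R) : (0 < c)%R ->
  \int[lam]_(x in [set x | (`|f x| <= c)%R]) (`|f x|)%:E < +oo.
Proof. exact: (small_part_integrable me mU e_gt0 step mq q_gt0 QE mf bounded). Qed.

End gamma_moments.

Section pnorm_bounds.
Context {R : realType}.
Local Open Scope ereal_scope.

(** The power 1/p that turns a p-th moment into a norm; for p < 1 the F-norm is
    the moment itself. *)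
Definition root (p a : R) : R := if (1 <= p)%R then (a `^ p^-1)%R else a.
Definition eroot (p : R) (x : \bar R) : \bar R := if (1 <= p)%R then x `^ p^-1 else x.

Lemma root_gt0 p a : (0 < a)%R -> (0 < root p a)%R.
Proof. by move=> a0; rewrite /root; case: ifP => // _; exact: powR_gt0. Qed.

Lemma pnormE d (T : measurableType d) (mu : {measure set T -> \bar R}) p (g : T -> R) :
  pnorm mu p g = eroot p (\int[mu]_x (`|g x| `^ p)%:E).
Proof. by rewrite /pnorm /eroot; case: ifP => // _; rewrite unlock. Qed.

Lemma erootM p (a : R) x : (0 <= a)%R -> 0 <= x ->
  eroot p (a%:E * x) = (root p a)%:E * eroot p x.
Proof.
move=> a0 x0; rewrite /eroot /root; case: ifP => // _.
by rewrite poweRM ?lee_fin.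
Qed.

Lemma le_eroot p x y : 0 <= x -> x <= y -> eroot p x <= eroot p y.
Proof.
move=> x0 xy; rewrite /eroot; case: ifPn => // p1.
apply: gt0_ler_poweR => //.
- by rewrite invr_ge0 (le_trans ler01).
- by rewrite in_itv/= x0 leey.
- by rewrite in_itv/= (le_trans x0 xy) leey.
Qed.

End pnorm_bounds.

Theorem theorem2p3 (R : realType) (p : R) (p_gt0 : 0 < p) :
  (forall s : R, exists c C : R, [/\ 0 < c, 0 < C &
    forall (dL dO : measure_display)
      (L : measurableType dL) (Omega : measurableType dO)
      (lam : {sigma_finite_measure set L -> \bar R})
      (P : probability Omega R) (q : L -> R)
      (tau : nat -> {RV P >-> R}) (U : nat -> {RV P >-> L}) (f : L -> R),
      Borel_space R L -> atomless lam ->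
      gamma_representation lam q tau U ->
      measurable_fun [set: L] f ->
      gamma_integral_exists P q tau U f ->
      lam (supp f) = s%:E ->
      (c%:E * pnorm lam p f <= pnorm P p (gamma_integral q tau U f))%E /\
      (pnorm P p (gamma_integral q tau U f) <= C%:E * pnorm lam p f)%E]) /\
  (forall (dL dO : measure_display)
      (L : measurableType dL) (Omega : measurableType dO)
      (lam : {sigma_finite_measure set L -> \bar R})
      (P : probability Omega R) (q : L -> R)
      (tau : nat -> {RV P >-> R}) (U : nat -> {RV P >-> L}) (f : L -> R),
      Borel_space R L -> atomless lam ->
      gamma_representation lam q tau U ->
      measurable_fun [set: L] f ->
      gamma_integral_exists P q tau U f ->
      let finite_moment :=
        ('E_P[(fun w => `|gamma_integral q tau U f w| `^ p)%R] < +oo)%E in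
      let cond_ab (c c' : R) :=
        (\int[lam]_(x in [set x | `|f x| <= c]%R) `|f x|%:E < +oo)%E /\
        (\int[lam]_(x in [set x | `|f x| > c']%R) (`|f x| `^ p)%:E < +oo)%E in
      (finite_moment <->
         exists c c' : R, [/\ 0 < c, 0 < c' & cond_ab c c']) /\
      (finite_moment <->
         forall c c' : R, 0 < c -> 0 < c' -> cond_ab c c')).
Proof.
split.
  move=> s; have [s0|s0] := leP 0 s; last first.
    exists 1, 1; split => // dL dO L Omega lam P q tau U f _ _ _ _ _ sE.
    have : (0 <= s%:E)%E by rewrite -sE measure_ge0.
    by rewrite lee_fin leNgt s0.
  (* the summand 1 keeps K positive for s = 0 *)
  pose K := (2 * (s + 1))^-1.
  have K0 : 0 < K by rewrite invr_gt0 mulr_gt0// ltr_wpDl.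
  (* the summand 1 makes the upper constant positive *)
  pose c := lower_const K p; pose C := moment_const s (Num.truncn p) p + 1.
  have c0 : 0 < c by exact: lower_const_gt0.
  have m0 : 0 <= moment_const s (Num.truncn p) p by exact: moment_const_ge0.
  have C0 : 0 < C by rewrite ltr_wpDl.
  exists (root p c), (root p C); split; [exact: root_gt0|exact: root_gt0|].
  move=> dL dO L Omega lam P q tau U f _ _ rep mf ex sE; rewrite !pnormE.
  set I := (\int[lam]_x _)%E; set E := (\int[P]_x _)%E.
  have I0 : (0 <= I)%E by apply: integral_ge0 => x _; rewrite lee_fin powR_ge0.
  have E0 : (0 <= E)%E by apply: integral_ge0 => x _; rewrite lee_fin powR_ge0.
  rewrite -!erootM ?(ltW c0) ?(ltW C0)//; split; apply: le_eroot => //.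
  - by rewrite mule_ge0 ?lee_fin ?(ltW c0).
  - have mA := measurable_supp mf.
    have IE : I = (\int[lam]_(x in supp f) (`|f x| `^ p)%:E)%E.
      rewrite [RHS]integral_mkcond; apply: eq_integral => x _.
      rewrite patchE; case: ifPn => //; rewrite notin_setE /supp/= => /negP/negPn/eqP ->.
      by rewrite normr0 powR0// gt_eqF.
    rewrite IE; apply: (gamma_moment_ge rep mf ex) => //.
    by rewrite sE -EFinM lee_fin half_room.
  - apply: le_trans (gamma_moment_le rep mf ex p_gt0 sE) _.
    by apply: lee_wpmul2r => //; rewrite lee_fin lerDl.
move=> dL dO L Omega lam P q tau U f _ _ rep mf ex fm ab.
have fmE : fm <-> (\int[P]_w (`|gamma_integral q tau U f w| `^ p)%:E < +oo)%E.
  by rewrite /fm unlock.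
have toall : fm -> forall c c' : R, 0 < c -> 0 < c' -> ab c c'.
  move=> /fmE h c c' c0 c'0; split; first exact: (gamma_small_part rep mf ex).
  exact: (gamma_moment_large_part rep mf ex).
have ofsome c c' : 0 < c' -> ab c c' -> fm.
  by move=> c'0 [_ h]; apply/fmE; exact: (gamma_moment_finite rep mf ex p_gt0 c'0 h).
split; split.
- by move=> /toall h; exists 1, 1; split => //; exact: h.
- by move=> [c [c' [_ c'0]]]; exact: ofsome.
- exact: toall.
- by move=> h; apply: (@ofsome 1 1) => //; exact: h.
Qed.
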